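(* Let $(\mathfrak{A}_\infty,\mathscr{H}_\infty,D_\infty)$ be a metric spectral triple which is the inductive limit of a sequence of metric spectral triples $(\mathfrak{A}_n,\mathscr{H}_n,D_n)_{n\in\mathbb{N}}$. For each $n\in\mathbb{N}\cup\{\infty\}$, let $$\mathrm{dom}(\mathsf{L}_n):=\{a\in\mathfrak{sa}(\mathfrak{A}_n): a\,\mathrm{dom}(D_n)\subseteq\mathrm{dom}(D_n)\text{ and }[D_n,a]\text{ is bounded}\},$$ and for all $a\in\mathrm{dom}(\mathsf{L}_n)$ let $\mathsf{L}_n(a)$ be the operator norm of $[D_n,a]$ on $\mathscr{H}_n$. If there exists a full quantum isometry $\pi:(\mathfrak{A}_\infty,\mathsf{L}_\infty)\to(\mathfrak{A}_\infty,\mathsf{L}_\infty)$ which is also a bridge builder for $((\mathfrak{A}_n,\mathsf{L}_n)_{n\in\mathbb{N}},(\mathfrak{A}_\infty,\mathsf{L}_\infty))$, then $$\lim_{n\to\infty}\mathsf{\Lambda}^{\mathsf{spec}}\big((\mathfrak{A}_n,\mathscr{H}_n,D_n),(\mathfrak{A}_\infty,\mathscr{H}_\infty,D_\infty)\big)=0.$$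
   Context: Fix constants $\Omega\geq1$, $\Omega'\geq0$, $\Omega_{\mathrm{mod}}\geq2$, $\Omega_{\mathrm{inner}}\geq1$ once and for all; all quantum compact metric spaces and metrical C*-correspondences use these constants. $\mathbb{N}$ contains $0$. $\mathscr{S}(\mathfrak{A})$ is the state space and $\mathfrak{sa}(\mathfrak{A})$ the self-adjoint part of a unital C*-algebra $\mathfrak{A}$; $\Re a=\frac{a+a^*}2$, $\Im a=\frac{a-a^*}{2i}$. Quantum compact metric space: a pair $(\mathfrak{A},\mathsf{L})$, $\mathfrak{A}$ a unital C*-algebra, $\mathsf{L}$ a seminorm on a dense Jordan-Lie subalgebra $\mathrm{dom}(\mathsf{L})$ of $\mathfrak{sa}(\mathfrak{A})$ (closed under $\Re(ab)$, $\Im(ab)$) with: $\{\mathsf{L}=0\}=\mathbb{R}1$; $\mathsf{mk}_{\mathsf{L}}(\varphi,\psi)=\sup\{|\varphi(a)-\psi(a)|:a\in\mathrm{dom}(\mathsf{L}),\mathsf{L}(a)\leq1\}$ is a metric on $\mathscr{S}(\mathfrak{A})$ inducing the weak-$*$ topology; $\max\{\mathsf{L}(\Re(ab)),\mathsf{L}(\Im(ab))\}\leq\Omega(\|a\|\mathsf{L}(b)+\mathsf{L}(a)\|b\|)+\Omega'\mathsf{L}(a)\mathsf{L}(b)$ for $a,b\in\mathrm{dom}(\mathsf{L})$; $\{\mathsf{L}\leq1\}$ is closed in $\mathfrak{A}$. Convention: $\mathsf{L}(a)=\infty$ for $a\notin\mathrm{dom}(\mathsf{L})$. Quantum isometry $\pi:(\mathfrak{A}_1,\mathsf{L}_1)\to(\mathfrak{A}_2,\mathsf{L}_2)$: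 surjective $*$-morphism with $\pi(\mathrm{dom}(\mathsf{L}_1))\subseteq\mathrm{dom}(\mathsf{L}_2)$ and $\mathsf{L}_2(b)=\inf\{\mathsf{L}_1(a):\pi(a)=b\}$ for all $b\in\mathrm{dom}(\mathsf{L}_2)$. Full quantum isometry: a bijective quantum isometry whose inverse is a quantum isometry; equivalently a $*$-isomorphism with $\mathsf{L}_2\circ\pi=\mathsf{L}_1$ on $\mathfrak{sa}(\mathfrak{A}_1)$. Tunnel between $(\mathfrak{A}_1,\mathsf{L}_1)$ and $(\mathfrak{A}_2,\mathsf{L}_2)$: $(\mathfrak{D},\mathsf{L}_{\mathfrak{D}},\pi_1,\pi_2)$ with $(\mathfrak{D},\mathsf{L}_{\mathfrak D})$ a quantum compact metric space and $\pi_j:(\mathfrak{D},\mathsf{L}_{\mathfrak{D}})\to(\mathfrak{A}_j,\mathsf{L}_j)$ quantum isometries; its extent is $\chi=\max_{j}\mathsf{Haus}[\mathsf{mk}_{\mathsf{L}_{\mathfrak{D}}}](\{\varphi\circ\pi_j:\varphi\in\mathscr{S}(\mathfrak{A}_j)\},\mathscr{S}(\mathfrak{D}))$ (Hausdorff distance). Bridge builder for $((\mathfrak{A}_n,\mathsf{L}_n)_{n\in\mathbb{N}},(\mathfrak{A}_\infty,\mathsf{L}_\infty))$ (where $(\mathfrak{A}_n)_{n\in\mathbb N}$ is an increasing sequence of C*-subalgebras with dense union in $\mathfrak{A}_\infty$ and the unit of $\mathfrak{A}_\infty$ in $\mathfrak{A}_0$): a $*$-automorphism $\pi$ of $\mathfrak{A}_\infty$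 such that for all $\varepsilon>0$ there is $N$ such that for all $n\geq N$: $\forall a\in\mathrm{dom}(\mathsf{L}_\infty)\ \exists b\in\mathrm{dom}(\mathsf{L}_n)$ with $\mathsf{L}_n(b)\leq\mathsf{L}_\infty(a)$, $\|\pi(a)-b\|<\varepsilon\mathsf{L}_\infty(a)$; and $\forall b\in\mathrm{dom}(\mathsf{L}_n)\ \exists a\in\mathrm{dom}(\mathsf{L}_\infty)$ with $\mathsf{L}_\infty(a)\leq\mathsf{L}_n(b)$, $\|\pi(a)-b\|<\varepsilon\mathsf{L}_n(b)$ (strict inequalities read as $\leq$ when the seminorm is $0$). Spectral triple $(\mathfrak{A},\mathscr{H},D)$: a unital C*-algebra $\mathfrak{A}$ of bounded operators on a Hilbert space $\mathscr{H}$ and a self-adjoint operator $D$ with dense domain $\mathrm{dom}(D)$ and compact resolvent such that $\{a\in\mathfrak{A}:a\,\mathrm{dom}(D)\subseteq\mathrm{dom}(D),[D,a]\text{ bounded}\}$ is a dense $*$-algebra in $\mathfrak{A}$. It is metric when $(\varphi,\psi)\mapsto\sup\{|\varphi(a)-\psi(a)|:a\in\mathfrak{A},\,a\,\mathrm{dom}(D)\subseteq\mathrm{dom}(D),\|[D,a]\|\leq1\}$ is a metric on $\mathscr{S}(\mathfrak{A})$ inducing the weak-$*$ topology; equivalently $(\mathfrak{A},\mathsf{L}_D)$ is a quantum compact metric space, where $\mathsf{L}_D(a)=\|[D,a]\|$ on $\{a\in\mathfrak{sa}(\mathfrak{A}):a\,\mathrm{dom}(D)\subseteq\mathrm{dom}(D),[D,a]\text{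 bounded}\}$. Inductive limit: let $\mathfrak{A}_\infty=\overline{\bigcup_n\mathfrak{A}_n}$ with $(\mathfrak{A}_n)_{n\in\mathbb{N}}$ an increasing sequence of C*-subalgebras and the unit of $\mathfrak{A}_\infty$ in $\mathfrak{A}_0$. A spectral triple $(\mathfrak{A}_\infty,\mathscr{H}_\infty,D_\infty)$ is the inductive limit of spectral triples $(\mathfrak{A}_n,\mathscr{H}_n,D_n)_{n\in\mathbb{N}}$ (coming from an inductive sequence, i.e. with $\mathscr{H}_n\subseteq\mathscr{H}_{n+1}$ and $D_{n+1}$ extending $D_n$) when $\mathscr{H}_\infty=\overline{\bigcup_n\mathscr{H}_n}$ with each $\mathscr{H}_n$ a Hilbert subspace of $\mathscr{H}_\infty$; the restriction of $D_\infty$ to $\mathrm{dom}(D_n)$ is $D_n$ for each $n\in\mathbb{N}$; and $\mathfrak{A}_n\mathscr{H}_n\subseteq\mathscr{H}_n$ for each $n\in\mathbb{N}$ (the action of $\mathfrak{A}_n$ on $\mathscr{H}_n$ being the restriction of that on $\mathscr{H}_\infty$). Metrical C*-correspondence $(\mathscr{M},\mathsf{DN},\mathfrak{A},\mathsf{L},\mathfrak{B},\mathsf{S})$: quantum compact metric spaces $(\mathfrak{A},\mathsf{L})$, $(\mathfrak{B},\mathsf{S})$; a right Hilbert $\mathfrak{B}$-module $\mathscr{M}$ with a unital $*$-morphism from $\mathfrak{A}$ to its adjointable operators; a norm $\mathsf{DN}$ on a dense subspace $\mathrm{dom}(\mathsf{DN})$ of $\mathscr{M}$ such that $\mathsf{DN}(\omega)\geq\|\omega\|_{\mathscr{M}}=\|\langle\omega,\omega\rangle\|^{1/2}$;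 $\{\mathsf{DN}\leq1\}$ is compact in $\mathscr{M}$; $\mathsf{DN}(a\omega)\leq\Omega_{\mathrm{mod}}(\|a\|+\mathsf{L}(a))\mathsf{DN}(\omega)$ for $a\in\mathrm{dom}(\mathsf{L})$; and $\max\{\mathsf{S}(\Re\langle\omega,\eta\rangle),\mathsf{S}(\Im\langle\omega,\eta\rangle)\}\leq\Omega_{\mathrm{inner}}\mathsf{DN}(\omega)\mathsf{DN}(\eta)$. For a metric spectral triple, $\mathrm{metCor}(\mathfrak{A},\mathscr{H},D):=(\mathscr{H},\mathsf{DN}_D,\mathfrak{A},\mathsf{L}_D,\mathbb{C},0)$ with $\mathsf{DN}_D(\xi)=\|\xi\|+\|D\xi\|$ on $\mathrm{dom}(D)$. Metrical quantum isometry from $(\mathscr{M}_1,\mathsf{DN}_1,\mathfrak{A}_1,\mathsf{L}_1,\mathfrak{B}_1,\mathsf{S}_1)$ to $(\mathscr{M}_2,\mathsf{DN}_2,\mathfrak{A}_2,\mathsf{L}_2,\mathfrak{B}_2,\mathsf{S}_2)$: $(\Pi,\pi,\theta)$ with $\Pi:\mathscr{M}_1\to\mathscr{M}_2$ continuous, surjective, $\mathbb{C}$-linear, $\pi:(\mathfrak{A}_1,\mathsf{L}_1)\to(\mathfrak{A}_2,\mathsf{L}_2)$ and $\theta:(\mathfrak{B}_1,\mathsf{S}_1)\to(\mathfrak{B}_2,\mathsf{S}_2)$ quantum isometries, $\Pi(a\omega)=\pi(a)\Pi(\omega)$, $\Pi(\omega b)=\Pi(\omega)\theta(b)$, $\theta(\langle\omega,\eta\rangle)=\langle\Pi(\omega),\Pi(\eta)\rangle$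 for $a\in\mathfrak{A}_1,b\in\mathfrak{B}_1,\omega,\eta\in\mathscr{M}_1$, $\Pi(\mathrm{dom}(\mathsf{DN}_1))\subseteq\mathrm{dom}(\mathsf{DN}_2)$, and $\mathsf{DN}_2(\omega)=\inf\{\mathsf{DN}_1(\eta):\eta\in\mathrm{dom}(\mathsf{DN}_1),\Pi(\eta)=\omega\}$ for $\omega\in\mathrm{dom}(\mathsf{DN}_2)$. Metrical tunnel $\tau$ from $\mathbb{M}_1$ to $\mathbb{M}_2$: a metrical C*-correspondence $(\mathscr{P},\mathsf{TN},\mathfrak{D},\mathsf{L}_{\mathfrak{D}},\mathfrak{E},\mathsf{L}_{\mathfrak{E}})$ with metrical quantum isometries $(\Pi_j,\pi_j,\theta_j)$ onto $\mathbb{M}_j$, $j=1,2$. Its extent $\chi(\tau)$ is the maximum of the extents of the tunnels $(\mathfrak{D},\mathsf{L}_{\mathfrak{D}},\pi_1,\pi_2)$ and $(\mathfrak{E},\mathsf{L}_{\mathfrak{E}},\theta_1,\theta_2)$. For metric spectral triples $(\mathfrak{A}_j,\mathscr{H}_j,D_j)$, $j=1,2$, and a metrical tunnel $\tau$ from $\mathrm{metCor}(\mathfrak{A}_1,\mathscr{H}_1,D_1)$ to $\mathrm{metCor}(\mathfrak{A}_2,\mathscr{H}_2,D_2)$, the $\varepsilon$-magnitude $\mu(\tau|\varepsilon)$ is the maximum of $\chi(\tau)$ and of the two numbers (for $\{j,k\}=\{1,2\}$) $$\sup_{\substack{\xi\in\mathrm{dom}(D_j)\\ \mathsf{DN}_{D_j}(\xi)\leq1}}\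 \inf_{\substack{\eta\in\mathrm{dom}(D_k)\\ \mathsf{DN}_{D_k}(\eta)\leq1}}\ \sup_{\substack{\omega\in\mathrm{dom}(\mathsf{TN}),\ \mathsf{TN}(\omega)\leq1\\ 0\leq t\leq 1/\varepsilon}}\big|\langle e^{itD_j}\xi,\Pi_j(\omega)\rangle_{\mathscr{H}_j}-\langle e^{itD_k}\eta,\Pi_k(\omega)\rangle_{\mathscr{H}_k}\big|.$$ The spectral propinquity $\mathsf{\Lambda}^{\mathsf{spec}}((\mathfrak{A}_1,\mathscr{H}_1,D_1),(\mathfrak{A}_2,\mathscr{H}_2,D_2))$ is the infimum of $\{\frac{\sqrt2}{2}\}\cup\{\varepsilon>0:\mu(\tau|\varepsilon)<\varepsilon\text{ for some such metrical tunnel }\tau\}$. *)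

(* Defs.v *)
From HB Require Import structures.
From mathcomp Require Import all_boot all_order all_algebra.
From mathcomp Require Import all_classical all_reals all_analysis.
From mathcomp Require Import complex.

Set Implicit Arguments.
Unset Strict Implicit.
Unset Printing Implicit Defensive.
Import Order.TTheory GRing.Theory Num.Theory numFieldNormedType.Exports.
Local Open Scope classical_set_scope.
Local Open Scope ring_scope.
Local Open Scope complex_scope.

(* Norms of the library over the field R[i] take values in R[i]; [cabs] and
   [nrm] are the same norms as elements of R. *)
Definition cabs (R : realType) (z : R[i]) : R := complex.Re `|z|.
Definition nrm (R : realType) (V : normedModType R[i]) (x : V) : R :=
  complex.Re `|x|.

(* MathComp has no common substructure of [algType] and [normedModType] (and
   Hierarchy Builder cannot add one below [numDomainType]), so the norm of a
   C*-algebra is a separate operation; the topology is that of [nspace A]. *)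
HB.mixin Record isPreCstarAlgebra (R : realType) A of GRing.Algebra R[i] A := {
  star : A -> A;
  starD : forall a b : A, star (a + b) = star a + star b;
  starZ : forall (k : R[i]) (a : A), star (k *: a) = (k^*)%C *: star a;
  starM : forall a b : A, star (a * b) = star b * star a;
  starK : forall a : A, star (star a) = a;
  anorm : A -> R;
  anorm_eq0 : forall a : A, anorm a = 0 -> a = 0;
  anormD : forall a b : A, anorm (a + b) <= anorm a + anorm b;
  anormZ : forall (k : R[i]) (a : A), anorm (k *: a) = cabs k * anorm a;
  anormM : forall a b : A, anorm (a * b) <= anorm a * anorm b;
  anorm_star : forall a : A, anorm (star a * a) = anorm a ^+ 2 }.

#[short(type="preCstarAlgType")]
HB.structure Definition PreCstarAlgebra (R : realType) :=
  {A of GRing.Algebra R[i] A & isPreCstarAlgebra R A}.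

Definition nspace (R : realType) (A : preCstarAlgType R) : Type := A.
HB.instance Definition _ (R : realType) (A : preCstarAlgType R) :=
  GRing.Lmodule.on (nspace A).

Section NSpace.
Variables (R : realType) (A : preCstarAlgType R).
Let nspace_norm (a : nspace A) : R[i] := (anorm (a : A))%:C.

Lemma nspace_normD a b : nspace_norm (a + b) <= nspace_norm a + nspace_norm b.
Proof. by rewrite -rmorphD lecR; exact: anormD. Qed.

Lemma nspace_normZ (k : R[i]) (a : nspace A) :
  nspace_norm (k *: a) = `|k| * nspace_norm a.
Proof.
by rewrite /nspace_norm [anorm _]anormZ rmorphM /= /cabs RRe_real// normr_real.
Qed.

Lemma nspace_norm_eq0 (a : nspace A) : nspace_norm a = 0 -> a = 0.
Proof. by move=> /(@complexI R) /anorm_eq0. Qed.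

HB.instance Definition _ := Lmodule_isNormed.Build R[i] (nspace A)
  nspace_normD nspace_normZ nspace_norm_eq0.
End NSpace.

HB.mixin Record PreCstarAlgebra_isComplete (R : realType) A
    of PreCstarAlgebra R A := {
  cstar_complete : forall F : set_system (nspace A),
    ProperFilter F -> cauchy F -> cvg F }.

#[short(type="cstarAlgType")]
HB.structure Definition CstarAlgebra (R : realType) :=
  {A of PreCstarAlgebra R A & PreCstarAlgebra_isComplete R A}.

Section Complex.
Variable R : realType.
Implicit Types z w : R[i].

Lemma cabs_eq0 z : cabs z = 0 -> z = 0.
Proof.
by move=> z0; apply/eqP; rewrite -normr_eq0 -(RRe_real (normr_real z)) -/(cabs z) z0.
Qed.

Lemma cabsD z w : cabs (z + w) <= cabs z + cabs w.
Proof.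
by rewrite -lecR rmorphD /= /cabs !RRe_real ?normr_real// ler_normD.
Qed.

Lemma cabsM z w : cabs (z * w) = cabs z * cabs w.
Proof.
by apply: (@complexI R); rewrite rmorphM /= /cabs !RRe_real ?normr_real// normrM.
Qed.

Lemma cabs_conj z : cabs z^* = cabs z.
Proof. by case: z => a b; rewrite /cabs !normc_def/= sqrrN. Qed.

Lemma conjc_mulC (k z : R[i]) : (k * z)^* = k^* * z^*.
Proof. exact: rmorphM. Qed.

Let conjcM (z w : R[i]^o) : ((z * w)^* : R[i]^o) = w^* * z^*.
Proof. by rewrite mulrC; exact: rmorphM. Qed.

Let cabs_star (z : R[i]^o) : cabs (z^* * z) = cabs z ^+ 2.
Proof. by rewrite [LHS]cabsM cabs_conj expr2. Qed.

Let cabs_leM (z w : R[i]^o) : cabs (z * w) <= cabs z * cabs w.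
Proof. by rewrite [leLHS]cabsM. Qed.

HB.instance Definition _ := isPreCstarAlgebra.Build R (R[i]^o)
  (fun z w => rmorphD (@conjc R) z w) (fun k z => conjc_mulC k z)
  conjcM (@conjcK R) (fun z => @cabs_eq0 z) cabsD (fun z w => cabsM z w)
  cabs_leM cabs_star.

Lemma Re_le_cabs z : `|complex.Re z| <= cabs z.
Proof.
case: z => a b; rewrite /cabs normc_def /= -[leLHS]sqrtr_sqr.
by rewrite ler_wsqrtr// lerDl sqr_ge0.
Qed.

Lemma Im_le_cabs z : `|complex.Im z| <= cabs z.
Proof.
case: z => a b; rewrite /cabs normc_def /= -[leLHS]sqrtr_sqr.
by rewrite ler_wsqrtr// lerDr sqr_ge0.
Qed.

Lemma cabs_le z : cabs z <= `|complex.Re z| + `|complex.Im z|.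
Proof.
case: z => a b; rewrite /cabs normc_def /=.
rewrite -[leRHS]ger0_norm ?addr_ge0// -[leRHS]sqrtr_sqr ler_wsqrtr//.
rewrite sqrrD !real_normK ?num_real// addrAC lerDl.
by rewrite mulrn_wge0// mulr_ge0.
Qed.

Lemma complex_complete (F : set_system (nspace (R[i]^o))) :
  ProperFilter F -> cauchy F -> cvg F.
Proof.
move=> PF /cauchyP cF.
have part (p : R[i] -> R) : (forall z w, p (z - w) = p z - p w) ->
    (forall z, `|p z| <= cabs z) -> cvg ((p : nspace (R[i]^o) -> R) @ F).
  move=> pB ple; apply/cauchy_cvgP/cauchyP => e e0.
  have e0C : 0 < e%:C by rewrite ltcR.
  have [z Fz] := cF _ e0C; exists (p z).
  rewrite nbhs_simpl /=; apply: filterS Fz => w.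
  rewrite -ball_normE -ball_normE /ball_ /= ltcR => zw.
  by rewrite -pB; apply: le_lt_trans (ple _) zw.
have cR : cvg ((@complex.Re R : nspace (R[i]^o) -> R) @ F).
  by apply: part Re_le_cabs => -[? ?] [? ?].
have cI : cvg ((@complex.Im R : nspace (R[i]^o) -> R) @ F).
  by apply: part Im_le_cabs => -[? ?] [? ?].
set a := lim ((@complex.Re R : nspace (R[i]^o) -> R) @ F).
set b := lim ((@complex.Im R : nspace (R[i]^o) -> R) @ F).
apply/cvg_ex; exists ((a +i* b) : nspace (R[i]^o)).
apply/cvgrPdist_lt => e; rewrite ltcE /= => /andP[/eqP ei er].
have e2 : 0 < complex.Re e / 2 by rewrite divr_gt0.
have /cvgrPdist_lt/(_ _ e2) Fa := cR.
have /cvgrPdist_lt/(_ _ e2) Fb := cI.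
near=> z.
rewrite ltcE /= ei eqxx /=; apply: le_lt_trans (cabs_le _) _.
rewrite [X in _ < X]splitr; apply: ltrD.
- have -> : complex.Re ((a +i* b) - (z : R[i])) = a - complex.Re (z : R[i]).
    by case: (z : R[i]).
  near: z; exact: Fa.
- have -> : complex.Im ((a +i* b) - (z : R[i])) = b - complex.Im (z : R[i]).
    by case: (z : R[i]).
  near: z; exact: Fb.
Unshelve. all: by end_near. Qed.

HB.instance Definition _ :=
  PreCstarAlgebra_isComplete.Build R (R[i]^o) complex_complete.
End Complex.

Section Algebra.
Variable R : realType.
Implicit Types A B : cstarAlgType R.

Definition selfadjoint A : set A := [set a | star a = a].

Definition re_part A (a : A) : A := (2 : R[i])^-1 *: (a + star a).
Definition im_part A (a : A) : A := (2 * 'i%C : R[i])^-1 *: (a - star a).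

Definition star_preserving A B (f : A -> B) : Prop :=
  forall a, f (star a) = star (f a).

Definition state A : set (A -> R[i]^o) :=
  [set phi | [/\ linear phi, forall a, 0 <= (phi (star a * a) : R[i])
               & phi 1 = 1]].

(* [d] restricts to a (finite) metric on the state space whose topology is the
   weak-* topology, i.e. that of pointwise convergence on A. *)
Definition metrizes_weak_star A
    (d : (A -> R[i]^o) -> (A -> R[i]^o) -> \bar R) : Prop :=
  [/\ forall phi psi, state phi -> state psi -> d phi psi \is a fin_num,
      forall phi psi, state phi -> state psi -> d phi psi = 0%E <-> phi = psi,
      forall phi psi, state phi -> state psi -> d phi psi = d psi phi,
      forall phi psi chi, state phi -> state psi -> state chi ->
        (d phi chi <= d phi psi + d psi chi)%E
    & forall phi, state phi -> forall U : set (A -> R[i]^o),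
        within (@state A) (nbhs (phi : {ptws A -> R[i]^o})) U <->
        exists2 e : R, 0 < e &
          forall psi, state psi -> (d phi psi < e%:E)%E -> U psi].

Definition hausdorff T (d : T -> T -> \bar R) (X Y : set T) : \bar R :=
  Order.max
    (ereal_sup [set ereal_inf [set d x y | y in Y] | x in X])
    (ereal_sup [set ereal_inf [set d x y | x in X] | y in Y]).

End Algebra.

(* Only the values of [lip] on [ldom] are meaningful. *)
Record seminorm (R : realType) (A : cstarAlgType R) := Seminorm {
  ldom : set A;
  lip :> A -> R }.

Section Qcms.
Variable R : realType.
Implicit Types A B : cstarAlgType R.

Definition mk A (L : seminorm A) (phi psi : A -> R[i]^o) : \bar R :=
  ereal_sup [set (cabs (phi a - psi a))%:E
            | a in [set a | ldom L a /\ L a <= 1]].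

Record is_qcms (Om Om' : R) A (L : seminorm A) : Prop := IsQcms {
  qcms_sa : ldom L `<=` @selfadjoint R A;
  qcmsD : forall a b, ldom L a -> ldom L b -> ldom L (a + b);
  qcmsZ : forall (r : R) a, ldom L a -> ldom L (r%:C *: a);
  qcms_re : forall a b, ldom L a -> ldom L b -> ldom L (re_part (a * b));
  qcms_im : forall a b, ldom L a -> ldom L b -> ldom L (im_part (a * b));
  qcms_dense :
    @selfadjoint R A `<=` (closure (ldom L : set (nspace A)) : set A);
  qcms_ge0 : forall a, ldom L a -> 0 <= L a;
  qcms_tri : forall a b, ldom L a -> ldom L b -> L (a + b) <= L a + L b;
  qcms_hom : forall (r : R) a, ldom L a -> L (r%:C *: a) = `|r| * L a;
  qcms_ker : forall a, ldom L a /\ L a = 0 <-> exists r : R, a = r%:C%:A;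
  qcms_mk : metrizes_weak_star (mk L);
  qcms_leibniz : forall a b, ldom L a -> ldom L b ->
    Num.max (L (re_part (a * b))) (L (im_part (a * b)))
      <= Om * (anorm a * L b + L a * anorm b) + Om' * L a * L b;
  qcms_closed : closed ([set a | ldom L a /\ L a <= 1] : set (nspace A)) }.

Definition quantum_isometry A B (LA : seminorm A) (LB : seminorm B)
    (f : {lrmorphism A -> B}) : Prop :=
  [/\ star_preserving f,
      forall b, exists a, f a = b,
      forall a, ldom LA a -> ldom LB (f a)
    & forall b, ldom LB b ->
        (LB b)%:E = ereal_inf [set (LA a)%:E
                              | a in [set a | ldom LA a /\ f a = b]]].

Definition full_quantum_isometry A B (LA : seminorm A) (LB : seminorm B)
    (f : {lrmorphism A -> B}) : Prop :=
  quantum_isometry LA LB f /\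
  exists g : {lrmorphism B -> A},
    [/\ cancel f g, cancel g f & quantum_isometry LB LA g].

Definition extent D A1 A2 (L : seminorm D)
    (f1 : D -> A1) (f2 : D -> A2) : \bar R :=
  Order.max
    (hausdorff (mk L) [set phi \o f1 | phi in @state R A1] (@state R D))
    (hausdorff (mk L) [set phi \o f2 | phi in @state R A2] (@state R D)).

End Qcms.

(* The inner product of the library is linear in its first argument. *)
Record hilbertType (R : realType) := Hilbert {
  hspace :> completeNormedModType R[i];
  hdot : {dot hspace for Num.conj};
  hdotE : forall x, hdot x x = `|x| ^+ 2 }.

Record operator (R : realType) (H : hilbertType R) := Operator {
  odom : set H;
  oapp :> H -> H }.

Section Operators.
Variables (R : realType) (H : hilbertType R).
Implicit Type D : operator H.

Record self_adjoint D : Prop := SelfAdjoint {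
  sa_dom0 : odom D 0;
  sa_domP : forall (k : R[i]) x y,
    odom D x -> odom D y -> odom D (k *: x + y);
  sa_linear : forall (k : R[i]) x y,
    odom D x -> odom D y -> D (k *: x + y) = k *: D x + D y;
  sa_dense : closure (odom D) = setT;
  (* (y, z) is in the graph of the adjoint iff it is in the graph of D *)
  sa_adjoint : forall y z,
    (forall x, odom D x -> hdot H (D x) y = hdot H x z) <->
    (odom D y /\ D y = z) }.

Definition compact_resolvent D : Prop :=
  exists (z : R[i]) (T : {linear H -> H}),
    [/\ forall x, odom D (T x) /\ D (T x) - z *: T x = x,
        forall x, odom D x -> T (D x - z *: x) = x
      & precompact (T @` [set x | nrm x <= 1])].

Definition opnorm (X : set H) (T : H -> H) : \bar R :=
  ereal_sup [set (nrm (T x))%:E | x in [set x | X x /\ nrm x <= 1]].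

Definition commutator D (T : H -> H) : H -> H := fun x => D (T x) - T (D x).

(* The strongly continuous one-parameter unitary groups with generator iD. *)
Definition unitary_group D : set (R -> H -> H) :=
  [set U | [/\ forall t, linear (U t),
               forall t x, nrm (U t x) = nrm x,
               forall x, U 0 x = x,
               forall s t x, U (s + t) x = U s (U t x)
             & (forall x, continuous (fun t => U t x)) /\
               forall x y, (odom D x /\ D x = y) <->
                 (fun t : R => (t^-1)%:C *: (U t x - x)) @ 0^' --> ('i%C : R[i]) *: y]].

(* exp(itD); by Stone's theorem [unitary_group D] is a singleton when D is
   self-adjoint. *)
Definition expi D : R -> H -> H := xget (fun (_ : R) (x : H) => x) (unitary_group D).

End Operators.

Record spectralData (R : realType) := SpectralData {
  salg : cstarAlgType R;
  shil : hilbertType R;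
  sact : salg -> shil -> shil;
  dirac : operator shil }.

Section SpectralTriples.
Variable R : realType.
Implicit Type S : spectralData R.

Definition preserves_dom S (a : salg S) : Prop :=
  forall x, odom (dirac S) x -> odom (dirac S) (sact a x).

Definition commnorm S (a : salg S) : \bar R :=
  opnorm (odom (dirac S)) (commutator (dirac S) (sact a)).

Definition smooth S : set (salg S) :=
  [set a | preserves_dom a /\ (commnorm a < +oo)%E].

(* The C*-algebra of bounded operators on H is encoded as an abstract
   C*-algebra with an isometric unital *-representation on H. *)
Record spectral_triple S : Prop := SpectralTriple {
  st_linear : forall a : salg S, linear (sact a);
  st_actP : forall x, linear (fun a : salg S => sact a x);
  st_act1 : forall x, sact (1 : salg S) x = x;
  st_actM : forall (a b : salg S) x, sact (a * b) x = sact a (sact b x);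
  st_adjoint : forall (a : salg S) x y,
    hdot (shil S) (sact a x) y = hdot (shil S) x (sact (star a) y);
  st_isometric : forall a : salg S, opnorm setT (sact a) = (anorm a)%:E;
  st_self_adjoint : self_adjoint (dirac S);
  st_compact : compact_resolvent (dirac S);
  st_dense : closure (@smooth S : set (nspace (salg S))) = setT;
  (* closure of [smooth] under linear combinations and products is automatic *)
  st_star : forall a, @smooth S a -> smooth (star a) }.

Definition connes_dist S (phi psi : salg S -> R[i]^o) : \bar R :=
  ereal_sup [set (cabs (phi a - psi a))%:E
            | a in [set a : salg S | preserves_dom a /\ (commnorm a <= 1)%E]].

Definition metric_spectral_triple S : Prop :=
  spectral_triple S /\ metrizes_weak_star (@connes_dist S).

Definition lipD S : seminorm (salg S) :=
  Seminorm (@selfadjoint R (salg S) `&` @smooth S) (fun a => fine (commnorm a)).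

End SpectralTriples.

(* The inclusions of A_n in A_oo and of H_n in H_oo are represented by the
   embeddings [iota n] and [kappa n]. *)
Record inductive_limit (R : realType) (S : nat -> spectralData R)
    (Soo : spectralData R)
    (iota : forall n, {lrmorphism salg (S n) -> salg Soo})
    (kappa : forall n, {linear shil (S n) -> shil Soo}) : Prop :=
  InductiveLimit {
  il_star : forall n, star_preserving (iota n);
  il_inj : forall n, injective (iota n);
  il_incr : forall n, range (iota n) `<=` range (iota n.+1);
  il_dense :
    closure (\bigcup_n range (iota n) : set (nspace (salg Soo))) = setT;
  il_isometry : forall n x y,
    hdot (shil Soo) (kappa n x) (kappa n y) = hdot (shil (S n)) x y;
  il_hincr : forall n, range (kappa n) `<=` range (kappa n.+1);
  il_hdense : closure (\bigcup_n range (kappa n)) = setT;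
  il_extends : forall n x, odom (dirac (S n)) x ->
    exists y, [/\ odom (dirac (S n.+1)) y, kappa n.+1 y = kappa n x
                & kappa n.+1 (dirac (S n.+1) y) = kappa n (dirac (S n) x)];
  il_dirac : forall n x, odom (dirac (S n)) x ->
    odom (dirac Soo) (kappa n x) /\
    dirac Soo (kappa n x) = kappa n (dirac (S n) x);
  il_act : forall n (a : salg (S n)) x,
    sact (iota n a) (kappa n x) = kappa n (sact a x) }.

(* x < e * s, read as x <= 0 when s = 0 *)
Definition lt_scaled (R : realType) (x e s : R) : Prop :=
  if s == 0 then x <= 0 else x < e * s.

Definition bridge_builder (R : realType) (A : nat -> cstarAlgType R)
    (Aoo : cstarAlgType R) (L : forall n, seminorm (A n)) (Loo : seminorm Aoo)
    (iota : forall n, {lrmorphism A n -> Aoo}) (f : {lrmorphism Aoo -> Aoo}) :=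
  [/\ star_preserving f, bijective f
    & forall e : R, 0 < e -> exists N : nat, forall n, (N <= n)%N ->
      (forall a, ldom Loo a -> exists b,
         [/\ ldom (L n) b, L n b <= Loo a
           & lt_scaled (anorm (f a - iota n b)) e (Loo a)]) /\
      (forall b, ldom (L n) b -> exists a,
         [/\ ldom Loo a, Loo a <= L n b
           & lt_scaled (anorm (f a - iota n b)) e (L n b)])].

(* [minner] is linear in its second argument; [DN] is only meaningful on
   [mdom]. *)
Record correspondence (R : realType) := Correspondence {
  malg : cstarAlgType R;
  mbase : cstarAlgType R;
  malgL : seminorm malg;
  mbaseL : seminorm mbase;
  mspace :> completeNormedModType R[i];
  lact : malg -> mspace -> mspace;
  ract : mspace -> mbase -> mspace;
  minner : mspace -> mspace -> mbase;
  mdom : set mspace;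
  DN : mspace -> R }.

Section Correspondences.
Variable R : realType.
Implicit Type M : correspondence R.

Record hilbert_module M : Prop := HilbertModule {
  hm_ractP : forall b : mbase M, linear (fun w : M => ract w b);
  hm_ractPr : forall w : M, linear (ract w);
  hm_ract1 : forall w : M, ract w 1 = w;
  hm_ractM : forall (w : M) b c, ract w (b * c) = ract (ract w b) c;
  hm_innerP : forall w : M, linear (minner w);
  hm_innerM : forall (w e : M) b, minner w (ract e b) = minner w e * b;
  hm_innerC : forall w e : M, star (minner w e) = minner e w;
  hm_inner_ge0 : forall w : M, exists b, minner w w = star b * b;
  hm_norm : forall w : M, nrm w = Num.sqrt (anorm (minner w w)) }.

Record metrical_correspondence (Om Om' Omod Oinn : R) M : Prop :=
  MetricalCorrespondence {
  mc_algL : is_qcms Om Om' (malgL M);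
  mc_baseL : is_qcms Om Om' (mbaseL M);
  mc_module : hilbert_module M;
  mc_lactP : forall w : M, linear (fun a : malg M => lact a w);
  mc_lact1 : forall w : M, lact (1 : malg M) w = w;
  mc_lactM : forall (a b : malg M) (w : M), lact (a * b) w = lact a (lact b w);
  mc_adjoint : forall (a : malg M) (w e : M),
    minner (lact a w) e = minner w (lact (star a) e);
  mc_dom0 : mdom (0 : M);
  mc_domP : forall (k : R[i]) (w e : M),
    mdom w -> mdom e -> mdom (k *: w + e);
  mc_dense : closure (@mdom R M) = setT;
  mc_DN_tri : forall w e : M, mdom w -> mdom e -> DN (w + e) <= DN w + DN e;
  mc_DN_hom : forall (k : R[i]) (w : M), mdom w -> DN (k *: w) = cabs k * DN w;
  mc_DN_ge : forall w : M, mdom w -> nrm w <= DN w;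
  mc_compact : compact [set w : M | mdom w /\ DN w <= 1];
  mc_lact_leibniz : forall (a : malg M) (w : M), ldom (malgL M) a -> mdom w ->
    mdom (lact a w) /\ DN (lact a w) <= Omod * (anorm a + malgL M a) * DN w;
  mc_inner_leibniz : forall w e : M, mdom w -> mdom e ->
    [/\ ldom (mbaseL M) (re_part (minner w e)),
        ldom (mbaseL M) (im_part (minner w e))
      & Num.max (mbaseL M (re_part (minner w e)))
                (mbaseL M (im_part (minner w e))) <= Oinn * DN w * DN e] }.

Definition metrical_quantum_isometry (M1 M2 : correspondence R)
    (F : {linear M1 -> M2}) (f : {lrmorphism malg M1 -> malg M2})
    (g : {lrmorphism mbase M1 -> mbase M2}) : Prop :=
  [/\ continuous F /\ (forall e, exists w, F w = e),
      quantum_isometry (malgL M1) (malgL M2) f /\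
      quantum_isometry (mbaseL M1) (mbaseL M2) g,
      [/\ forall a w, F (lact a w) = lact (f a) (F w),
          forall w b, F (ract w b) = ract (F w) (g b)
        & forall w e, g (minner w e) = minner (F w) (F e)],
      forall w, mdom w -> mdom (F w)
    & forall e : M2, mdom e ->
        (DN e)%:E = ereal_inf [set (DN w)%:E
                              | w in [set w : M1 | mdom w /\ F w = e]]].

Record metrical_tunnel (Om Om' Omod Oinn : R) (M1 M2 : correspondence R) :=
  MetricalTunnel {
  tunnel :> correspondence R;
  tmod1 : {linear tunnel -> M1};
  talg1 : {lrmorphism malg tunnel -> malg M1};
  tbase1 : {lrmorphism mbase tunnel -> mbase M1};
  tmod2 : {linear tunnel -> M2};
  talg2 : {lrmorphism malg tunnel -> malg M2};
  tbase2 : {lrmorphism mbase tunnel -> mbase M2};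
  tunnelP : metrical_correspondence Om Om' Omod Oinn tunnel;
  tisom1 : metrical_quantum_isometry tmod1 talg1 tbase1;
  tisom2 : metrical_quantum_isometry tmod2 talg2 tbase2 }.

Definition tunnel_extent Om Om' Omod Oinn M1 M2
    (tau : metrical_tunnel Om Om' Omod Oinn M1 M2) : \bar R :=
  Order.max (extent (malgL tau) (talg1 tau) (talg2 tau))
            (extent (mbaseL tau) (tbase1 tau) (tbase2 tau)).

End Correspondences.

Section Propinquity.
Variable R : realType.
Implicit Type S : spectralData R.

(* The inner product is flipped, so as to be linear in its second argument. *)
Definition metCor S : correspondence R :=
  @Correspondence R (salg S) (R[i]^o : cstarAlgType R) (lipD S)
    (Seminorm (@selfadjoint R (R[i]^o : cstarAlgType R)) (fun=> 0))
    (shil S) (@sact R S) (fun x z => (z : R[i]) *: x)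
    (fun x y => hdot (shil S) y x)
    (odom (dirac S)) (fun x => nrm x + nrm (dirac S x)).

Definition orbit_gap S1 S2 (P : correspondence R) (F1 : P -> shil S1)
    (F2 : P -> shil S2) (e : R) : \bar R :=
  ereal_sup [set ereal_inf [set ereal_sup
      [set (cabs (hdot (shil S1) (expi (dirac S1) p.2 x) (F1 p.1)
                - hdot (shil S2) (expi (dirac S2) p.2 y) (F2 p.1)))%:E
      | p in [set p : P * R | [/\ mdom p.1, DN p.1 <= 1 & 0 <= p.2 <= e^-1]]]
    | y in [set y : metCor S2 | mdom y /\ DN y <= 1]]
  | x in [set x : metCor S1 | mdom x /\ DN x <= 1]].

Definition magnitude Om Om' Omod Oinn S1 S2
    (tau : metrical_tunnel Om Om' Omod Oinn (metCor S1) (metCor S2)) (e : R) :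
    \bar R :=
  Order.max (tunnel_extent tau)
    (Order.max (@orbit_gap S1 S2 tau (tmod1 tau) (tmod2 tau) e)
               (@orbit_gap S2 S1 tau (tmod2 tau) (tmod1 tau) e)).

Definition spectral_propinquity (Om Om' Omod Oinn : R) S1 S2 : R :=
  inf ([set Num.sqrt 2 / 2] `|`
       [set e : R | 0 < e /\
         exists tau : metrical_tunnel Om Om' Omod Oinn (metCor S1) (metCor S2),
           (magnitude tau e < e%:E)%E]).

End Propinquity.

(* Main.v *)
Require Import Defs.
From HB Require Import structures.
From mathcomp Require Import all_boot all_order all_algebra.
From mathcomp Require Import all_classical all_reals all_analysis.
From mathcomp Require Import complex.
From mathcomp Require Import ring lra.

(* Composing with the full quantum isometry, the bridge builder may be taken to be
   the identity: elements of A_oo and of A_n with the same Lipschitz bound are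
   uniformly close in norm.  The tunnel is then the direct sum A_oo + A_n with
   L(a, b) = max (L_oo a) (L_n b) (|a - b| / eps), acting on H_oo + H_n with
   TN(x, y) = max (DN_oo x) (DN_n y) (|x - y| / eps) over C + C with |z - w| / (2 eps).
   The orthogonal projection P_n of H_oo onto H_n intertwines D_oo and D_n and
   tends to 1 uniformly on the graph-norm ball of D_oo, which is compact; so x and
   P_n x are eps-close, which makes both projections of the tunnel isometric.
   As P_n also intertwines exp(itD_oo) and exp(itD_n), pairing x with P_n x
   bounds the orbit gap by eps for all times at once.  Extending states of A_n
   to A_oo bounds the extent. *)

Set Implicit Arguments.
Unset Strict Implicit.
Unset Printing Implicit Defensive.
Import Order.TTheory GRing.Theory Num.Theory numFieldNormedType.Exports.
Local Open Scope classical_set_scope.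
Local Open Scope ring_scope.
Local Open Scope complex_scope.

(** * Norms and inner products *)

(** [expi D] is the identity when [D] has no unitary group, so intertwining it with the projections
    has to cover that default too: it is shown that for all large n either both D_oo and D_n have a
    group or neither has. Operator norms of self-adjoint elements are read off their quadratic forms
    in the given isometric representations, and the bound |phi(a)| <= |a| for states comes from an
    explicit square root of 1 - x for |x| < 1. Finiteness of the diameter of the state space is used
    twice. It forces the kernel of the commutator seminorm to be scalar, and it bounds the cost of
    moving weight between the two summands of A_oo + A_n. The base carries 2 eps because an inner
    product is compared in two arguments, each costing eps. Every other estimate costs eps, so eps =
    e / 3 leaves a magnitude of at most 2e / 3. *)

Section Nrm.
Variables (R : realType) (V : normedModType R[i]).
Implicit Types x y : V.

Lemma normr_nrm x : `|x| = (nrm x)%:C.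
Proof. by rewrite /nrm RRe_real. Qed.

Lemma nrm_ge0 x : 0 <= nrm x.
Proof. by rewrite -ler0c -normr_nrm. Qed.

Lemma nrmD x y : nrm (x + y) <= nrm x + nrm y.
Proof. by rewrite -lecR rmorphD /= -!normr_nrm ler_normD. Qed.

Lemma nrmN x : nrm (- x) = nrm x.
Proof. by rewrite /nrm normrN. Qed.

Lemma nrm0 : nrm (0 : V) = 0.
Proof. by rewrite /nrm normr0. Qed.

Lemma nrm_eq0 x : nrm x = 0 -> x = 0.
Proof. by move=> x0; apply/eqP; rewrite -normr_eq0 normr_nrm x0. Qed.

Lemma cabsE (z : R[i]) : `|z| = (cabs z)%:C.
Proof. by rewrite /cabs RRe_real. Qed.

Lemma nrmZ (k : R[i]) x : nrm (k *: x) = cabs k * nrm x.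
Proof. by apply: complexI; rewrite rmorphM /= -!normr_nrm -cabsE normrZ. Qed.

Lemma cabs_real (r : R) : cabs r%:C = `|r|.
Proof. by rewrite /cabs normc_def /= expr0n /= addr0 sqrtr_sqr. Qed.

Lemma nrmZr (r : R) x : nrm (r%:C *: x) = `|r| * nrm x.
Proof. by rewrite nrmZ cabs_real. Qed.

Lemma nrmBC x y : nrm (x - y) = nrm (y - x).
Proof. by rewrite -nrmN opprB. Qed.

Lemma nrmB x y : nrm (x - y) <= nrm x + nrm y.
Proof. by apply: le_trans (nrmD _ _) _; rewrite nrmN. Qed.

Lemma nrm_tri (z x y : V) : nrm (x - y) <= nrm (x - z) + nrm (z - y).
Proof. by apply: le_trans (nrmD _ _); rewrite addrA subrK. Qed.

Lemma nrm_dist x y : `|nrm x - nrm y| <= nrm (x - y).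
Proof.
rewrite ler_norml; apply/andP; split.
  by have := nrmD (y - x) x; rewrite subrK (nrmBC y x); lra.
by have := nrmD (x - y) y; rewrite subrK; lra.
Qed.

(** Radii live in R[i], where 0 < e forces e to be real, so real radii describe the same
    neighbourhoods. *)
Lemma nbhs_nrmP x (A : set V) :
  nbhs x A <-> exists2 e : R, 0 < e & forall y, nrm (x - y) < e -> A y.
Proof.
split=> [/nbhs_ballP[e /= e0 xA]|[e e0 xA]].
  have er : e = (complex.Re e)%:C by rewrite RRe_real ?gtr0_real.
  exists (complex.Re e) => [|y xy]; first by rewrite -ltcR -er.
  by apply: xA; rewrite -ball_normE /ball_ /= normr_nrm er ltcR.
apply/nbhs_ballP; exists e%:C => /= [|y]; first by rewrite ltcR.
by rewrite -ball_normE /ball_ /= normr_nrm ltcR; exact: xA.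
Qed.

Lemma closure_nrmP (A : set V) x :
  closure A x <-> forall e : R, 0 < e -> exists2 y, A y & nrm (x - y) < e.
Proof.
split=> [Ax e e0|Ax B /nbhs_nrmP[e e0 xB]].
  have /Ax[y [Ay]] : nbhs x [set y | nrm (x - y) < e] by apply/nbhs_nrmP; exists e.
  by exists y.
by have [y Ay xy] := Ax e e0; exists y; split=> //; exact: xB.
Qed.

Lemma closed_nrmP (A : set V) :
  (forall x, (forall e : R, 0 < e -> exists2 y, A y & nrm (x - y) < e) -> A x) ->
  closed A.
Proof. by move=> h x /closure_nrmP /h. Qed.

Lemma cvg_nrmP T (F : set_system T) (f : T -> V) l : Filter F ->
  f @ F --> l <-> forall e : R, 0 < e -> \forall t \near F, nrm (l - f t) < e.
Proof.
move=> FF; split=> [fl e e0|fl A /nbhs_nrmP[e e0 lA]].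
  by apply: (fl [set y | nrm (l - y) < e]); apply/nbhs_nrmP; exists e.
by apply: filterS (fl e e0) => t /=; exact: lA.
Qed.

Lemma continuous_nrmP (f : R -> V) :
  continuous f <-> forall t (e : R), 0 < e ->
    exists2 d : R, 0 < d & forall s, `|t - s| < d -> nrm (f t - f s) < e.
Proof.
split=> [cf t e e0|cf t].
  have /cvg_nrmP/(_ e e0) := cf t.
  by move=> /nbhs_ballP[d /= d0 h]; exists d => // s ts; exact: h.
apply/cvg_nrmP => e e0; have [d d0 h] := cf t e e0.
by apply/nbhs_ballP; exists d => // s; exact: h.
Qed.

Lemma dnbhs_nrmP (f : R -> V) l :
  f @ 0^' --> l <-> forall e : R, 0 < e ->
    exists2 d : R, 0 < d & forall t, t != 0 -> `|t| < d -> nrm (l - f t) < e.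
Proof.
rewrite cvg_nrmP; split=> h e /h.
  move=> /nbhs_ballP[d /= d0 hd]; exists d => // t t0 td.
  by apply: hd => //; rewrite /ball /= sub0r normrN.
move=> [d d0 hd]; apply/nbhs_ballP; exists d => // t.
by rewrite /ball /= sub0r normrN => td t0; exact: hd.
Qed.

(** The net is extracted from the cover of the compact closure by balls, so its centres lie in the
    closure of K. *)
Lemma compact_net (K : set V) (e : R) : 0 < e -> precompact K ->
  exists s : seq V, forall x, K x -> exists2 y, y \in s & nrm (x - y) < e.
Proof.
move=> e0; rewrite precompactE compact_cover => cK.
have op (x : V) : closure K x -> open [set y | nrm (x - y) < e].
  move=> _; rewrite openE => y /= xy.
  apply/nbhs_nrmP; exists (e - nrm (x - y)) => [|z yz]; first by rewrite subr_gt0.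
  by apply: le_lt_trans (nrm_tri y _ _) _; rewrite addrC -ltrBrDr.
have [|s sK cov] := cK _ (closure K) (fun x => [set y | nrm (x - y) < e]) op.
  by move=> x Kx; exists x => //=; rewrite subrr nrm0.
exists (finmap.enum_fset s) => x /subset_closure /cov[y ys xy]; exists y => //.
by rewrite nrmBC.
Qed.
End Nrm.

Lemma Re_mulr (R : realType) (r : R) (w : R[i]) :
  complex.Re (r%:C * w) = r * complex.Re w.
Proof. by case: w => a b /=; rewrite mul0r subr0. Qed.

Lemma nspace_nrm (R : realType) (A : preCstarAlgType R) (a : nspace A) :
  nrm a = anorm (a : A).
Proof. by []. Qed.

Lemma nrm_cauchy_cvg (R : realType) (V : completeNormedModType R[i])
    (u : nat -> V) :
  (forall e : R, 0 < e -> exists N, forall m n, (N <= m)%N -> (N <= n)%N ->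
     nrm (u m - u n) < e) ->
  exists l, forall e : R, 0 < e -> exists N, forall n, (N <= n)%N ->
    nrm (l - u n) < e.
Proof.
move=> cu; have /cauchy_cvgP/cvg_ex[l ul] : cauchy (u @ \oo).
  apply/cauchy_ballP => e e0.
  have er : e = (complex.Re e)%:C by rewrite RRe_real ?gtr0_real.
  have [|N uN] := cu (complex.Re e); first by rewrite -ltcR -er.
  exists ([set u n | n in [set n | (N <= n)%N]], [set u n | n in [set n | (N <= n)%N]]).
    by split; exists N => // n /= Nn; exists n.
  move=> [x y] /= [[m Nm <-] [n Nn <-]].
  by rewrite -ball_normE /ball_ /= normr_nrm er ltcR; exact: uN.
exists l => e e0; have /cvg_nrmP/(_ e e0)[N _ h] := ul.
by exists N => n; exact: h.
Qed.

Section Hilbert.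
Variables (R : realType) (H : hilbertType R).
Implicit Types x y z : H.
Local Notation "<< x , y >>" := (hdot H x y).

Lemma hdotDl x y z : << x + y, z >> = << x, z >> + << y, z >>.
Proof. exact: linearDl. Qed.
Lemma hdotDr x y z : << z, x + y >> = << z, x >> + << z, y >>.
Proof. exact: linearDr. Qed.
Lemma hdotBl x y z : << x - y, z >> = << x, z >> - << y, z >>.
Proof. exact: linearBl. Qed.
Lemma hdotBr x y z : << z, x - y >> = << z, x >> - << z, y >>.
Proof. exact: linearBr. Qed.
Lemma hdotNl x z : << - x, z >> = - << x, z >>.
Proof. exact: linearNl. Qed.
Lemma hdotNr x z : << z, - x >> = - << z, x >>.
Proof. exact: linearNr. Qed.
Lemma hdot0l z : << 0, z >> = 0.
Proof. exact: linear0l. Qed.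
Lemma hdot0r z : << z, 0 >> = 0.
Proof. exact: linear0r. Qed.
Lemma hdotZl (k : R[i]) x z : << k *: x, z >> = k * << x, z >>.
Proof. exact: linearZl_LR. Qed.
Lemma hdotZr (k : R[i]) x z : << z, k *: x >> = conjc k * << z, x >>.
Proof. exact: linearZr_LR. Qed.
Lemma hdotC x y : << x, y >> = conjc << y, x >>.
Proof. by rewrite hermC /= expr0 mul1r. Qed.

Lemma hdotxx x : << x, x >> = (nrm x ^+ 2)%:C.
Proof. by rewrite hdotE normr_nrm rmorphXn. Qed.

Lemma rdotC x y : complex.Re << x, y >> = complex.Re << y, x >>.
Proof. by rewrite hdotC; case: (hdot H y x). Qed.

Lemma nrm_sqrD x y :
  nrm (x + y) ^+ 2 = nrm x ^+ 2 + nrm y ^+ 2 + 2 * complex.Re << x, y >>.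
Proof.
have := hdotxx (x + y); rewrite hdotDl !hdotDr !hdotxx => /(congr1 (@complex.Re R)).
by rewrite !raddfD /= (rdotC y x) => <-; ring.
Qed.

Lemma nrm_sqrB x y :
  nrm (x - y) ^+ 2 = nrm x ^+ 2 + nrm y ^+ 2 - 2 * complex.Re << x, y >>.
Proof. by rewrite nrm_sqrD nrmN hdotNr raddfN /= mulrN. Qed.

Lemma parallelogram x y :
  nrm (x + y) ^+ 2 + nrm (x - y) ^+ 2 = 2 * (nrm x ^+ 2 + nrm y ^+ 2).
Proof. by rewrite nrm_sqrD nrm_sqrB; ring. Qed.

Lemma cabs_sqr (w : R[i]) : w * conjc w = (cabs w ^+ 2)%:C.
Proof. by rewrite -sqr_normc cabsE rmorphXn. Qed.

Lemma cabs_ge0 (w : R[i]) : 0 <= cabs w.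
Proof. by rewrite -ler0c -cabsE. Qed.

Lemma rdot_le x y : complex.Re << x, y >> <= nrm x * nrm y.
Proof.
have [x0|x0] := eqVneq (nrm x) 0.
  by rewrite (nrm_eq0 x0) hdot0l nrm0 mul0r.
have [y0|y0] := eqVneq (nrm y) 0.
  by rewrite (nrm_eq0 y0) hdot0r nrm0 mulr0.
have xp : 0 < nrm x by rewrite lt_def x0 nrm_ge0.
have yp : 0 < nrm y by rewrite lt_def y0 nrm_ge0.
(* This square expands to 2|x||y| (|x||y| - Re<x, y>). *)
have := sqr_ge0 (nrm ((nrm y)%:C *: x - (nrm x)%:C *: y)).
rewrite nrm_sqrB !nrmZr hdotZl hdotZr conjc_real !ger0_norm ?nrm_ge0//.
have -> : complex.Re ((nrm y)%:C * ((nrm x)%:C * << x, y >>)) =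
   nrm y * (nrm x * complex.Re << x, y >>).
  by case: (hdot H x y) => a b /=; rewrite !mul0r !subr0.
move=> h; have {}h : 0 <= (nrm x * nrm y) * (nrm x * nrm y - complex.Re << x, y >>).
  by nra.
by move: h; rewrite pmulr_rge0 ?mulr_gt0// subr_ge0.
Qed.

Lemma cauchy_schwarz x y : cabs << x, y >> <= nrm x * nrm y.
Proof.
set w := << x, y >>.
have [w0|w0] := eqVneq (cabs w) 0; first by rewrite w0 mulr_ge0 ?nrm_ge0.
have wp : 0 < cabs w by rewrite lt_def w0 cabs_ge0.
(* Multiplying y by w = <x, y> makes the inner product the real number |w|^2. *)
have := rdot_le x (w *: y); rewrite hdotZr -/w mulrC cabs_sqr /= nrmZ.
by rewrite expr2 mulrCA ler_pM2l.
Qed.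

Lemma hdot_ext x y : (forall z, << z, x >> = << z, y >>) -> x = y.
Proof.
move=> h; apply/eqP; rewrite -subr_eq0; apply/eqP/nrm_eq0/eqP.
by rewrite -sqrf_eq0 -(inj_eq (@complexI R)) -hdotxx hdotBr h subrr.
Qed.

Lemma hdot_extl x y : (forall z, << x, z >> = << y, z >>) -> x = y.
Proof. by move=> h; apply: hdot_ext => z; rewrite hdotC h -hdotC. Qed.

Lemma nrm_dual_le (V : set H) x (c : R) : closure V = setT -> 0 <= c ->
  (forall z, V z -> cabs << x, z >> <= c * nrm z) -> nrm x <= c.
Proof.
move=> dV c0 h.
have [x0|x0] := eqVneq (nrm x) 0; first by rewrite x0.
have xp : 0 < nrm x by rewrite lt_def x0 nrm_ge0.
apply/ler_addgt0Pr => e e0.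
have : closure V x by rewrite dV.
have k0 : 0 < nrm x + c by rewrite ltr_wpDr.
(* With |x - z| = r the hypothesis gives |x|^2 <= c|x| + (|x| + c) r, and this accuracy makes the
   last term at most e|x|. *)
move=> /closure_nrmP/(_ (e * nrm x / (nrm x + c))) [|z Vz xz].
  by rewrite divr_gt0 ?mulr_gt0.
move: xz; rewrite ltr_pdivlMr// => xz.
have h1 := h _ Vz.
have h2 : nrm z <= nrm x + nrm (x - z).
  by have := nrmB x (x - z); rewrite opprB addrC subrK.
have h3 : nrm x ^+ 2 <= nrm x * nrm (x - z) + cabs << x, z >>.
  have -> : nrm x ^+ 2 = cabs << x, x >>.
    by rewrite hdotxx cabs_real ger0_norm ?sqr_ge0.
  rewrite -{2}[x](subrK z) hdotDr; apply: le_trans (cabsD _ _) _.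
  by rewrite lerD2r; exact: cauchy_schwarz.
have h4 : c * nrm z <= c * (nrm x + nrm (x - z)) by exact: ler_wpM2l.
have : nrm x * nrm x <= nrm x * (c + e) by nra.
by rewrite ler_pM2l.
Qed.
End Hilbert.

(** * Riesz representation and self-adjoint operators *)

(** Lets an approximation argument lose a fixed multiple of e instead of tuning each accuracy. *)
Lemma ler_eps (R : realType) (a b k : R) :
  0 <= k -> (forall e, 0 < e -> a <= b + k * e) -> a <= b.
Proof.
move=> k0 h; apply/ler_addgt0Pr => e e0.
have k1 : 0 < k + 1 by lra.
apply: le_trans (h (e / (k + 1)) _) _; first by rewrite divr_gt0.
by rewrite lerD2l mulrA ler_pdivrMr//; nra.
Qed.

Section Riesz.
Variables (R : realType) (H : hilbertType R).
Implicit Types x y z : H.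
Local Notation "<< x , y >>" := (hdot H x y).

Variables (V : set H) (f : H -> R[i]) (c : R).
Hypothesis V0 : V 0.
Hypothesis VP : forall (k : R[i]) x y, V x -> V y -> V (k *: x + y).
Hypothesis fP : forall (k : R[i]) x y, V x -> V y -> f (k *: x + y) = k * f x + f y.
Hypothesis fb : forall x, V x -> cabs (f x) <= c * nrm x.

(** If f = <., z>, then J x = |x - z|^2 - |z|^2, so the representing vector is found by minimising
    J. *)
Let J x := nrm x ^+ 2 - 2 * complex.Re (f x).
Let m := inf [set J x | x in V].

Let VD x y : V x -> V y -> V (x + y).
Proof. by move=> Vx Vy; rewrite -[x]scale1r; exact: VP. Qed.

Let VZ k x : V x -> V (k *: x).
Proof. by move=> Vx; rewrite -[_ *: _]addr0; exact: VP. Qed.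

Let f0 : f 0 = 0.
Proof.
have := fP 1 V0 V0; rewrite scale1r addr0 mul1r => h.
by apply: (@addrI _ (f 0)); rewrite -h addr0.
Qed.

Let fD x y : V x -> V y -> f (x + y) = f x + f y.
Proof. by move=> Vx Vy; rewrite -{1}[x]scale1r fP// mul1r. Qed.

Let fZ k x : V x -> f (k *: x) = k * f x.
Proof. by move=> Vx; rewrite -[_ *: _]addr0 fP// f0 addr0. Qed.

Let m_le x : V x -> m <= J x.
Proof.
move=> Vx; apply: ge_inf; last by exists x.
exists (- c ^+ 2) => _ [y Vy <-]; rewrite /J.
have h1 := fb Vy; have h2 := le_trans (ler_norm _) (Re_le_cabs (f y)).
by have := sqr_ge0 (nrm y - c); nra.
Qed.

Let minimizing e : 0 < e -> exists2 x, V x & J x < m + e.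
Proof.
move=> e0; have [|_ [x Vx <-] xm] := @inf_adherent R [set J x | x in V] e e0.
  split; first by exists (J 0), 0.
  exists m => _ [y Vy <-]; exact: m_le.
by exists x.
Qed.

(** Parallelogram law, with J bounded below by m at the midpoint of x and y. It makes minimising
    sequences Cauchy. *)
Let J_dist x y : V x -> V y ->
  nrm (x - y) ^+ 2 <= 2 * ((J x - m) + (J y - m)).
Proof.
move=> Vx Vy.
have Vh : V ((2^-1)%:C *: (x + y)) by exact/VZ/VD.
have := m_le Vh; rewrite /J nrmZr fZ; last exact: VD.
rewrite Re_mulr fD// raddfD /= exprMn.
have := parallelogram x y.
rewrite real_normK ?num_real//. have -> : (2^-1 : R) ^+ 2 = 4^-1 by field.
lra.
Qed.

Lemma riesz_subspace : exists z, forall x, V x -> f x = << x, z >>.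
Proof.
have mn (n : nat) : exists x, V x /\ J x < m + n.+1%:R^-1.
  by have [|x Vx xm] := @minimizing n.+1%:R^-1; [rewrite invr_gt0|exists x].
have [u /= uP] := choice mn.
have small (e : R) : 0 < e -> exists N, forall n, (N <= n)%N -> n.+1%:R^-1 < e.
  move=> e0; have [N _ NP] : \forall n \near \oo, n.+1%:R^-1 < e.
    exact: near_infty_natSinv_lt (PosNum e0).
  by exists N => n; exact: NP.
have [|z zP] := @nrm_cauchy_cvg R H u.
  move=> e e0; have [|N NP] := small (e ^+ 2 / 4); first by rewrite divr_gt0 ?exprn_gt0.
  exists N => i j Ni Nj.
  have [Vi ui] := uP i; have [Vj uj] := uP j.
  have h := J_dist Vi Vj; have si := NP _ Ni; have sj := NP _ Nj.
  rewrite -(@ltr_pXn2r _ 2)// ?nnegrE ?nrm_ge0 ?(ltW e0)//.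
  apply: le_lt_trans h _; move: ui uj si sj.
  move: (J (u i)) (J (u j)) (i.+1%:R^-1) (j.+1%:R^-1) (e ^+ 2) => a b p q r.
  lra.
have re w : V w -> complex.Re (f w) = complex.Re << w, z >>.
  move=> Vw; rewrite rdotC.
  set d := complex.Re << z, w >> - complex.Re (f w).
  (* First variation: m <= J (u n + t w) and J (u n) < m + e, while u n tends to z. *)
  have key t : 0 <= t ^+ 2 * nrm w ^+ 2 + 2 * t * d.
    apply: (@ler_eps _ _ _ (1 + 2 * `|t| * nrm w)) => [|e e0].
      by rewrite addr_ge0// !mulr_ge0// nrm_ge0.
    have [N1 N1P] := small _ e0; have [N2 N2P] := zP _ e0.
    pose n := maxn N1 N2.
    have [Vn un] := uP n.
    have {}un : J (u n) < m + e by apply: lt_trans un _; rewrite ltrD2l N1P ?leq_maxl.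
    have zn : nrm (z - u n) < e by rewrite N2P ?leq_maxr.
    have VW : V (u n + t%:C *: w) by apply: VD => //; exact: VZ.
    have := m_le VW; rewrite /J fD// ?fZ//; last exact: VZ.
    rewrite raddfD /= Re_mulr nrm_sqrD nrmZr hdotZr conjc_real Re_mulr.
    rewrite exprMn real_normK ?num_real//.
    have h : t * (complex.Re << u n, w >> - complex.Re << z, w >>) <= `|t| * (nrm w * e).
      apply: le_trans (ler_norm _) _; rewrite normrM ler_wpM2l//.
      rewrite -raddfB -hdotBl; apply: le_trans (Re_le_cabs _) _.
      apply: le_trans (cauchy_schwarz _ _) _; rewrite mulrC ler_wpM2l ?nrm_ge0//.
      by rewrite nrmBC ltW.
    move: un; rewrite /J /d; lra.
  have b1 : 0 < nrm w ^+ 2 + 1 by rewrite ltr_wpDl ?sqr_ge0.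
  (* At this t the quadratic is a negative multiple of d^2, which forces d = 0; the + 1 covers w =
     0. *)
  have := key (- d / (nrm w ^+ 2 + 1)).
  set b := nrm w ^+ 2 in b1 *.
  have -> : (- d / (b + 1)) ^+ 2 * b + 2 * (- d / (b + 1)) * d =
            - (d ^+ 2 * (b + 2) / (b + 1) ^+ 2).
    by field; rewrite gt_eqF.
  rewrite oppr_ge0 pmulr_lle0 ?invr_gt0 ?exprn_gt0//.
  rewrite pmulr_lle0; last by lra.
  by rewrite real_exprn_even_le0 ?num_real//= subr_eq0 => /eqP ->.
exists z => x Vx; apply/eqP; rewrite eq_complex re// eqxx /=.
(* The imaginary part at x is minus the real part at i x. *)
have := re _ (VZ 'i%C Vx); rewrite fZ// hdotZl.
case: (f x) => a b; case: (hdot H x z) => a' b' /=.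
by rewrite !mul0r !mul1r !sub0r => /oppr_inj ->.
Qed.
End Riesz.

Lemma contraction_adjoint (R : realType) (H1 H2 : hilbertType R) (K : {linear H1 -> H2}) :
  (forall x, nrm (K x) <= nrm x) ->
  exists Ks : {linear H2 -> H1}, forall x y, hdot H2 (K x) y = hdot H1 x (Ks y).
Proof.
move=> Kb.
have ex y : exists z, forall x, hdot H2 (K x) y = hdot H1 x z.
  have [//|//|k x x' _ _|x _|z zP] := @riesz_subspace R H1 setT
    (fun x => hdot H2 (K x) y) (nrm y).
  - by rewrite linearP hdotDl hdotZl.
  - apply: le_trans (cauchy_schwarz _ _) _; rewrite mulrC.
    by rewrite ler_wpM2l ?nrm_ge0.
  by exists z => x; exact: zP.
have [g gP] := choice ex.
have lin : linear g.
  move=> k x y; apply: hdot_ext => z.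
  by rewrite hdotDr hdotZr -!gP hdotDr hdotZr.
pose gM := GRing.isLinear.Build _ _ _ _ g lin.
pose gL : {linear H2 -> H1} := HB.pack g gM.
by exists gL.
Qed.

Section SelfAdjoint.
Variables (R : realType) (H : hilbertType R) (D : operator H).
Hypothesis sD : self_adjoint D.
Implicit Types x y z v : H.

Lemma sa_domD x y : odom D x -> odom D y -> odom D (x + y).
Proof. by move=> dx dy; rewrite -[x]scale1r; exact: sa_domP. Qed.

Lemma sa_domZ k x : odom D x -> odom D (k *: x).
Proof. by move=> dx; rewrite -[_ *: _]addr0; apply: sa_domP => //; exact: sa_dom0. Qed.

Lemma sa_D x y : odom D x -> odom D y -> D (x + y) = D x + D y.
Proof. by move=> dx dy; rewrite -{1}[x]scale1r sa_linear// scale1r. Qed.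

Lemma sa_0 : D 0 = 0.
Proof.
have := sa_D (sa_dom0 sD) (sa_dom0 sD); rewrite addr0 => h.
by apply: (@addrI _ (D 0)); rewrite -h addr0.
Qed.

Lemma sa_Z k x : odom D x -> D (k *: x) = k *: D x.
Proof.
move=> dx; rewrite -[_ *: _]addr0 sa_linear ?sa_0 ?addr0//.
exact: sa_dom0.
Qed.

Lemma sa_sym x y : odom D x -> odom D y -> hdot H (D x) y = hdot H x (D y).
Proof.
move=> dx dy; have /(sa_adjoint sD) h : odom D y /\ D y = D y by [].
exact: h.
Qed.

(** The functional v |-> <D v, x> is bounded, hence represented by some z; this puts (x, z) in the
    graph of the adjoint of D, which is that of D. *)
Lemma sa_dom_bounded x c : 0 <= c ->
  (forall v, odom D v -> cabs (hdot H (D v) x) <= c * nrm v) ->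
  odom D x /\ nrm (D x) <= c.
Proof.
move=> c0 h.
have [||k u v du dv|//|z zP] := @riesz_subspace R H (odom D)
    (fun v => hdot H (D v) x) c.
- exact: sa_dom0.
- exact: sa_domP.
- by rewrite sa_linear// hdotDl hdotZl.
have [dx Dx] : odom D x /\ D x = z by apply/(sa_adjoint sD) => v; exact: zP.
split=> //; apply: (nrm_dual_le (sa_dense sD)) => // v dv.
by rewrite hdotC cabs_conj Dx -zP// h.
Qed.

(** Only x itself is approximated, not D x. For y near x, <D v, x> is close to <v, D y>, so the
    functional v |-> <D v, x> is bounded by c - |x| and [sa_dom_bounded] applies. *)
Lemma graph_ball_closed x c :
  (forall e : R, 0 < e ->
     exists2 y, odom D y /\ nrm y + nrm (D y) <= c & nrm (x - y) < e) ->
  odom D x /\ nrm x + nrm (D x) <= c.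
Proof.
move=> h.
have xc : nrm x <= c.
  apply: (@ler_eps _ _ _ 1) => // e /h[y [_ yc] xy].
  have := nrm_ge0 (D y); have := nrm_dist x y; rewrite ler_norml => /andP[_]; lra.
suff [dx nx] : odom D x /\ nrm (D x) <= c - nrm x by split=> //; lra.
apply: sa_dom_bounded => [|v dv]; first by rewrite subr_ge0.
apply: (@ler_eps _ _ _ (nrm (D v) + nrm v)) => [|e e0].
  by rewrite addr_ge0 ?nrm_ge0.
have [y [dy yc] xy] := h _ e0.
rewrite -[x in hdot H _ x](subrK y) hdotDr; apply: le_trans (cabsD _ _) _.
rewrite (sa_sym dv dy).
have h1 := cauchy_schwarz (D v) (x - y); have h2 := cauchy_schwarz v (D y).
have h3 : nrm (D v) * nrm (x - y) <= nrm (D v) * e by rewrite ler_wpM2l ?nrm_ge0 ?ltW.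
have h4 : nrm v * nrm (D y) <= nrm v * (c - nrm x + e).
  rewrite ler_wpM2l ?nrm_ge0//.
  have := nrm_dist x y; rewrite ler_norml => /andP[_]; lra.
lra.
Qed.

Lemma graph_ball_compact : compact_resolvent D ->
  compact [set x | odom D x /\ nrm x + nrm (D x) <= 1].
Proof.
move=> [z [T [_ TD]]]; rewrite precompactE => cT.
(* On the graph-norm ball |D x - z x| <= 1 + |z|, and x = T (D x - z x), so the ball lies in k times
   the closure of the image of the unit ball under T. *)
pose k : R := 1 + cabs z.
have k0 : 0 < k by rewrite ltr_pwDl// cabs_ge0.
pose g (x : H) : H := k%:C *: x.
have cg : continuous g.
  move=> x; apply/cvg_nrmP => e e0; apply/nbhs_nrmP.
  exists (e / k) => [|y]; first by rewrite divr_gt0.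
  rewrite ltr_pdivlMr// /g -scalerBr nrmZr gtr0_norm// => h.
  by rewrite mulrC.
apply: (@subclosed_compact _ _ (g @` closure (T @` [set x | nrm x <= 1]))).
- by apply: closed_nrmP => x; exact: graph_ball_closed.
- by apply: continuous_compact => //; exact: continuous_subspaceT.
- move=> x [dx nx]; exists (k^-1%:C *: x); last first.
    by rewrite /g scalerA -rmorphM /= divff ?gt_eqF// scale1r.
  apply: subset_closure; exists (k^-1%:C *: (D x - z *: x)) => /=.
    rewrite nrmZr ger0_norm ?invr_ge0 ?(ltW k0)// ler_pdivrMl// mulr1.
    apply: le_trans (nrmB _ _) _; rewrite nrmZ /k.
    have := nrm_ge0 x; have := nrm_ge0 (D x); have := cabs_ge0 z; nra.
  by rewrite linearZ /= TD.
Qed.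
End SelfAdjoint.

Section Opnorm.
Variables (R : realType) (H : hilbertType R) (X : set H) (T : H -> H).
Hypothesis X0 : X 0.
Hypothesis XZ : forall (k : R[i]) x, X x -> X (k *: x).
Hypothesis TZ : forall (k : R[i]) x, X x -> T (k *: x) = k *: T x.

(** Homogeneity of T is asked on X only, because a commutator [D, a] is linear only on the domain of
    D. *)
Lemma opnorm_leP (c : R) : 0 <= c ->
  (opnorm X T <= c%:E)%E <-> forall x, X x -> nrm (T x) <= c * nrm x.
Proof.
move=> c0; split=> [h x Xx|h].
  have T0 : T 0 = 0 by have := TZ 0 X0; rewrite !scale0r.
  have [x0|x0] := eqVneq (nrm x) 0.
    by rewrite (nrm_eq0 x0) T0 nrm0 mulr0.
  have xp : 0 < nrm x by rewrite lt_def x0 nrm_ge0.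
  have : (nrm (T ((nrm x)^-1%:C *: x)))%:E \in
      [set (nrm (T x))%:E | x in [set x | X x /\ nrm x <= 1]].
    apply/mem_set; exists ((nrm x)^-1%:C *: x) => //; split; first exact: XZ.
    by rewrite nrmZr ger0_norm ?invr_ge0 ?nrm_ge0// mulVf.
  move=> /set_mem /ereal_sup_ubound /le_trans /(_ h).
  by rewrite lee_fin TZ// nrmZr ger0_norm ?invr_ge0 ?nrm_ge0// ler_pdivrMl// mulrC.
apply: ge_ereal_sup => _ [x [Xx x1] <-]; rewrite lee_fin.
apply: le_trans (h _ Xx) _; by rewrite ler_piMr.
Qed.

Lemma opnorm_ge0 : (0 <= opnorm X T)%E.
Proof.
apply: le_trans (ereal_sup_ubound _); last first.
  by exists 0 => //; split=> //; rewrite nrm0.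
by rewrite lee_fin nrm_ge0.
Qed.
End Opnorm.

(** * Unitary groups *)

Section MeanValue.
Variable R : realType.

Lemma is_derive_littleo (f : R -> R) (t l : R) :
  (forall e : R, 0 < e -> exists2 d : R, 0 < d & forall h, `|h| < d ->
     `|f (t + h) - f t - h * l| <= e * `|h|) ->
  is_derive t (1 : R) f l.
Proof.
move=> fl.
have cv : h^-1 *: ((f \o shift t) (h *: (1 : R)) - f t) @[h --> 0^'] --> l.
  apply/cvgrPdist_le => e e0; have [d d0 hd] := fl e e0.
  apply/nbhs_ballP; exists d => // h; rewrite /ball /= sub0r normrN => hd' h0.
  have hp : 0 < `|h| by rewrite normr_gt0.
  change (`|l - h^-1 * (f (h * 1 + t) - f t)| <= e).
  rewrite -(ler_pM2l hp) -normrM mulrBr mulrA divff// mul1r distrC.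
  by rewrite mulr1 addrC [h + t]addrC addrC [X in _ <= X]mulrC; exact: hd.
by apply: DeriveDef; [apply/cvg_ex; exists l|exact: cvg_lim cv].
Qed.

(** Pairing W with its own increment y = W h - W 0 reduces the vector inequality to the real mean
    value theorem: |y|^2 <= M |y| |h|. *)
Lemma mean_value_bound (H : hilbertType R) (W dW : R -> H) (h M : R) :
  (forall t (e : R), 0 < e -> exists2 d : R, 0 < d & forall k, `|k| < d ->
     nrm (W (t + k) - W t - k%:C *: dW t) <= e * `|k|) ->
  (forall s, `|s| <= `|h| -> nrm (dW s) <= M) ->
  nrm (W h - W 0) <= M * `|h|.
Proof.
move=> dWP dWM.
have [y yE] : exists y, y = W h - W 0 by eexists.
rewrite -yE.
pose f t := complex.Re (hdot H (W t) y).
have df (t : R) : is_derive t (1 : R) f (complex.Re (hdot H (dW t) y)).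
  apply: is_derive_littleo => e e0.
  have y1 : 0 < nrm y + 1 by rewrite ltr_wpDl// nrm_ge0.
  have [|d d0 hd] := dWP t (e / (nrm y + 1)); first by rewrite divr_gt0.
  exists d => // k /hd kd.
  have -> : f (t + k) - f t - k * complex.Re (hdot H (dW t) y) =
      complex.Re (hdot H (W (t + k) - W t - k%:C *: dW t) y).
    by rewrite !hdotBl hdotZl !raddfB /= Re_mulr.
  apply: le_trans (Re_le_cabs _) _; apply: le_trans (cauchy_schwarz _ _) _.
  have := nrm_ge0 y; move: kd; rewrite mulrAC ler_pdivlMr//.
  by have := nrm_ge0 (W (t + k) - W t - k%:C *: dW t); nra.
have cf a b : {within `[a, b], continuous f}.
  apply: continuous_subspaceT => t; apply: differentiable_continuous.
  by apply/derivable1_diffP; case: (df t).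
have fdist : `|f h - f 0| <= M * nrm y * `|h|.
  have bound s : `|s| <= `|h| -> `|complex.Re (hdot H (dW s) y)| <= M * nrm y.
    move=> sh; apply: le_trans (Re_le_cabs _) _; apply: le_trans (cauchy_schwarz _ _) _.
    by rewrite ler_wpM2r ?nrm_ge0// dWM.
  have [h0|h0] := leP 0 h.
    have [s /[!in_itv]/= /andP[s0 sh] ->] := MVT_segment h0 (fun x _ => df x) (cf 0 h).
    by rewrite subr0 normrM ler_wpM2r// bound// !ger0_norm.
  have [s /[!in_itv]/= /andP[hs s0] e] := MVT_segment (ltW h0) (fun x _ => df x) (cf h 0).
  rewrite distrC e sub0r normrM normrN ler_wpM2r// bound//.
  by rewrite !ler0_norm ?(ltW h0)// lerN2.
have [y0|y0] := eqVneq (nrm y) 0.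
  by rewrite y0 mulr_ge0//; apply: le_trans (nrm_ge0 _) (dWM h (lexx _)).
have yp : 0 < nrm y by rewrite lt_def y0 nrm_ge0.
rewrite -(ler_pM2r yp) mulrAC; apply: le_trans fdist.
by rewrite /f -raddfB -hdotBl -yE hdotxx /= ger0_norm ?sqr_ge0.
Qed.
End MeanValue.

Definition intertwines (R : realType) (H1 H2 : hilbertType R)
    (D1 : operator H1) (D2 : operator H2) (K : H1 -> H2) :=
  forall x, odom D1 x -> odom D2 (K x) /\ D2 (K x) = K (D1 x).

Section UnitaryGroup.
Variables (R : realType) (H : hilbertType R).
Implicit Types (U : R -> H -> H) (D : operator H).

(** Derivative i y at time 0 in multiplied-out form: there is no division, h = 0 is allowed, and
    isometries transport the estimate directly. *)
Definition has_velocity U (x y : H) := forall e : R, 0 < e ->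
  exists2 d : R, 0 < d & forall h, `|h| < d ->
    nrm (U h x - x - (h%:C * 'i%C) *: y) <= e * `|h|.

Lemma cvg_has_velocity U x y : U 0 x = x ->
  (fun t : R => (t^-1)%:C *: (U t x - x)) @ 0^' --> ('i%C : R[i]) *: y <->
  has_velocity U x y.
Proof.
move=> U0.
have E t : t != 0 -> nrm ('i%C *: y - (t^-1)%:C *: (U t x - x)) * `|t| =
    nrm (U t x - x - (t%:C * 'i%C) *: y).
  move=> t0; rewrite mulrC -nrmZr scalerBr !scalerA -rmorphM /= divff// scale1r.
  by rewrite nrmBC.
rewrite dnbhs_nrmP; split=> h e e0.
  have [d d0 hd] := h e e0; exists d => // t td.
  have [->|t0] := eqVneq t 0.
    by rewrite U0 subrr mul0r scale0r subr0 nrm0 normr0 mulr0.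
  by rewrite -E// ler_wpM2r// ltW// hd.
(* Halving e turns the weak inequality of [has_velocity] into the strict one of the limit. *)
have [|d d0 hd] := h (e / 2); first by rewrite divr_gt0.
exists d => // t t0 td; apply: le_lt_trans (_ : e / 2 < e); last first.
  by rewrite ltr_pdivrMr// ltr_pMr// ltr1n.
by have := hd _ td; rewrite -E// ler_pM2r// normr_gt0.
Qed.

Section Fixed.
Variables (U : R -> H -> H) (D : operator H).
Hypothesis UD : unitary_group D U.

Lemma ug_linear t : linear (U t). Proof. by case: UD. Qed.
Lemma ug_nrm t x : nrm (U t x) = nrm x. Proof. by case: UD. Qed.
Lemma ug0 x : U 0 x = x. Proof. by case: UD. Qed.
Lemma ugD s t x : U (s + t) x = U s (U t x). Proof. by case: UD. Qed.
Lemma ug_continuous x : continuous (fun t => U t x). Proof. by case: UD => ? ? ? ? []. Qed.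

Lemma ug_velocity x y : (odom D x /\ D x = y) <-> has_velocity U x y.
Proof.
by rewrite -cvg_has_velocity ?ug0//; case: UD => ? ? ? ? [].
Qed.

Lemma ug_B t x y : U t (x - y) = U t x - U t y.
Proof. by rewrite addrC -scaleN1r ug_linear scaleN1r addrC. Qed.

Lemma ug_0 t : U t 0 = 0.
Proof. by have := ug_B t 0 0; rewrite !subrr. Qed.

Lemma ug_Z t k x : U t (k *: x) = k *: U t x.
Proof. by rewrite -[k *: x]addr0 ug_linear ug_0 addr0. Qed.

Lemma ugNK t x : U t (U (- t) x) = x.
Proof. by rewrite -ugD subrr ug0. Qed.

(** U t is isometric and commutes with every U h, so it carries the velocity of x to that of U t
    x. *)
Lemma ug_dom t x : odom D x -> odom D (U t x) /\ D (U t x) = U t (D x).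
Proof.
move=> dx; apply/ug_velocity => e e0.
have /ug_velocity/(_ e e0)[d d0 hd] : odom D x /\ D x = D x by [].
exists d => // h /hd; rewrite -(ug_nrm t) !ug_B ug_Z.
by rewrite -!ugD [t + h]addrC.
Qed.

Lemma ug_velocity_at t x e : odom D x -> 0 < e ->
  exists2 d : R, 0 < d & forall h, `|h| < d ->
    nrm (U (t + h) x - U t x - (h%:C * 'i%C) *: U t (D x)) <= e * `|h|.
Proof.
move=> dx e0; have /ug_velocity/(_ e e0)[d d0 hd] := ug_dom t dx.
by exists d => // h /hd; rewrite -ugD [t + h]addrC.
Qed.

(** The remainder has derivative i (U s (D x) - D x). Unlike the plain derivative, this explicit
    bound can be passed to a limit of groups. *)
Lemma ug_generator_bound x h M : odom D x ->
  (forall s, `|s| <= `|h| -> nrm (U s (D x) - D x) <= M) ->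
  nrm (U h x - x - (h%:C * 'i%C) *: D x) <= M * `|h|.
Proof.
move=> dx hM.
have := @mean_value_bound R H (fun t => U t x - (t%:C * 'i%C) *: D x)
  (fun t => 'i%C *: (U t (D x) - D x)) h M.
rewrite mul0r scale0r subr0 ug0 addrAC; apply => [t e e0|s sh].
  have [d d0 hd] := ug_velocity_at t dx e0; exists d => // k /hd.
  congr (nrm _ <= _); apply: hdot_extl => z.
  by rewrite !(hdotBl, hdotZl) rmorphD; ring.
rewrite nrmZ (_ : cabs 'i%C = 1) ?mul1r ?hM//.
by rewrite /cabs normc_def /= expr0n expr1n add0r sqrtr1.
Qed.
End Fixed.
End UnitaryGroup.

Section Intertwining.
Variables (R : realType) (H1 H2 : hilbertType R).
Variables (D1 : operator H1) (D2 : operator H2) (U1 : R -> H1 -> H1) (U2 : R -> H2 -> H2).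
Hypotheses (sD1 : self_adjoint D1).
Hypotheses (UD1 : unitary_group D1 U1) (UD2 : unitary_group D2 U2).
Variable K : {linear H1 -> H2}.
Hypothesis Kb : forall x, nrm (K x) <= nrm x.
Hypothesis KD : intertwines D1 D2 K.

(* t |-> U2(-t) K U1(t) x has zero derivative. *)
Lemma ug_intertwine t x : K (U1 t x) = U2 t (K x).
Proof.
(* Both sides are contractions in x, so the dense domain of D1 suffices. *)
suff dom_case v : odom D1 v -> K (U1 t v) = U2 t (K v).
  apply/eqP; rewrite -subr_eq0; apply/eqP/nrm_eq0/eqP.
  rewrite eq_le nrm_ge0 andbT.
  apply: (@ler_eps _ _ _ 2) => // e e0; rewrite add0r.
  have : closure (odom D1) x by rewrite sa_dense.
  move=> /closure_nrmP/(_ e e0)[v dv xv].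
  have -> : K (U1 t x) - U2 t (K x) = K (U1 t (x - v)) - U2 t (K (x - v)).
    rewrite (ug_B UD1) !linearB /= (ug_B UD2) (dom_case _ dv).
    by rewrite opprB addrA subrK.
  apply: le_trans (nrmB _ _) _; rewrite (ug_nrm UD2).
  have := Kb (U1 t (x - v)); rewrite (ug_nrm UD1); have := Kb (x - v); lra.
move=> dv.
suff : nrm (U2 (- t) (K (U1 t v)) - U2 (- 0) (K (U1 0 v))) <= 0 * `|t|.
  rewrite mul0r oppr0 (ug0 UD2) (ug0 UD1) => h.
  have /eqP : nrm (U2 (- t) (K (U1 t v)) - K v) = 0.
    by apply/eqP; rewrite eq_le h nrm_ge0.
  move=> /eqP/nrm_eq0/eqP; rewrite subr_eq0 => /eqP <-.
  by rewrite (ugNK UD2).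
apply: (@mean_value_bound R H2 (fun t => U2 (- t) (K (U1 t v))) (fun=> 0)) => [s e e0|s _].
  have [dsv Dsv] := ug_dom UD1 s dv.
  have [dKs DKs] := KD dsv.
  have e2 : 0 < e / 2 by rewrite divr_gt0.
  have [a a0 ha] := ug_velocity_at UD1 s dv e2.
  have /(ug_velocity UD2)/(_ _ e2)[b b0 hb] :
    odom D2 (K (U1 s v)) /\ D2 (K (U1 s v)) = K (D1 (U1 s v)) by [].
  exists (Num.min a b) => [|k]; first by rewrite lt_min a0.
  rewrite lt_min => /andP[/ha ka /hb kb].
  rewrite scaler0 subr0.
  have -> : U2 (- (s + k)) (K (U1 (s + k) v)) - U2 (- s) (K (U1 s v)) =
    U2 (- (s + k)) (K (U1 (s + k) v) - U2 k (K (U1 s v))).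
    by rewrite (ug_B UD2) -(ugD UD2) opprD subrK.
  rewrite (ug_nrm UD2).
  (* Difference of two first-order expansions whose velocity terms cancel because D2 K = K D1. *)
  have -> : K (U1 (s + k) v) - U2 k (K (U1 s v)) =
     K (U1 (s + k) v - U1 s v - (k%:C * 'i%C) *: U1 s (D1 v)) -
     (U2 k (K (U1 s v)) - K (U1 s v) - (k%:C * 'i%C) *: K (D1 (U1 s v))).
    rewrite !linearB /= linearZ /= Dsv; apply: hdot_extl => z.
    by rewrite !(hdotBl, hdotDl, hdotNl, hdotZl); ring.
  apply: le_trans (nrmB _ _) _.
  have := Kb (U1 (s + k) v - U1 s v - (k%:C * 'i%C) *: U1 s (D1 v)); lra.
by rewrite nrm0.
Qed.
End Intertwining.

(** * Isometric embeddings onto reducing subspaces *)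

Section Reduction.
Variables (R : realType) (H1 H2 : hilbertType R).
Variables (D1 : operator H1) (D2 : operator H2).
Variables (K : {linear H1 -> H2}) (Ks : {linear H2 -> H1}).
Hypothesis sD1 : self_adjoint D1.
Hypothesis sD2 : self_adjoint D2.
Hypothesis Kiso : forall x y, hdot H2 (K x) (K y) = hdot H1 x y.
Hypothesis KsP : forall x y, hdot H2 (K x) y = hdot H1 x (Ks y).
Hypothesis KD : intertwines D1 D2 K.

Lemma isometry_nrm x : nrm (K x) = nrm x.
Proof.
apply/eqP; rewrite -(eqrXn2 (n := 2))// ?nrm_ge0//; apply/eqP/(@complexI R).
by rewrite -!hdotxx Kiso.
Qed.

Lemma adjointK x : Ks (K x) = x.
Proof. by apply: hdot_ext => z; rewrite -KsP Kiso. Qed.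

Lemma adjoint_nrm y : nrm (Ks y) <= nrm y.
Proof.
have [y0|y0] := eqVneq (nrm (Ks y)) 0; first by rewrite y0 nrm_ge0.
have yp : 0 < nrm (Ks y) by rewrite lt_def y0 nrm_ge0.
rewrite -(ler_pM2l yp); have := cauchy_schwarz (K (Ks y)) y.
by rewrite KsP hdotxx cabs_real ger0_norm ?sqr_ge0// isometry_nrm expr2.
Qed.

(** Taking adjoints in D2 K = K D1 gives <D1 x, Ks y> = <x, Ks (D2 y)>, and self-adjointness of D1
    turns this weak identity into membership of its domain. *)
Lemma adjoint_intertwines : intertwines D2 D1 Ks.
Proof.
move=> y dy; apply/(sa_adjoint sD1) => x dx.
by have [dKx DKx] := KD dx; rewrite -!KsP -DKx (sa_sym sD2).
Qed.

Lemma projection_intertwines : intertwines D2 D2 (K \o Ks).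
Proof.
move=> y /adjoint_intertwines[dy Dy] /=; have [dKy ->] := KD dy.
by rewrite Dy.
Qed.

Lemma projection_best y x : nrm (y - K (Ks y)) <= nrm (y - K x).
Proof.
rewrite -(@ler_pXn2r _ 2) ?nnegrE ?nrm_ge0//.
have -> : y - K x = (y - K (Ks y)) + K (Ks y - x) by rewrite linearB /= addrA subrK.
rewrite [leRHS]nrm_sqrD rdotC KsP (linearB Ks) /= adjointK subrr hdot0r /= mulr0 addr0.
by rewrite lerDl sqr_ge0.
Qed.

(** The projection K Ks commutes with D2, hence with U by [ug_intertwine]. So U preserves the range
    of K, and the compression is again a group of isometries. *)
Lemma compressed_group U : unitary_group D2 U ->
  unitary_group D1 (fun t x => Ks (U t (K x))).
Proof.
move=> UD2.
have comm t y : K (Ks (U t y)) = U t (K (Ks y)).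
  apply: (@ug_intertwine _ _ _ D2 D2 U U sD2 UD2 UD2 (K \o Ks)) => [z|].
    by rewrite /= isometry_nrm adjoint_nrm.
  exact: projection_intertwines.
have KV t x : K (Ks (U t (K x))) = U t (K x) by rewrite comm adjointK.
split.
- by move=> t k x y; rewrite linearP (ug_linear UD2) linearP.
- by move=> t x; rewrite -isometry_nrm KV (ug_nrm UD2) isometry_nrm.
- by move=> x; rewrite (ug0 UD2) adjointK.
- by move=> s t x; rewrite (ugD UD2) KV.
split.
  move=> x; apply/continuous_nrmP => t e e0.
  have /continuous_nrmP/(_ t e e0)[d d0 hd] := @ug_continuous _ _ _ _ UD2 (K x).
  exists d => // s /hd; apply: le_lt_trans; rewrite -linearB; exact: adjoint_nrm.
move=> x y; have V0 : Ks (U 0 (K x)) = x by rewrite (ug0 UD2) adjointK.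
apply: (iff_trans _ (iff_sym (@cvg_has_velocity _ _ (fun t x => Ks (U t (K x))) x y V0))).
have E h : nrm (Ks (U h (K x)) - x - (h%:C * 'i%C) *: y) =
    nrm (U h (K x) - K x - (h%:C * 'i%C) *: K y).
  by rewrite -isometry_nrm !linearB /= KV linearZ.
split=> [[dx Dx]|h].
  have /(ug_velocity UD2) h : odom D2 (K x) /\ D2 (K x) = K y.
    by rewrite -Dx; exact: KD.
  by move=> e /h[d d0 hd]; exists d => // k /hd; rewrite -E.
have /(ug_velocity UD2)[/adjoint_intertwines[]] : has_velocity U (K x) (K y).
  by move=> e /h[d d0 hd]; exists d => // k; rewrite -E; exact: hd.
by rewrite adjointK => dx -> DK; rewrite DK adjointK.
Qed.
End Reduction.

(* The unitary groups W n of an increasing sequence of reducing subspaces H n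
   agree where they are all defined, so that they have a pointwise limit. *)
Section GroupLimit.
Variables (R : realType) (Hn : nat -> hilbertType R) (H : hilbertType R).
Variables (Dn : forall n, operator (Hn n)) (D : operator H).
Variables (K : forall n, {linear Hn n -> H}) (Ks : forall n, {linear H -> Hn n}).
Variable U : forall n, R -> Hn n -> Hn n.
Hypothesis sDn : forall n, self_adjoint (Dn n).
Hypothesis sD : self_adjoint D.
Hypothesis Kiso : forall n x y, hdot H (K n x) (K n y) = hdot (Hn n) x y.
Hypothesis KsP : forall n x y, hdot H (K n x) y = hdot (Hn n) x (Ks n y).
Hypothesis KD : forall n, intertwines (Dn n) D (K n).
Hypothesis Kincr : forall n m, (n <= m)%N -> range (K n) `<=` range (K m).
Hypothesis Kdense : forall x (e : R), 0 < e ->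
  exists N, forall n, (N <= n)%N -> nrm (x - K n (Ks n x)) < e.
Variable good : set nat.
Hypothesis good_inf : forall N, exists2 n, good n & (N <= n)%N.
Hypothesis UD : forall n, good n -> unitary_group (Dn n) (@U n).


Let W n t x := K n (@U n t (Ks n x)).
Let d n x := nrm (x - K n (Ks n x)).

Let W_proj n t x : good n -> K n (Ks n (W n t x)) = W n t x.
Proof. by move=> gn; rewrite /W (adjointK (@Kiso n) (@KsP n)). Qed.

Let W_B n t x y : good n -> W n t (x - y) = W n t x - W n t y.
Proof. by move=> gn; rewrite /W linearB (ug_B (UD gn)) linearB. Qed.

Let W_nrm n t x : good n -> nrm (W n t x) <= nrm x.
Proof.
move=> gn; rewrite /W (isometry_nrm (@Kiso n)) (ug_nrm (UD gn)).
exact: adjoint_nrm (@Kiso n) (@KsP n) x.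
Qed.

(** [Ks m \o K n] is the inclusion of the n-th space in the m-th; it intertwines the two operators
    and therefore their groups. *)
Let W_compat n m t x : good n -> good m -> (n <= m)%N ->
  W m t (K n (Ks n x)) = W n t x.
Proof.
move=> gn gm nm.
have proj y : K m (Ks m (K n y)) = K n y.
  have [z _ <-] : range (K m) (K n y) by apply: (Kincr nm); exists y.
  by rewrite (adjointK (@Kiso m) (@KsP m)).
rewrite /W.
rewrite -(@ug_intertwine _ _ _ (Dn n) (Dn m) (@U n) (@U m) (sDn n) (UD gn) (UD gm) (Ks m \o K n)).
- by rewrite /= proj.
- move=> z /=; rewrite -(isometry_nrm (@Kiso n) z).
  exact: adjoint_nrm (@Kiso m) (@KsP m) _.
- move=> z dz /=; have [dK <-] := @KD n z dz.
  exact: (adjoint_intertwines (sDn m) sD (@KsP m) (@KD m)).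
Qed.

Let W_dist n m t x : good n -> good m -> (n <= m)%N ->
  nrm (W m t x - W n t x) <= d n x.
Proof.
move=> gn gm nm; rewrite -(W_compat t x gn gm nm) -W_B//.
exact: W_nrm.
Qed.

(** The error d n x is the distance from x to the n-th space. It does not depend on t, and this
    uniformity yields the continuity and the generator of the limit. *)
Let limit_ex t x : exists l, forall n, good n -> nrm (l - W n t x) <= d n x.
Proof.
have [g gP] : {g : nat -> nat & forall N, good (g N) /\ (N <= g N)%N}.
  apply: (@choice _ _ (fun N n => good n /\ (N <= n)%N)) => N.
  by have [n gn Nn] := good_inf N; exists n.
have [|l lP] := @nrm_cauchy_cvg R H (fun N => W (g N) t x).
  move=> e e0; have [N NP] := Kdense x e0; exists N => i j Ni Nj.
  have [gi igi] := gP i; have [gj jgj] := gP j.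
  have [gij|/ltnW gji] := leqP (g i) (g j).
    rewrite nrmBC; apply: le_lt_trans (W_dist t x gi gj gij) _.
    by apply: NP; exact: leq_trans igi.
  apply: le_lt_trans (W_dist t x gj gi gji) _.
  by apply: NP; exact: leq_trans jgj.
exists l => n gn; apply/ler_addgt0Pr => e e0.
have [N NP] := lP e e0; pose m := maxn N n.
have [gm mgm] := gP m.
apply: le_trans (nrm_tri (W (g m) t x) _ _) _; rewrite addrC lerD//.
  by apply: W_dist => //; apply: leq_trans mgm; exact: leq_maxr.
by apply/ltW/NP; exact: leq_maxl.
Qed.

Lemma limit_group : exists V, unitary_group D V.
Proof.
have [V' V'P] := choice (fun p : R * H => limit_ex p.1 p.2).
have [V VW] : exists V : R -> H -> H, forall n t x, good n -> nrm (V t x - W n t x) <= d n x.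
  by exists (fun t x => V' (t, x)) => n t x gn; exact: (V'P (t, x)).
have d_small (x y z : H) (e : R) : 0 < e ->
    exists2 n, good n & [/\ d n x < e, d n y < e & d n z < e].
  move=> e0; have [N1 P1] := Kdense x e0; have [N2 P2] := Kdense y e0.
  have [N3 P3] := Kdense z e0.
  have [n gn] := good_inf (maxn (maxn N1 N2) N3).
  rewrite !geq_max => /andP[/andP[n1 n2] n3].
  by exists n => //; split; [exact: P1|exact: P2|exact: P3].
have eq_small (a b : H) (k : R) : 0 <= k ->
    (forall e, 0 < e -> nrm (a - b) <= k * e) -> a = b.
  move=> k0 h; apply/eqP; rewrite -subr_eq0; apply/eqP/nrm_eq0/eqP.
  rewrite eq_le nrm_ge0 andbT; apply: (@ler_eps _ _ _ k) => // e e0.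
  by rewrite add0r h.
have Vlin t : linear (V t).
  move=> k x y; apply: (@eq_small _ _ (2 + cabs k)) => [|e e0].
    by rewrite addr_ge0// cabs_ge0.
  have [n gn [d1 d2 d3]] := d_small (k *: x + y) x y _ e0.
  have h1 := VW _ t (k *: x + y) gn; have h2 := VW _ t x gn.
  have h3 := VW _ t y gn.
  have -> : V t (k *: x + y) - (k *: V t x + V t y) =
      (V t (k *: x + y) - W n t (k *: x + y)) -
      (k *: (V t x - W n t x) + (V t y - W n t y)).
    have -> : W n t (k *: x + y) = k *: W n t x + W n t y.
      by rewrite /W linearP (ug_linear (UD gn)) linearP.
    apply: hdot_extl => z.
    by rewrite !(hdotBl, hdotDl, hdotNl, hdotZl); ring.
  apply: le_trans (nrmB _ _) _.
  have h4 := nrmD (k *: (V t x - W n t x)) (V t y - W n t y).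
  have h5 : cabs k * nrm (V t x - W n t x) <= cabs k * e.
    by rewrite ler_wpM2l ?cabs_ge0//; lra.
  by move: h4; rewrite nrmZ; lra.
have Vnrm t x : nrm (V t x) = nrm x.
  apply/eqP; rewrite -subr_eq0 -normr_eq0 eq_le normr_ge0 andbT.
  apply: (@ler_eps _ _ _ 2) => // e e0; rewrite add0r.
  have [n gn [dx _ _]] := d_small x x x _ e0.
  have h1 := le_trans (nrm_dist _ _) (VW _ t x gn).
  have h2 := nrm_dist x (K n (Ks n x)).
  have h3 : nrm (W n t x) = nrm (K n (Ks n x)).
    by rewrite /W !(isometry_nrm (@Kiso n)) (ug_nrm (UD gn)).
  move: h1 h2 dx; rewrite h3 /d !ler_norml; move=> /andP[? ?] /andP[? ?] ?.
  by apply/andP; split; lra.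
have V0 x : V 0 x = x.
  apply: (@eq_small _ _ 2) => // e e0.
  have [n gn [dx _ _]] := d_small x x x _ e0.
  have h1 := VW _ 0 x gn.
  have WE : W n 0 x = K n (Ks n x) by rewrite /W (ug0 (UD gn)).
  have h2 := nrm_tri (W n 0 x) (V 0 x) x.
  move: h2 h1 dx; rewrite WE /d (nrmBC (K n _)); lra.
have VB t x y : V t (x - y) = V t x - V t y.
  by rewrite addrC -scaleN1r Vlin scaleN1r addrC.
have VD s t x : V (s + t) x = V s (V t x).
  apply: (@eq_small _ _ 2) => // e e0.
  have [n gn [dx _ _]] := d_small x x x _ e0.
  have WD : W n (s + t) x = W n s (W n t x).
    by rewrite /W (ugD (UD gn)) (adjointK (@Kiso n) (@KsP n)).
  have h1 := VW _ (s + t) x gn.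
  have h2 := VW _ s (W n t x) gn.
  have h3 := VW _ t x gn.
  have h4 : nrm (V s (W n t x) - V s (V t x)) <= d n x.
    by rewrite -VB Vnrm nrmBC.
  have h5 : d n (W n t x) = 0 by rewrite /d W_proj// subrr nrm0.
  have h6 := nrm_tri (W n (s + t) x) (V (s + t) x) (V s (V t x)).
  have h7 := nrm_tri (V s (W n t x)) (W n (s + t) x) (V s (V t x)).
  have h8 : nrm (W n (s + t) x - V s (W n t x)) <= 0 by rewrite WD nrmBC -h5.
  lra.
have Vcont x : continuous (fun t => V t x).
  apply/continuous_nrmP => t e e0.
  have e4 : 0 < e / 4 by rewrite divr_gt0.
  have [n gn [dx _ _]] := d_small x x x _ e4.
  have /continuous_nrmP/(_ t _ e4)[r r0 hr] := @ug_continuous _ _ _ _ (UD gn) (Ks n x).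
  exists r => // s /hr; rewrite -(isometry_nrm (@Kiso n)) linearB -/(W n t x) -/(W n s x) => h.
  have h1 := VW _ t x gn; have h2 := VW _ s x gn.
  have h3 := nrm_tri (W n t x) (V t x) (V s x).
  have h4 := nrm_tri (W n s x) (W n t x) (V s x).
  move: h4; rewrite (nrmBC (W n s x)); lra.
(* A linear isometry preserves inner products by polarisation, and V (-t) inverts V t. *)
have Vadj t x y : hdot H (V t x) y = hdot H x (V (- t) y).
  have re u v : complex.Re (hdot H (V t u) (V t v)) = complex.Re (hdot H u v).
    have := nrm_sqrB (V t u) (V t v); rewrite -VB !Vnrm nrm_sqrB.
    move: (complex.Re _) (complex.Re _) => p q; lra.
  have inner u v : hdot H (V t u) (V t v) = hdot H u v.
    apply/eqP; rewrite eq_complex re eqxx /=.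
    have := re ('i%C *: u) v.
    have -> : V t ('i%C *: u) = 'i%C *: V t u.
      have Vt0 : V t 0 = 0 by have := VB t 0 0; rewrite !subrr.
      by rewrite -['i%C *: u]addr0 Vlin Vt0 addr0.
    rewrite !hdotZl; case: (hdot H (V t u) _) => a b; case: (hdot H u v) => a' b' /=.
    by rewrite !mul0r !mul1r !sub0r => /oppr_inj ->.
  by rewrite -{1}[y]V0 -(subrr t) VD inner.
(* Continuity of V at 0 on D x bounds the derivative of the remainder by e / 2; [ug_generator_bound]
   at level n keeps this bound up to a multiple of a, which is arbitrarily small. *)
have gen x : odom D x -> has_velocity V x (D x).
  move=> dx e e0.
  have e2 : 0 < e / 2 by rewrite divr_gt0.
  have /continuous_nrmP/(_ 0 _ e2)[r r0 hr] := Vcont (D x).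
  exists r => // h hb.
  apply: (@ler_eps _ _ _ (2 + 3 * `|h|)) => [|a a0]; first by rewrite addr_ge0// mulr_ge0.
  have [n gn [d1 d2 _]] := d_small x (D x) x _ a0.
  have [dKs DKs] := adjoint_intertwines (sDn n) sD (@KsP n) (@KD n) dx.
  have bnd s : `|s| <= `|h| -> nrm (@U n s (Dn n (Ks n x)) - Dn n (Ks n x)) <= e / 2 + 2 * a.
    move=> sh; rewrite DKs -(isometry_nrm (@Kiso n)) linearB -/(W n s (D x)).
    have h1 := VW _ s (D x) gn.
    have h2 : nrm (V s (D x) - D x) < e / 2.
      by rewrite -{2}(V0 (D x)) nrmBC hr// sub0r normrN (le_lt_trans sh).
    have h3 := nrm_tri (V s (D x)) (W n s (D x)) (K n (Ks n (D x))).
    have h4 := nrm_tri (D x) (V s (D x)) (K n (Ks n (D x))).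
    move: h3 d2; rewrite (nrmBC (W n s (D x)) (V s (D x))) /d => h3 d2; rewrite /d in h1; lra.
  have := ug_generator_bound (UD gn) dKs bnd.
  rewrite -(isometry_nrm (@Kiso n)) !linearB /= -/(W n h x) linearZ /= DKs => h1.
  have h2 := VW _ h x gn.
  have -> : V h x - x - (h%:C * 'i%C) *: D x = (V h x - W n h x) - (x - K n (Ks n x))
     - (h%:C * 'i%C) *: (D x - K n (Ks n (D x)))
     + (W n h x - K n (Ks n x) - (h%:C * 'i%C) *: K n (Ks n (D x))).
    by apply: hdot_extl => z; rewrite !(hdotBl, hdotDl, hdotNl, hdotZl); ring.
  apply: le_trans (nrmD _ _) _.
  have h3 := nrmB (V h x - W n h x - (x - K n (Ks n x)))
    ((h%:C * 'i%C) *: (D x - K n (Ks n (D x)))).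
  have h4 := nrmB (V h x - W n h x) (x - K n (Ks n x)).
  have ci : cabs (h%:C * 'i%C) = `|h|.
    by rewrite cabsM cabs_real /cabs normc_def /= expr0n expr1n add0r sqrtr1 mulr1.
  move: h3; rewrite nrmZ ci => h3.
  have h5 : `|h| * nrm (D x - K n (Ks n (D x))) <= `|h| * a.
    by rewrite ler_wpM2l// ltW.
  have h6 : (e / 2) * `|h| <= e * `|h| by rewrite ler_wpM2r//; lra.
  move: h1 h2 h3 h4 d1; rewrite /d; lra.
exists V; split=> //; split=> // x y.
rewrite cvg_has_velocity//; split=> [[dx <-]|vx]; first exact: gen.
(* The generator of V extends D by [gen] and is symmetric, and a self-adjoint operator has no proper
   symmetric extension. Symmetry is read off by comparing V h z with V (-h) x for small h. *)
apply/(sa_adjoint sD) => z dz.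
apply/eqP; rewrite -subr_eq0; apply/eqP/cabs_eq0/eqP.
rewrite eq_le cabs_ge0 andbT.
apply: (@ler_eps _ _ _ (nrm x + nrm z)) => [|e e0]; first by rewrite addr_ge0 ?nrm_ge0.
have [a a0 ha] := gen _ dz _ e0; have [b b0 hb] := vx _ e0.
pose h := Num.min a b / 2.
have mab : 0 < Num.min a b by rewrite lt_min a0.
have h0 : 0 < h by rewrite divr_gt0.
have hm : h < Num.min a b by rewrite ltr_pdivrMr// ltr_pMr// ltr1n.
have {hm}[hA hB] : h < a /\ h < b by apply/andP; rewrite -lt_min.
have {}ha := ha h; have {}hb := hb (- h).
rewrite normrN gtr0_norm// in ha hb; have {}ha := ha hA; have {}hb := hb hB.
have E : h%:C * 'i%C * (hdot H (D z) x - hdot H z y) =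
    hdot H z (V (- h) x - x - ((- h)%:C * 'i%C) *: y)
    - hdot H (V h z - z - (h%:C * 'i%C) *: D z) x.
  have cE : conjc ((- h)%:C * 'i%C) = h%:C * 'i%C.
    by apply/eqP; rewrite eq_complex /=; apply/andP; split; apply/eqP; ring.
  rewrite !hdotBl !hdotBr hdotZl hdotZr cE Vadj; ring.
have := congr1 (@cabs R) E; rewrite !cabsM cabs_real gtr0_norm//.
have -> : cabs ('i%C : R[i]) = 1.
  by rewrite /cabs normc_def /= expr0n expr1n add0r sqrtr1.
rewrite mulr1 add0r => Eh; rewrite -(ler_pM2l h0) Eh.
have cN (w : R[i]) : cabs (- w) = cabs w by rewrite /cabs normrN.
apply: le_trans (cabsD _ _) _; rewrite cN.
have h1 := cauchy_schwarz z (V (- h) x - x - ((- h)%:C * 'i%C) *: y).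
have h2 := cauchy_schwarz (V h z - z - (h%:C * 'i%C) *: D z) x.
have h3 := ler_wpM2l (nrm_ge0 z) hb; have h4 := ler_wpM2r (nrm_ge0 x) ha.
lra.
Qed.
End GroupLimit.

Section Expi.
Variables (R : realType) (Hn : nat -> hilbertType R) (H : hilbertType R).
Variables (Dn : forall n, operator (Hn n)) (D : operator H).
Variables (K : forall n, {linear Hn n -> H}) (Ks : forall n, {linear H -> Hn n}).
Hypothesis sDn : forall n, self_adjoint (Dn n).
Hypothesis sD : self_adjoint D.
Hypothesis Kiso : forall n x y, hdot H (K n x) (K n y) = hdot (Hn n) x y.
Hypothesis KsP : forall n x y, hdot H (K n x) y = hdot (Hn n) x (Ks n y).
Hypothesis KD : forall n, intertwines (Dn n) D (K n).
Hypothesis Kincr : forall n m, (n <= m)%N -> range (K n) `<=` range (K m).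
Hypothesis Kdense : forall x (e : R), 0 < e ->
  exists N, forall n, (N <= n)%N -> nrm (x - K n (Ks n x)) < e.

Lemma expi_group H' (D' : operator H') V :
  unitary_group D' V -> @unitary_group R H' D' (expi D').
Proof. by move=> DV; apply: xgetI DV. Qed.

Lemma expi_id H' (D' : operator H') :
  (forall V, ~ unitary_group D' V) -> @expi R H' D' = fun _ x => x.
Proof. exact: xgetPN. Qed.

(** A unitary group and the default identity are both isometric. *)
Lemma expi_nrm H' (D' : operator H') t x : nrm (@expi R H' D' t x) = nrm x.
Proof.
have [[V DV]|noV] := pselect (exists V, unitary_group D' V).
  exact: ug_nrm (expi_group DV) t x.
by rewrite expi_id// => V DV; apply: noV; exists V.
Qed.

(* [expi] is the identity when there is no unitary group: either D has one, and
   compressing it gives one for every D n, or all but finitely many D n have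
   none, since otherwise their limit would be one for D. *)
Lemma expi_compat : exists N, forall n, (N <= n)%N ->
  (forall t x, Ks n (expi D t x) = expi (Dn n) t (Ks n x)) /\
  (forall t y, K n (expi (Dn n) t y) = expi D t (K n y)).
Proof.
have [[V DV]|noV] := pselect (exists V, unitary_group D V).
  exists 0%N => n _.
  have DV' := expi_group DV.
  have Dn' := expi_group (compressed_group (sDn n) sD (@Kiso n) (@KsP n) (@KD n) DV).
  split=> t x.
    apply: (@ug_intertwine _ _ _ _ _ _ _ sD DV' Dn').
      exact: adjoint_nrm (@Kiso n) (@KsP n).
    exact: adjoint_intertwines (sDn n) sD (@KsP n) (@KD n).
  apply: (@ug_intertwine _ _ _ _ _ _ _ (sDn n) Dn' DV').
    by move=> z; rewrite (isometry_nrm (@Kiso n)).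
  exact: KD.
have [N NP] : exists N, forall n, (N <= n)%N -> forall V, ~ unitary_group (Dn n) V.
  apply: contrapT => h; apply: noV.
  apply: (@limit_group _ _ _ _ _ _ _ (fun n => expi (Dn n)) sDn sD Kiso KsP KD
    Kincr Kdense [set n | unitary_group (Dn n) (expi (Dn n))]) => [N|//].
  apply: contrapT => h'; apply: h; exists N => n Nn V DV; apply: h'.
  by exists n => //; exact: expi_group DV.
exists N => n /NP noVn.
by rewrite !expi_id// => V DV; apply: noV; exists V.
Qed.
End Expi.

(** * States of C*-algebras and sublinear functionals *)

HB.instance Definition _ (R : realType) (A : cstarAlgType R) :=
  Uniform_isComplete.Build (nspace A) (@cstar_complete R A).

Section CstarAlgebra.
Variables (R : realType) (A : cstarAlgType R).
Implicit Types a b x y z : A.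

Lemma star0 : star (0 : A) = 0.
Proof. by have := starZ 0 (0 : A); rewrite !scale0r conjc0 scale0r. Qed.

Lemma starN a : star (- a) = - star a.
Proof.
apply/eqP; rewrite -addr_eq0 -starD addNr star0 eqxx//.
Qed.

Lemma starB a b : star (a - b) = star a - star b.
Proof. by rewrite starD starN. Qed.

Lemma star1 : star (1 : A) = 1.
Proof. by have := starM (star (1 : A)) 1; rewrite mulr1 starK mulr1. Qed.

Lemma starZr (r : R) a : star (r%:C *: a) = r%:C *: star a.
Proof. by rewrite starZ conjc_real. Qed.

Lemma anorm_ge0 a : 0 <= anorm a.
Proof. exact: (@nrm_ge0 R (nspace A)). Qed.

Lemma anorm0 : anorm (0 : A) = 0.
Proof. exact: (@nrm0 R (nspace A)). Qed.

Lemma anormN a : anorm (- a) = anorm a.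
Proof. exact: (@nrmN R (nspace A)). Qed.

Lemma anormB a b : anorm (a - b) <= anorm a + anorm b.
Proof. exact: (@nrmB R (nspace A)). Qed.

Lemma anormBC a b : anorm (a - b) = anorm (b - a).
Proof. exact: (@nrmBC R (nspace A)). Qed.

Lemma anormZr (r : R) a : anorm (r%:C *: a) = `|r| * anorm a.
Proof. by rewrite anormZ cabs_real. Qed.

Lemma anorm_tri z x y : anorm (x - y) <= anorm (x - z) + anorm (z - y).
Proof. exact: (@nrm_tri R (nspace A)). Qed.

(** The C*-identity gives |b|^2 = |b* b| <= |b*| |b|; applying this to b and to b* gives
    equality. *)
Lemma star_anorm a : anorm (star a) = anorm a.
Proof.
suff le b : anorm b <= anorm (star b).
  by apply/eqP; rewrite eq_le le -{2}[a]starK le.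
have [b0|b0] := eqVneq (anorm b) 0; first by rewrite b0 anorm_ge0.
have bp : 0 < anorm b by rewrite lt_def b0 anorm_ge0.
by rewrite -(ler_pM2r bp) -expr2 -anorm_star anormM.
Qed.

Lemma anorm1 : anorm (1 : A) = 1.
Proof.
have n0 : anorm (1 : A) != 0.
  by apply/eqP => /anorm_eq0/eqP; rewrite oner_eq0.
have := anorm_star (1 : A); rewrite star1 mulr1 expr2 => /eqP.
by rewrite -{1}[anorm 1]mulr1 (inj_eq (mulfI n0)) eq_sym => /eqP.
Qed.

Lemma seq_anorm_bounded (s : seq A) :
  exists2 M : R, 0 <= M & forall a, a \in s -> anorm a <= M.
Proof.
exists (\sum_(a <- s) anorm a) => [|a sa].
  by apply: sumr_ge0 => a _; exact: anorm_ge0.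
rewrite (perm_big _ (perm_to_rem sa)) big_cons lerDl.
by apply: sumr_ge0 => b _; exact: anorm_ge0.
Qed.

Lemma selfadjoint_closed x :
  (forall e : R, 0 < e -> exists2 y, star y = y & anorm (x - y) < e) -> star x = x.
Proof.
move=> h; apply/eqP; rewrite -subr_eq0; apply/eqP/anorm_eq0/eqP.
rewrite eq_le anorm_ge0 andbT; apply: (@ler_eps _ _ _ 2) => // e e0.
have [y sy xy] := h _ e0; rewrite add0r.
have := anorm_tri y (star x) x.
have -> : anorm (star x - y) = anorm (x - y) by rewrite -{1}sy -starB star_anorm.
by rewrite (anormBC y x); lra.
Qed.

(** A fixed point z of g z = (x + z^2) / 2 satisfies (1 - z)^2 = 1 - x. On the ball of radius r =
    |x| < 1 the map g is r-Lipschitz, so its iterates from 0 converge, and they stay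
    self-adjoint. *)
Lemma one_sub_square x : star x = x -> anorm x < 1 ->
  exists y, star y * y = 1 - x.
Proof.
move=> sx x1; set r := anorm x in x1.
have r0 : 0 <= r by exact: anorm_ge0.
pose g z := (2^-1)%:C *: (x + z * z) : A.
pose u n := iter n g 0.
have half2 : `|2^-1 : R| = 2^-1 by rewrite ger0_norm.
have ub n : anorm (u n) <= r.
  elim: n => [|n ih] /=; first by rewrite anorm0.
  rewrite /g anormZr half2.
  have := anormD x (u n * u n); have := anormM (u n) (u n).
  have := anorm_ge0 (u n); rewrite -/r; nra.
have us n : star (u n) = u n.
  elim: n => [|n ih] /=; first exact: star0.
  by rewrite /g starZr starD sx starM ih.
have gB y z : anorm (g y - g z) <= 2^-1 * ((anorm y + anorm z) * anorm (y - z)).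
  rewrite /g -scalerBr anormZr half2 ler_wpM2l//.
  have -> : x + y * y - (x + z * z) = y * (y - z) + (y - z) * z.
    by rewrite mulrBr mulrBl addrA subrK opprD addrACA subrr add0r.
  apply: le_trans (anormD _ _) _; rewrite [leRHS]mulrDl lerD ?anormM//.
  by apply: le_trans (anormM _ _) _; rewrite mulrC.
have contr m n k : anorm (u (n + m)%N - u (n + k)%N) <= r ^+ n * (2 * r).
  elim: n => [|n ih].
    rewrite !add0n expr0 mul1r; apply: le_trans (anormB _ _) _.
    by have := ub m; have := ub k; lra.
  rewrite !addSn /=; apply: le_trans (gB _ _) _.
  have h1 := ub (n + m)%N; have h2 := ub (n + k)%N.
  rewrite exprS -mulrA.
  apply: le_trans (_ : r * anorm (u (n + m)%N - u (n + k)%N) <= _); last first.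
    by rewrite ler_wpM2l.
  by rewrite mulrA ler_wpM2r ?anorm_ge0//; lra.
have small (e : R) : 0 < e -> exists N, r ^+ N * (2 * r) < e.
  move=> e0.
  have h : (fun n => r ^+ n * (2 * r)) @ \oo --> (0 : R).
    rewrite -[X in _ --> X](mul0r (2 * r)); apply: cvgMl.
    by apply: cvg_expr; rewrite ger0_norm.
  have /cvgrPdist_lt/(_ e e0)[N _ NP] := h; exists N.
  have := NP N (leqnn N); rewrite /= sub0r normrN.
  by apply: le_lt_trans; exact: ler_norm.
have [|z zP] := @nrm_cauchy_cvg R (nspace A) u.
  move=> e e0; have [N NP] := small e e0; exists N => m n Nm Nn.
  by rewrite nspace_nrm -(subnKC Nm) -(subnKC Nn); exact: le_lt_trans (contr _ _ _) NP.
have eq_small a b (k : R) : 0 <= k ->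
    (forall e, 0 < e -> anorm (a - b) <= k * e) -> a = b.
  move=> k0 h; apply/eqP; rewrite -subr_eq0; apply/eqP/anorm_eq0/eqP.
  rewrite eq_le anorm_ge0 andbT; apply: (@ler_eps _ _ _ k) => // e e0.
  by rewrite add0r h.
have sz : star (z : A) = z.
  apply: selfadjoint_closed => e e0; have [N NP] := zP e e0.
  by exists (u N) => //; exact: NP.
have zg : (z : A) = g z.
  have zk : 0 <= anorm (z : A) + 1 by rewrite addr_ge0 ?anorm_ge0.
  apply: (@eq_small _ _ (1 + 2^-1 * (anorm (z : A) + 1))) => [|e e0].
    by rewrite addr_ge0// mulr_ge0.
  have [N NP] := zP e e0.
  have h := NP N (leqnn N); have hS := NP N.+1 (leqnSn N).
  rewrite !nspace_nrm in h hS.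
  have h1 := anorm_tri (u N.+1) z (g z).
  have h2 := gB (u N) z.
  have h3 : (anorm (u N) + anorm (z : A)) * anorm (u N - (z : A)) <= (anorm (z : A) + 1) * e.
    apply: ler_pM; rewrite ?addr_ge0 ?anorm_ge0//; last by rewrite anormBC ltW.
    by rewrite addrC lerD2l (le_trans (ub N))// ltW.
  have h4 : 2^-1 * ((anorm (u N) + anorm (z : A)) * anorm (u N - (z : A))) <=
    2^-1 * ((anorm (z : A) + 1) * e) by rewrite ler_wpM2l.
  move: h1 h2 => /=; lra.
exists (1 - z : A); rewrite starB star1 sz mulrBl !mulrBr !mul1r mulr1.
have : (z : A) + z = x + z * z.
  rewrite {1 2}zg /g -scalerDl -rmorphD /= (_ : 2^-1 + 2^-1 = 1 :> R) ?scale1r//.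
  by field.
move=> e; have -> : x = z + z - z * z by rewrite e addrK.
by rewrite -addrA -opprD addrA.
Qed.
End CstarAlgebra.

Section States.
Variables (R : realType) (A : cstarAlgType R) (phi : A -> R[i]^o).
Implicit Types a b : A.

Section Positive.
Hypothesis phi_linear : linear phi.
Hypothesis phi_pos : forall a, 0 <= (phi (star a * a) : R[i]).

Lemma functionalB a b : phi (a - b) = phi a - phi b.
Proof. by rewrite addrC -scaleN1r phi_linear scaleN1r addrC. Qed.

Lemma functional0 : phi 0 = 0.
Proof. by have := functionalB 0 0; rewrite !subrr. Qed.

Lemma functionalZ (k : R[i]) a : phi (k *: a) = k * (phi a : R[i]).
Proof. by rewrite -[k *: a]addr0 phi_linear functional0 addr0. Qed.

Lemma functionalD a b : phi (a + b) = phi a + phi b.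
Proof. by rewrite -{1}[a]scale1r phi_linear scale1r. Qed.

(** phi (b* b) is real. Taking b = a + 1 settles the imaginary parts, and b = a + i the real
    parts. *)
Lemma functional_star a : (phi (star a) : R[i]) = conjc (phi a).
Proof.
have im b : complex.Im (phi (star b * b) : R[i]) = 0.
  exact/ger0_Im/phi_pos.
have h1 := im (a + 1); have h2 := im (a + 'i%C%:A).
have h0 := im 1; have := im a; move: h1 h2 h0.
rewrite !starD star1 starZ star1 !mulrDl !mulrDr !mul1r !mulr1.
rewrite -!scalerAl -!scalerAr !mul1r !mulr1 !(functionalD, functionalZ).
case: (phi (star a)) => p q; case: (phi a) => p' q'; case: (phi (star a * a)) => s t /=.
case: (phi 1) => u v /=.
move=> h1 h2 h0 h3; rewrite h0 h3 in h1 h2.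
apply/eqP; rewrite eq_complex /=; apply/andP; split; apply/eqP.
  by move: h1 h2; lra.
by apply/eqP; rewrite -addr_eq0 -h1 add0r addr0.
Qed.

(** If phi 1 = 0, then phi ((b + s)* (b + s)) is affine in the real number s and nonnegative, so its
    slope 2 Re (phi b) vanishes. *)
Lemma functional_degenerate a : (phi 1 : R[i]) = 0 -> (phi a : R[i]) = 0.
Proof.
move=> phi10.
have re b : complex.Re (phi b : R[i]) = 0.
  set q := complex.Re _; apply/eqP; apply: contraT => q0.
  pose K := complex.Re (phi (star b * b) : R[i]).
  have h (s : R) : 0 <= s * q + s * q + K.
    have := phi_pos (b + s%:C%:A); rewrite lecE => /andP[_].
    rewrite starD starZr star1 !mulrDl !mulrDr -!scalerAl -!scalerAr !mul1r !mulr1.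
    rewrite !(functionalD, functionalZ) phi10 functional_star /q /K.
    case: (phi b) => x y; case: (phi (star b * b)) => u v /=; lra.
  (* For this s the affine function takes the value -1. *)
  have := h (- (K + 1) / (2 * q)).
  have -> : - (K + 1) / (2 * q) * q + - (K + 1) / (2 * q) * q + K = -1 by field.
  by rewrite lerNr oppr0 ler10.
apply/eqP; rewrite eq_complex re eqxx /=.
by have := re ('i%C *: a); rewrite functionalZ; case: (phi a) => x y /=;
   rewrite mul0r mul1r sub0r => /eqP; rewrite oppr_eq0.
Qed.

(* [rho] is only used when [phi 1 = 0]. *)
Lemma functional_normalize (rho : A -> R[i]^o) : state rho ->
  exists2 psi, state psi & forall a, phi a = (phi 1 : R[i]) * (psi a : R[i]).
Proof.
move=> srho; have [p0|p0] := eqVneq (phi 1 : R[i]) 0.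
  by exists rho => // a; rewrite p0 mul0r; exact: functional_degenerate.
exists (fun a => (phi 1 : R[i])^-1 * (phi a : R[i]) : R[i]^o); last first.
  by move=> a; rewrite mulVKf.
split=> [k a b|a|].
- rewrite phi_linear mulrDr; congr (_ + _).
  by rewrite /GRing.scale /= mulrCA.
- rewrite mulr_ge0// invr_ge0.
  by have := phi_pos 1; rewrite star1 mulr1.
- by rewrite mulVf.
Qed.
End Positive.

Hypothesis sphi : state phi.

Lemma state_linear : linear phi. Proof. by case: sphi. Qed.
Lemma state_pos a : 0 <= (phi (star a * a) : R[i]). Proof. by case: sphi. Qed.
Lemma state1 : phi 1 = 1. Proof. by case: sphi. Qed.

Lemma stateB a b : phi (a - b) = phi a - phi b.
Proof. exact: functionalB state_linear a b. Qed.

Lemma state0 : phi 0 = 0.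
Proof. exact: functional0 state_linear. Qed.

Lemma stateZ (k : R[i]) a : phi (k *: a) = k * (phi a : R[i]).
Proof. exact: functionalZ state_linear k a. Qed.

Lemma stateD a b : phi (a + b) = phi a + phi b.
Proof. exact: functionalD state_linear a b. Qed.

Lemma state_star a : (phi (star a) : R[i]) = conjc (phi a).
Proof. exact: functional_star state_linear state_pos a. Qed.

Lemma state_sa a : star a = a -> (phi a : R[i]) = (complex.Re (phi a : R[i]))%:C.
Proof.
move=> sa; have := state_star a; rewrite sa; case: (phi a) => p q /= -[h].
by congr (_ +i* _); lra.
Qed.

(** Nonnegativity of the variance: apply phi to the square of a - phi(a) 1. *)
Lemma state_cs a : cabs (phi a : R[i]) ^+ 2 <= complex.Re (phi (star a * a) : R[i]).
Proof.
have := state_pos (a - (phi a : R[i])%:A).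
rewrite starB starZ star1 mulrBl !mulrBr -!scalerAl -!scalerAr !mul1r !mulr1.
rewrite !(stateB, stateZ) state1 state_star mulr1 lecE => /andP[_].
have -> : cabs (phi a : R[i]) ^+ 2 = complex.Re ((phi a : R[i]) * conjc (phi a)).
  by rewrite cabs_sqr.
rewrite !raddfB /= mulrC; lra.
Qed.

(** 1 - a / (|a| + e) has the form y* y, on which phi is nonnegative; e > 0 brings the norm strictly
    below 1. *)
Lemma state_re_le a : star a = a -> complex.Re (phi a : R[i]) <= anorm a.
Proof.
move=> sa; apply/ler_addgt0Pr => e e0.
have c0 : 0 < anorm a + e by rewrite ltr_wpDl// anorm_ge0.
have [||y yE] := @one_sub_square R A ((anorm a + e)^-1%:C *: a).
- by rewrite starZr sa.
- by rewrite anormZr ger0_norm ?invr_ge0 ?ltW// ltr_pdivrMl// mulr1 ltrDl.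
have := state_pos y; rewrite yE stateB stateZ state1 lecE => /andP[_].
by rewrite raddfB /= Re_mulr subr_ge0 ler_pdivrMl// mulr1.
Qed.

Lemma state_contractive a : cabs (phi a : R[i]) <= anorm a.
Proof.
rewrite -(@ler_pXn2r _ 2) ?nnegrE ?cabs_ge0 ?anorm_ge0//.
apply: le_trans (state_cs _) _; rewrite -anorm_star; apply: state_re_le.
by rewrite starM starK.
Qed.
End States.

Section SublinearFunctionals.
Variables (R : realType) (V : lmodType R[i]).

(** Homogeneity concerns nonnegative real scalars: the theory is applied to real parts, from which
    complex functionals are rebuilt. *)
Definition sublinear (q : V -> R) :=
  (forall x y, q (x + y) <= q x + q y) /\
  (forall (r : R) x, 0 <= r -> q (r%:C *: x) = r * q x).

Lemma sublinear0 q : sublinear q -> q 0 = 0.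
Proof. by move=> [_ qZ]; rewrite -(scale0r (0 : V)) (qZ 0) ?mul0r. Qed.

Lemma sublinearN q x : sublinear q -> - q (- x) <= q x.
Proof.
move=> sq; have := sq.1 x (- x); rewrite subrr sublinear0//; lra.
Qed.

Lemma sublinearI q : q 0 = 0 -> (forall x y, q (x + y) <= q x + q y) ->
  (forall (r : R) x, 0 < r -> q (r%:C *: x) <= r * q x) -> sublinear q.
Proof.
move=> q0 qD qZ; split=> // r x; rewrite le_eqVlt => /orP[/eqP <-|r0].
  by rewrite mul0r scale0r.
apply/eqP; rewrite eq_le qZ//=.
have := qZ r^-1 (r%:C *: x); rewrite invr_gt0 => /(_ r0).
rewrite scalerA -rmorphM /= mulVf ?gt_eqF// scale1r.
by rewrite -(ler_pM2l r0) mulrA divff ?gt_eqF// mul1r.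
Qed.

(* Pointwise infima of chains of sublinear functionals are sublinear, and a
   minimal sublinear functional is additive. *)
Lemma linear_below_sublinear (p : V -> R) : sublinear p ->
  exists g : V -> R, [/\ forall x, g x <= p x,
    forall x y, g (x + y) = g x + g y &
    forall (r : R) x, g (r%:C *: x) = r * g x].
Proof.
move=> sp.
pose T := {q : V -> R | sublinear q /\ forall x, q x <= p x}.
(* The order is reversed, so that a maximal element for Zorn's lemma is a minimal functional. *)
pose below : rel T := fun q1 q2 => `[< forall x, sval q2 x <= sval q1 x >].
have Tp : T by exists p.
have [||C totC|[q [sq qp]] qmin] := @ZL_preorder T Tp below.
- by move=> t; apply/asboolP.
- move=> r s t /asboolP rs /asboolP st; apply/asboolP => x.
  exact: le_trans (st x) (rs x).
- have [[q0 Cq0]|C0] := pselect (exists q, C q); last first.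
    by exists Tp => s Cs; case: C0; exists s.
  pose E x := [set sval q x | q in C].
  have lb x : has_inf (E x).
    split; first by exists (sval q0 x), q0.
    exists (- p (- x)) => _ [[q [sq qp]] Cq <-] /=.
    by apply: le_trans (sublinearN x sq); rewrite lerN2.
  pose I x := inf (E x).
  have I_le q x : C q -> I x <= sval q x.
    by move=> Cq; apply: ge_inf; [exact: (lb x).2|exists q].
  have I_adh x e : 0 < e -> exists2 q, C q & sval q x < I x + e.
    by move=> e0; have [_ [q Cq <-] h] := inf_adherent e0 (lb x); exists q.
  have sI : sublinear I.
    apply: sublinearI.
    - apply/eqP; rewrite eq_le; apply/andP; split.
        by apply: le_trans (I_le _ _ Cq0) _; rewrite sublinear0//; case: (svalP q0).
      apply: lb_le_inf; first exact: (lb 0).1.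
      by move=> _ [q Cq <-]; rewrite sublinear0//; case: (svalP q).
    - move=> x y; apply: (@ler_eps _ _ _ 2) => // e e0.
      have [q1 C1 h1] := I_adh x _ e0; have [q2 C2 h2] := I_adh y _ e0.
      have [q [Cq qx qy]] : exists q, [/\ C q, sval q x < I x + e & sval q y < I y + e].
        have [/asboolP h|/asboolP h] := totC _ _ C1 C2.
          by exists q2; split=> //; exact: le_lt_trans (h x) h1.
        by exists q1; split=> //; exact: le_lt_trans (h y) h2.
      apply: le_trans (I_le _ _ Cq) _; have := (svalP q).1.1 x y; lra.
    - move=> r x r0; apply: (@ler_eps _ _ _ r) => [|e e0]; first exact: ltW.
      have [q Cq h] := I_adh x _ e0; apply: le_trans (I_le _ _ Cq) _.
      by rewrite (svalP q).1.2 ?(ltW r0)// -mulrDr ler_pM2l// ltW.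
  have Ip x : I x <= p x.
    by apply: le_trans (I_le _ x Cq0) _; exact: (svalP q0).2.
  by exists (exist _ I (conj sI Ip)) => q Cq; apply/asboolP => x; exact: I_le.
have {}qmin q' : sublinear q' -> (forall x, q' x <= q x) -> forall x, q x <= q' x.
  move=> sq' q'q x.
  have q'p y : q' y <= p y by exact: le_trans (q'q y) (qp y).
  have /asboolP : below (exist _ q' (conj sq' q'p)) (exist _ q (conj sq qp)).
    by apply: qmin; apply/asboolP.
  exact.
have qD x y : q (x + y) = q x + q y.
  apply/eqP; rewrite eq_le sq.1 /=.
  (* The infimum over t is sublinear and below q, hence equal to q by minimality; t = 1 then gives q
     y + q x <= q (x + y). *)
  pose E z := [set q (z + t%:C *: x) - t * q x | t in [set t : R | 0 <= t]].
  have lb z : has_inf (E z).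
    split; first by exists (q (z + 0%:C *: x) - 0 * q x), 0 => //=.
    exists (- q (- z)) => _ [t /= t0 <-].
    have := sq.1 (- z) (z + t%:C *: x); rewrite addKr sq.2//; lra.
  pose I z := inf (E z).
  have I_le z t : 0 <= t -> I z <= q (z + t%:C *: x) - t * q x.
    by move=> t0; apply: ge_inf; [exact: (lb z).2|exists t].
  have I_adh z e : 0 < e -> exists2 t, 0 <= t & q (z + t%:C *: x) - t * q x < I z + e.
    by move=> e0; have [_ [t t0 <-] h] := inf_adherent e0 (lb z); exists t.
  have Iq z : I z <= q z.
    by apply: le_trans (I_le z 0 (lexx _)) _; rewrite scale0r addr0 mul0r subr0.
  have sI : sublinear I.
    apply: sublinearI.
    - apply/eqP; rewrite eq_le; apply/andP; split.
        by apply: le_trans (Iq 0) _; rewrite sublinear0.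
      apply: lb_le_inf; first exact: (lb 0).1.
      by move=> _ [t t0 <-]; rewrite add0r sq.2// subrr.
    - move=> z1 z2; apply: (@ler_eps _ _ _ 2) => // e e0.
      have [t1 t10 h1] := I_adh z1 _ e0; have [t2 t20 h2] := I_adh z2 _ e0.
      apply: le_trans (I_le _ (t1 + t2) (addr_ge0 t10 t20)) _.
      have := sq.1 (z1 + t1%:C *: x) (z2 + t2%:C *: x).
      rewrite addrACA -scalerDl -rmorphD /=; lra.
    - move=> s u s0; apply: (@ler_eps _ _ _ s) => [|e e0]; first exact: ltW.
      have [t t0 h] := I_adh u _ e0.
      apply: le_trans (I_le _ (s * t) (mulr_ge0 (ltW s0) t0)) _.
      rewrite rmorphM /= -scalerA -scalerDr sq.2 ?(ltW s0)//.
      by rewrite -mulrA -mulrBr -mulrDr ler_pM2l// ltW.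
  have := qmin _ sI Iq y; have := I_le y 1 ler01.
  by rewrite scale1r mul1r [y + x]addrC; lra.
exists q; split=> // r x.
have [r0|r0] := leP 0 r; first exact: sq.2.
have qN y : q (- y) = - q y.
  by have := qD y (- y); rewrite subrr sublinear0//; lra.
have : q ((- r)%:C *: x) = - r * q x by apply: sq.2; rewrite oppr_ge0 ltW.
rewrite rmorphN scaleNr qN mulNr; exact: oppr_inj.
Qed.
End SublinearFunctionals.

(** * Spectral triples and their Lipschitz seminorms *)

Lemma cabsi (R : realType) : cabs ('i%C : R[i]) = 1.
Proof. by rewrite /cabs normc_def /= expr0n expr1n add0r sqrtr1. Qed.

Lemma cabsV (R : realType) (k : R[i]) : cabs k^-1 = (cabs k)^-1.
Proof.
have [->|k0] := eqVneq k 0; first by rewrite invr0 /cabs normr0 /= invr0.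
have c0 : cabs k != 0 by apply: contraNneq k0 => /cabs_eq0 ->.
apply: (mulIf c0); rewrite -cabsM !mulVf// .
by rewrite /cabs normr1.
Qed.

Lemma cabs2 (R : realType) : cabs (2 : R[i]) = 2.
Proof. by rewrite (_ : 2 = (2 : R)%:C) ?cabs_real ?ger0_norm// rmorph_nat. Qed.

Section RealParts.
Variables (R : realType) (A : cstarAlgType R).
Implicit Types a b : A.

Lemma re_part_sa a : star (re_part a) = re_part a.
Proof.
rewrite /re_part starZ starD starK addrC; congr (_ *: _).
by rewrite conjc_inv conjc_nat.
Qed.

Lemma im_part_sa a : star (im_part a) = im_part a.
Proof.
rewrite /im_part starZ starB starK -opprB scalerN -scaleNr; congr (_ *: _).
rewrite conjc_inv -invrN; congr (_^-1).
rewrite (_ : 2 = (2 : R)%:C); last by rewrite rmorph_nat.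
by apply/eqP; rewrite eq_complex /=; apply/andP; split; apply/eqP; ring.
Qed.

Lemma re_part_id a : star a = a -> re_part a = a.
Proof.
move=> sa; rewrite /re_part sa -{1 2}[a]scale1r -scalerDl scalerA.
by rewrite mulVf ?scale1r// pnatr_eq0.
Qed.

Lemma re_partB a b : re_part (a - b) = re_part a - re_part b.
Proof. by rewrite /re_part starB -scalerBr opprD addrACA. Qed.

Lemma anorm_half (k : R[i]) a b : cabs k = 2^-1 -> anorm a = anorm b ->
  anorm (k *: (a + b)) <= anorm a.
Proof.
move=> kE ab; rewrite anormZ kE ler_pdivrMl//.
by apply: le_trans (anormD _ _) _; rewrite -ab mulr2n mulrDl mul1r.
Qed.

Lemma cabs_re_coef : cabs ((2 : R[i])^-1) = 2^-1.
Proof. by rewrite cabsV cabs2. Qed.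

Lemma cabs_im_coef : cabs ((2 * 'i%C : R[i])^-1) = 2^-1.
Proof. by rewrite cabsV cabsM cabs2 cabsi mulr1. Qed.

Lemma re_part_anorm a : anorm (re_part a) <= anorm a.
Proof. by apply: anorm_half; [exact: cabs_re_coef|rewrite star_anorm]. Qed.

Lemma state_re_part (phi : A -> R[i]^o) a : state phi ->
  complex.Re (phi (re_part a) : R[i]) = complex.Re (phi a : R[i]).
Proof.
move=> sphi; rewrite /re_part stateZ// stateD// state_star//.
rewrite (_ : (2 : R[i])^-1 = (2^-1)%:C); last by rewrite fmorphV rmorph_nat.
by rewrite Re_mulr; case: (phi a) => p q /=; field.
Qed.
End RealParts.

Section Representation.
Variables (R : realType) (S : spectralData R).
Hypothesis st : spectral_triple S.
Local Notation A := (salg S).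
Local Notation H := (shil S).
Local Notation D := (Defs.dirac S).
Implicit Types (a b : salg S) (x y : shil S).

Lemma sactD a b x : sact (a + b) x = sact a x + sact b x.
Proof. by have := st_actP st x 1 a b; rewrite !scale1r. Qed.

Lemma sactZ (k : R[i]) a x : sact (k *: a) x = k *: sact a x.
Proof.
have h0 : sact (0 : A) x = 0.
  by have := st_actP st x 1 0 0; rewrite !scale1r addr0 -{1}[sact 0 x]addr0 => /addrI.
by have := st_actP st x k a 0; rewrite addr0 h0 addr0.
Qed.

Lemma sactB a b x : sact (a - b) x = sact a x - sact b x.
Proof. by rewrite sactD -scaleN1r sactZ scaleN1r. Qed.

Lemma sactDr a x y : sact a (x + y) = sact a x + sact a y.
Proof. by have := st_linear st a 1 x y; rewrite !scale1r. Qed.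

Lemma sactZr (k : R[i]) a x : sact a (k *: x) = k *: sact a x.
Proof.
have h0 : sact a 0 = 0.
  by have := st_linear st a 1 0 0; rewrite !scale1r addr0 -{1}[sact a 0]addr0 => /addrI.
by have := st_linear st a k x 0; rewrite addr0 h0 addr0.
Qed.

Lemma sactBr a x y : sact a (x - y) = sact a x - sact a y.
Proof. by rewrite sactDr -scaleN1r sactZr scaleN1r. Qed.

Lemma anorm_leP a (c : R) : 0 <= c ->
  anorm a <= c <-> forall x, nrm (sact a x) <= c * nrm x.
Proof.
move=> c0; rewrite -lee_fin -(st_isometric st).
have h := @opnorm_leP R H setT (sact a) I (fun _ _ _ => I) (fun k x _ => sactZr k a x) c c0.
by split=> [/h h' x|h']; [exact: h'|apply/h => x _].
Qed.

Lemma sact_bound a x : nrm (sact a x) <= anorm a * nrm x.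
Proof. exact: (anorm_leP a (anorm_ge0 a)).1. Qed.

(** On the zero space an isometric representation would give the unit norm 0. The vector provides
    vector states. *)
Lemma rep_unit_vector : exists x : H, nrm x = 1.
Proof.
apply: contrapT => h.
have z (x : H) : x = 0.
  apply: contrapT => /eqP x0; apply: h; exists ((nrm x)^-1%:C *: x).
  have n0 : nrm x != 0 by apply: contraNneq x0 => /nrm_eq0 ->.
  by rewrite nrmZr ger0_norm ?invr_ge0 ?nrm_ge0// mulVf.
have : anorm (1 : A) <= 0.
  by apply/anorm_leP => // x; rewrite (z (sact _ x)) nrm0 mul0r.
by rewrite anorm1 ler10.
Qed.

Lemma vector_state x : nrm x = 1 ->
  state (fun a : A => hdot H (sact a x) x : R[i]^o).
Proof.
move=> x1; split=> [k a b|a|].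
- by rewrite sactD sactZ hdotDl hdotZl.
- by rewrite (st_actM st) (st_adjoint st) starK hdotxx ler0c sqr_ge0.
- by rewrite (st_act1 st) hdotxx x1 expr1n.
Qed.

(** For self-adjoint a, polarisation bounds Re<ax, y> by c (|x|^2 + |y|^2) / 2. *)
Lemma numerical_radius a (c : R) : 0 <= c -> star a = a ->
  (forall x, `|complex.Re (hdot H (sact a x) x)| <= c * nrm x ^+ 2) ->
  anorm a <= c.
Proof.
move=> c0 sa h; apply/anorm_leP => // x.
have [n0|n0] := eqVneq (nrm (sact a x)) 0.
  by rewrite n0 mulr_ge0 ?nrm_ge0.
have np : 0 < nrm (sact a x) by rewrite lt_def n0 nrm_ge0.
have key y : complex.Re (hdot H (sact a x) y) <= c / 2 * (nrm x ^+ 2 + nrm y ^+ 2).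
  have := h (x + y); have := h (x - y); rewrite !ler_norml => /andP[h1 _] /andP[_ h2].
  have := parallelogram x y; move: h1 h2.
  have sactNr z : sact a (- z) = - sact a z by rewrite -scaleN1r sactZr scaleN1r.
  rewrite !(sactDr, sactNr, hdotDl, hdotDr, hdotNl, hdotNr) opprK.
  rewrite !(raddfD (@complex.Re R)) !(raddfN (@complex.Re R)) /=.
  have -> : complex.Re (hdot H (sact a y) x) = complex.Re (hdot H (sact a x) y).
    by rewrite (st_adjoint st) sa rdotC.
  move=> h1 h2 pl.
  have : c * (nrm (x + y) ^+ 2 + nrm (x - y) ^+ 2) = c * (2 * (nrm x ^+ 2 + nrm y ^+ 2)).
    by rewrite pl.
  lra.
(* y points along a x and has the length of x, so the bound reads |x||ax| <= c|x|^2. *)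
have := key ((nrm x / nrm (sact a x))%:C *: sact a x).
rewrite hdotZr conjc_real hdotxx -rmorphM /= nrmZr.
rewrite ger0_norm ?divr_ge0 ?nrm_ge0// divfK//.
rewrite expr2 mulrA divfK//.
have [x0|x0] := eqVneq (nrm x) 0.
  by move=> _; have := sact_bound a x; rewrite x0 !mulr0.
have xp : 0 < nrm x by rewrite lt_def x0 nrm_ge0.
by move=> h1; rewrite -(ler_pM2l xp); lra.
Qed.

Lemma dom_commutatorZ a : preserves_dom a -> forall (k : R[i]) x, odom D x ->
  commutator D (sact a) (k *: x) = k *: commutator D (sact a) x.
Proof.
move=> pa k x dx; have sD := st_self_adjoint st.
by rewrite /commutator sactZr (sa_Z sD _ (pa _ dx)) (sa_Z sD _ dx) sactZr scalerBr.
Qed.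

Let commnorm_leP a (c : R) : preserves_dom a -> 0 <= c ->
  (commnorm a <= c%:E)%E <->
  forall x, odom D x -> nrm (commutator D (sact a) x) <= c * nrm x.
Proof.
move=> pa c0; have sD := st_self_adjoint st.
apply: opnorm_leP => //; first exact: sa_dom0.
  by move=> k x; exact: sa_domZ.
exact: dom_commutatorZ.
Qed.

Lemma commnorm_ge0 a : (0 <= commnorm a)%E.
Proof. by apply: opnorm_ge0; exact: sa_dom0 (st_self_adjoint st). Qed.

Lemma commnormE a : smooth a -> commnorm a = (lipD S a)%:E.
Proof.
move=> [_ fa]; rewrite /= fineK// fin_numElt fa andbT.
by apply: lt_le_trans (commnorm_ge0 a); rewrite ltNyr.
Qed.

Lemma lip_ge0 a : 0 <= lipD S a.
Proof. by rewrite /= fine_ge0// commnorm_ge0. Qed.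

Lemma lip_bound a x : smooth a -> odom D x ->
  nrm (commutator D (sact a) x) <= lipD S a * nrm x.
Proof.
move=> sa dx; apply: (commnorm_leP sa.1 (lip_ge0 a)).1 => //.
by rewrite commnormE.
Qed.

Lemma lip_leP a (c : R) : 0 <= c -> preserves_dom a ->
  (forall x, odom D x -> nrm (commutator D (sact a) x) <= c * nrm x) ->
  smooth a /\ lipD S a <= c.
Proof.
move=> c0 pa h; have le : (commnorm a <= c%:E)%E by apply/commnorm_leP.
have sa : smooth a by split=> //; apply: le_lt_trans le _; rewrite ltry.
by split=> //; rewrite -lee_fin -commnormE.
Qed.

Lemma smoothD a b : smooth a -> smooth b ->
  smooth (a + b) /\ lipD S (a + b) <= lipD S a + lipD S b.
Proof.
move=> sa sb; have sD := st_self_adjoint st.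
apply: lip_leP => [|x dx|x dx].
- by rewrite addr_ge0 ?lip_ge0.
- by rewrite sactD; apply: (sa_domD sD); [exact: sa.1|exact: sb.1].
have -> : commutator D (sact (a + b)) x = commutator D (sact a) x + commutator D (sact b) x.
  by rewrite /commutator !sactD (sa_D sD (sa.1 _ dx) (sb.1 _ dx)) opprD addrACA.
by rewrite mulrDl (le_trans (nrmD _ _))// lerD ?lip_bound.
Qed.

Lemma smoothZ (k : R[i]) a : smooth a ->
  smooth (k *: a) /\ lipD S (k *: a) <= cabs k * lipD S a.
Proof.
move=> sa; have sD := st_self_adjoint st.
apply: lip_leP => [|x dx|x dx].
- by rewrite mulr_ge0 ?lip_ge0 ?cabs_ge0.
- by rewrite sactZ; apply: (sa_domZ sD); exact: sa.1.
have -> : commutator D (sact (k *: a)) x = k *: commutator D (sact a) x.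
  by rewrite /commutator !sactZ (sa_Z sD _ (sa.1 _ dx)) scalerBr.
by rewrite nrmZ -mulrA ler_wpM2l ?cabs_ge0// lip_bound.
Qed.

Lemma smoothM a b : smooth a -> smooth b ->
  smooth (a * b) /\ lipD S (a * b) <= anorm a * lipD S b + lipD S a * anorm b.
Proof.
move=> sa sb; have sD := st_self_adjoint st.
apply: lip_leP => [|x dx|x dx].
- by rewrite addr_ge0 ?mulr_ge0 ?lip_ge0 ?anorm_ge0.
- by rewrite (st_actM st); apply: sa.1; exact: sb.1.
have -> : commutator D (sact (a * b)) x =
    sact a (commutator D (sact b) x) + commutator D (sact a) (sact b x).
  by rewrite /commutator !(st_actM st) sactBr [RHS]addrC [RHS]addrA subrK.
apply: le_trans (nrmD _ _) _; rewrite mulrDl lerD//.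
  apply: le_trans (sact_bound _ _) _; rewrite -mulrA.
  by rewrite ler_wpM2l ?anorm_ge0// lip_bound.
apply: le_trans (lip_bound sa (sb.1 _ dx)) _; rewrite -mulrA.
by rewrite ler_wpM2l ?lip_ge0// sact_bound.
Qed.

(** On the domain of D, <[D, a*] x, y> = - <x, [D, a] y>. *)
Lemma smooth_star a : smooth a -> smooth (star a) /\ lipD S (star a) <= lipD S a.
Proof.
move=> sa; have sD := st_self_adjoint st.
have [pa' _] := st_star st sa.
apply: lip_leP => // [|x dx]; first exact: lip_ge0.
apply: (nrm_dual_le (sa_dense sD)) => [|y dy].
  by rewrite mulr_ge0 ?nrm_ge0 ?lip_ge0.
have -> : hdot H (commutator D (sact (star a)) x) y = - hdot H x (commutator D (sact a) y).
  rewrite /commutator hdotBl hdotBr (sa_sym sD (pa' _ dx) dy).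
  rewrite !(st_adjoint st) starK (sa_sym sD dx (sa.1 _ dy)).
  by rewrite opprB.
rewrite /cabs normrN -/(cabs _); apply: le_trans (cauchy_schwarz _ _) _.
have := lip_bound sa dy; have := nrm_ge0 x; nra.
Qed.

Lemma smooth_scalar (k : R[i]) : smooth (k%:A : A) /\ lipD S (k%:A : A) <= 0.
Proof.
have sD := st_self_adjoint st.
apply: lip_leP => // x dx.
  by rewrite sactZ (st_act1 st); exact: sa_domZ.
by rewrite /commutator !sactZ !(st_act1 st) (sa_Z sD _ dx) subrr nrm0 mul0r.
Qed.

Lemma smooth_average (k : R[i]) a b c : cabs k = 2^-1 ->
  smooth a -> smooth b -> lipD S a <= c -> lipD S b <= c ->
  smooth (k *: (a + b)) /\ lipD S (k *: (a + b)) <= c.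
Proof.
move=> kE sa sb ac bc; have [sab lab] := smoothD sa sb.
have [s l] := smoothZ k sab; split=> //.
by apply: le_trans l _; rewrite kE; lra.
Qed.

Lemma smooth_re_part a : smooth a ->
  smooth (re_part a) /\ lipD S (re_part a) <= lipD S a.
Proof.
move=> sa; have [ss ls] := smooth_star sa.
by apply: smooth_average => //; exact: cabs_re_coef.
Qed.

Lemma smooth_im_part a : smooth a ->
  smooth (im_part a) /\ lipD S (im_part a) <= lipD S a.
Proof.
move=> sa; have [ss ls] := smooth_star sa.
have [sn ln] := smoothZ (-1) ss.
have e : cabs (-1 : R[i]) = 1 by rewrite /cabs normrN normr1.
rewrite e mul1r scaleN1r in ln; rewrite scaleN1r in sn.
apply: smooth_average => //; first exact: cabs_im_coef.
exact: le_trans ln ls.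
Qed.

(** Lower semicontinuity of the commutator norm. The vectors b x approximate a x with uniformly
    bounded graph norms, so a x stays in the domain by [graph_ball_closed]. *)
Lemma smooth_closed a (c : R) : 0 <= c ->
  (forall e : R, 0 < e -> exists b, [/\ smooth b, lipD S b <= c & anorm (a - b) < e]) ->
  smooth a /\ lipD S a <= c.
Proof.
move=> c0 h; have sD := st_self_adjoint st.
have pa : preserves_dom a.
  move=> x dx.
  (* Bounds the graph norm of b x for every admissible b within 1 of a, through D b x = [D, b] x + b
     D x. *)
  pose k := (anorm a + 1) * nrm x + (c * nrm x + (anorm a + 1) * nrm (D x)).
  suff [] : odom D (sact a x) /\ nrm (sact a x) + nrm (D (sact a x)) <= k by [].
  apply: (graph_ball_closed sD) => e e0.
  pose e' := Num.min 1 (e / (nrm x + 1)).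
  have x1 : 0 < nrm x + 1 by rewrite ltr_wpDl ?nrm_ge0.
  have [|b [sb lb ab]] := h e'; first by rewrite lt_min ltr01 divr_gt0.
  move: ab; rewrite lt_min => /andP[ab1 abe].
  have bn : anorm b <= anorm a + 1.
    have := anorm_tri a b 0; rewrite !subr0 anormBC; lra.
  exists (sact b x); last first.
    rewrite -sactB; apply: le_lt_trans (sact_bound _ _) _.
    move: abe; rewrite ltr_pdivlMr// => abe.
    by have := anorm_ge0 (a - b); nra.
  split; first exact: sb.1.
  have h1 := sact_bound b x; have h2 := sact_bound b (D x).
  have h3 := lip_bound sb dx.
  have h4 : nrm (D (sact b x)) <= nrm (commutator D (sact b) x) + nrm (sact b (D x)).
    by rewrite -{1}[D (sact b x)](subrK (sact b (D x))); exact: nrmD.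
  have h5 : anorm b * nrm x <= (anorm a + 1) * nrm x by rewrite ler_wpM2r ?nrm_ge0.
  have h6 : anorm b * nrm (D x) <= (anorm a + 1) * nrm (D x) by rewrite ler_wpM2r ?nrm_ge0.
  have h7 : lipD S b * nrm x <= c * nrm x by rewrite ler_wpM2r ?nrm_ge0.
  rewrite /k; lra.
apply: lip_leP => // x dx.
apply: (nrm_dual_le (sa_dense sD)) => [|y dy]; first by rewrite mulr_ge0 ?nrm_ge0.
apply: (@ler_eps _ _ _ (nrm x * nrm (D y) + nrm (D x) * nrm y)) => [|e e0].
  by rewrite addr_ge0 ?mulr_ge0 ?nrm_ge0.
have [b [sb lb ab]] := h e e0.
(* Moving D onto y leaves only the bounded operator a - b in the error. *)
have -> : hdot H (commutator D (sact a) x) y = hdot H (commutator D (sact b) x) y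
    + (hdot H (sact (a - b) x) (D y) - hdot H (sact (a - b) (D x)) y).
  rewrite /commutator !hdotBl !sactB !hdotBl.
  by rewrite (sa_sym sD (pa _ dx) dy) (sa_sym sD (sb.1 _ dx) dy); ring.
have h1 := cauchy_schwarz (commutator D (sact b) x) y.
have h2 := cauchy_schwarz (sact (a - b) x) (D y).
have h3 := cauchy_schwarz (sact (a - b) (D x)) y.
have h4 := lip_bound sb dx.
have h5 := sact_bound (a - b) x; have h6 := sact_bound (a - b) (D x).
have h7 := cabsD (hdot H (commutator D (sact b) x) y)
  (hdot H (sact (a - b) x) (D y) - hdot H (sact (a - b) (D x)) y).
have h8 := cabsD (hdot H (sact (a - b) x) (D y)) (- hdot H (sact (a - b) (D x)) y).
have h9 : cabs (- hdot H (sact (a - b) (D x)) y) = cabs (hdot H (sact (a - b) (D x)) y).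
  by rewrite /cabs normrN.
have x0 := nrm_ge0 x; have y0 := nrm_ge0 y.
have Dx0 := nrm_ge0 (D x); have Dy0 := nrm_ge0 (D y).
have k1 : nrm (commutator D (sact b) x) * nrm y <= c * nrm x * nrm y.
  rewrite ler_wpM2r//; apply: le_trans h4 _; by rewrite ler_wpM2r.
have k2 : nrm (sact (a - b) x) * nrm (D y) <= e * nrm x * nrm (D y).
  rewrite ler_wpM2r//; apply: le_trans h5 _; by rewrite ler_wpM2r// ltW.
have k3 : nrm (sact (a - b) (D x)) * nrm y <= e * nrm (D x) * nrm y.
  rewrite ler_wpM2r//; apply: le_trans h6 _; by rewrite ler_wpM2r// ltW.
rewrite h9 in h8; lra.
Qed.
End Representation.

(** * The weak-* topology and the Monge-Kantorovich metric *)

Section WeakStar.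
Variables (R : realType) (A : cstarAlgType R).
Implicit Types (phi psi : A -> R[i]^o) (a b : A) (s : seq A).

Definition weak_close s (e : R) phi psi :=
  forall a, a \in s -> cabs ((phi a : R[i]) - psi a) < e.

(** The sets given by finitely many test elements and one radius form a filter, which is compared
    with the neighbourhood filter through pointwise convergence. *)
Lemma weak_star_nbhsP phi (U : set (A -> R[i]^o)) :
  within (@state R A) (nbhs (phi : {ptws A -> R[i]^o})) U <->
  exists s e, 0 < e /\ forall psi, state psi -> weak_close s e phi psi -> U psi.
Proof.
pose F : set_system (A -> R[i]^o) := [set V | exists s e, 0 < e /\
  forall psi, weak_close s e phi psi -> V psi].
have FF : Filter F.
  split.
  - by exists [::], 1.
  - move=> V W [s [e [e0 sV]]] [s' [e' [e'0 sW]]].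
    exists (s ++ s'), (Num.min e e'); split; first by rewrite lt_min e0.
    move=> psi c; split; [apply: sV|apply: sW] => a sa; have := c a;
      rewrite mem_cat sa ?orbT => /(_ isT); rewrite lt_min => /andP[] //.
  - by move=> V W VW [s [e [e0 sV]]]; exists s, e; split=> // psi /sV; exact: VW.
have nP := @pointwise_cvgP (nspace A) (R[i]^o).
have nbF (V : set (A -> R[i]^o)) : nbhs (phi : {ptws A -> R[i]^o}) V <-> F V.
  split.
    have : {ptws, F --> (phi : nspace A -> R[i]^o)}.
      apply/nP => t; apply/cvg_nrmP => e e0; exists [:: t], e; split=> // psi h.
      by apply: h; rewrite inE.
    exact.
  move=> [s [e [e0 sV]]].
  have FN : Filter (nbhs (phi : {ptws A -> R[i]^o})) := nbhs_filter _.
  apply: (@filterS _ _ FN _ _ sV).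
  elim: s {sV} => [|a s ih]; first by apply: (@filterE _ _ FN) => psi b; rewrite in_nil.
  have ha : nbhs (phi : {ptws A -> R[i]^o}) [set psi | cabs ((phi a : R[i]) - psi a) < e].
    have /nP/(_ a) : {ptws, nbhs (phi : {ptws nspace A -> R[i]^o}) --> (phi : nspace A -> R[i]^o)}.
      exact: cvg_id.
    by move=> /cvg_nrmP; apply.
  apply: (@filterS2 _ _ FN _ _ _ _ ha ih) => psi h1 h2 b.
  by rewrite inE => /predU1P[->|]; [exact: h1|exact: h2].
split.
  move=> /nbF[s [e [e0 sU]]]; exists s, e; split=> // psi spsi c; exact: sU.
move=> [s [e [e0 sU]]]; apply/nbF; exists s, e; split=> // psi c spsi; exact: sU.
Qed.
End WeakStar.

Section MongeKantorovich.
Variables (R : realType) (A : cstarAlgType R).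
Implicit Types (phi psi : A -> R[i]^o) (a b : A) (L : seminorm A).

Lemma metrizes_weak_star_ext (d d' : (A -> R[i]^o) -> (A -> R[i]^o) -> \bar R) :
  (forall phi psi, state phi -> state psi -> d phi psi = d' phi psi) ->
  metrizes_weak_star d -> metrizes_weak_star d'.
Proof.
move=> dd' [h1 h2 h3 h4 h5]; split.
- by move=> phi psi sp sq; rewrite -dd'//; exact: h1.
- by move=> phi psi sp sq; rewrite -dd'//; exact: h2.
- by move=> phi psi sp sq; rewrite -!dd'//; exact: h3.
- by move=> phi psi chi sp sq sr; rewrite -!dd'//; exact: h4.
- move=> phi sp U; apply: (iff_trans (h5 phi sp U)).
  by split=> -[e e0 h]; exists e => // psi sq; have := h psi sq; rewrite dd'.
Qed.

Lemma mk_le L phi psi (c : R) :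
  (forall a, ldom L a -> L a <= 1 -> cabs ((phi a : R[i]) - psi a) <= c) ->
  (mk L phi psi <= c%:E)%E.
Proof.
by move=> h; apply: ge_ereal_sup => _ [a [da La] <-]; rewrite lee_fin; exact: h.
Qed.

Lemma mk_ge L phi psi a : ldom L a -> L a <= 1 ->
  ((cabs ((phi a : R[i]) - psi a))%:E <= mk L phi psi)%E.
Proof. by move=> da La; apply: ereal_sup_ubound; exists a. Qed.

Lemma mkC L phi psi : mk L phi psi = mk L psi phi.
Proof.
congr (ereal_sup _); rewrite eqEsubset; split=> _ [a aP <-]; exists a => //;
  by congr (_%:E); rewrite /cabs distrC.
Qed.

Lemma re_im_part a : a = re_part a + ('i%C : R[i]) *: im_part a.
Proof.
rewrite /re_part /im_part scalerA.
have -> : 'i%C * (2 * 'i%C)^-1 = 2^-1 :> R[i].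
  rewrite invfM mulrCA divff ?mulr1//.
  by apply/eqP => /(congr1 (@cabs R)); rewrite cabsi /cabs normr0 => /eqP; rewrite oner_eq0.
rewrite -scalerDr addrACA subrr addr0 -{2 3}[a]scale1r -scalerDl scalerA.
by rewrite mulVf ?scale1r// pnatr_eq0.
Qed.

Section Dense.
Variable L : seminorm A.
Hypothesis L0 : ldom L 0.
Hypothesis LZ : forall (r : R) a, ldom L a -> ldom L (r%:C *: a).
Hypothesis L_dense : @selfadjoint R A `<=` (closure (ldom L : set (nspace A)) : set A).
Hypothesis L_ge0 : forall a, ldom L a -> 0 <= L a.
Hypothesis L_hom : forall (r : R) a, ldom L a -> L (r%:C *: a) = `|r| * L a.

Lemma mk_ge0 phi psi : (0 <= mk L phi psi)%E.
Proof.
apply: le_trans (_ : (cabs ((phi 0 : R[i]) - psi 0))%:E <= _)%E.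
  by rewrite lee_fin cabs_ge0.
apply: mk_ge => //.
by have := L_hom 0 L0; rewrite scale0r normr0 mul0r => ->.
Qed.

Lemma mk_fin phi psi (c : R) : (mk L phi psi <= c%:E)%E -> mk L phi psi \is a fin_num.
Proof.
move=> h; rewrite fin_numElt (lt_le_trans _ (mk_ge0 phi psi)) ?ltNyr//=.
by rewrite (le_lt_trans h) ?ltry.
Qed.

Lemma mk_bound phi psi a (c : R) : ldom L a -> (mk L phi psi <= c%:E)%E ->
  state phi -> state psi -> cabs ((phi a : R[i]) - psi a) <= (L a + 1) * c.
Proof.
move=> da h sphi spsi.
have La := L_ge0 da; have k0 : 0 < L a + 1 by rewrite ltr_wpDl.
(* Dividing by L a + 1 instead of L a also covers L a = 0. *)
have := @mk_ge L phi psi ((L a + 1)^-1%:C *: a) (LZ _ da).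
rewrite L_hom// ger0_norm ?invr_ge0 ?(ltW k0)// ler_pdivrMl// mulr1 lerDl.
move=> /(_ ler01)/le_trans/(_ h); rewrite lee_fin stateZ// stateZ// -mulrBr cabsM.
by rewrite cabs_real ger0_norm ?invr_ge0 ?(ltW k0)// ler_pdivrMl.
Qed.

(** Real and imaginary parts are approximated by elements of the dense domain, where [mk] bounds the
    difference of the states; contractivity of states absorbs the approximation error. *)
Lemma mk_finer phi a (e : R) : state phi -> 0 < e -> exists2 d : R, 0 < d &
  forall psi, state psi -> (mk L phi psi < d%:E)%E -> cabs ((phi a : R[i]) - psi a) < e.
Proof.
move=> sphi e0.
have sa_case b : star b = b -> exists2 d : R, 0 < d & forall psi, state psi ->
    (mk L phi psi < d%:E)%E -> cabs ((phi b : R[i]) - psi b) < e / 2.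
  (* Two approximation errors and one [mk] term of e / 8 stay below e / 2, the share of each of the
     two parts. *)
  move=> sb; have /L_dense/closure_nrmP/(_ (e / 8)) : selfadjoint b by [].
  rewrite divr_gt0// => /(_ isT) [c dc bc].
  have Lc := L_ge0 dc; have k0 : 0 < L c + 1 by rewrite ltr_wpDl.
  exists (e / 8 / (L c + 1)) => [|psi spsi]; first by rewrite !divr_gt0.
  move=> /ltW/(mk_bound dc)/(_ sphi spsi); rewrite mulrC divfK ?gt_eqF// => h.
  have -> : (phi b : R[i]) - psi b =
    ((phi (b - (c : A)) : R[i]) + ((phi c : R[i]) - psi c)) - psi (b - (c : A)).
    by rewrite (stateB sphi) (stateB spsi); ring.
  rewrite nspace_nrm in bc.
  have h1 := state_contractive sphi (b - (c : A)); have h2 := state_contractive spsi (b - (c : A)).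
  apply: le_lt_trans (cabsD _ _) _; rewrite /cabs normrN -!/(cabs _).
  have := cabsD (phi (b - (c : A))) ((phi c : R[i]) - psi c).
  have : anorm (b - (c : A)) < e / 8 by [].
  lra.
have [d1 d10 h1] := sa_case _ (re_part_sa a).
have [d2 d20 h2] := sa_case _ (im_part_sa a).
exists (Num.min d1 d2) => [|psi spsi]; first by rewrite lt_min d10.
rewrite EFin_min lt_min => /andP[/(h1 _ spsi) k1 /(h2 _ spsi) k2].
have E chi : state chi ->
    (chi a : R[i]) = (chi (re_part a) : R[i]) + 'i%C * (chi (im_part a) : R[i]).
  by move=> sc; rewrite {1}(re_im_part a) (stateD sc) (stateZ sc).
rewrite (E _ sphi) (E _ spsi) opprD addrACA -mulrBr; apply: le_lt_trans (cabsD _ _) _.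
by rewrite cabsM cabsi mul1r; lra.
Qed.

(** [mk_finer] already puts an [mk] ball in every weak-* neighbourhood, so finiteness and the
    converse comparison are what remains to be checked for each seminorm. *)
Lemma mk_metrizes :
  (forall phi psi, state phi -> state psi -> mk L phi psi \is a fin_num) ->
  (forall phi (e : R), state phi -> 0 < e -> exists s (d : R), 0 < d /\
     forall psi, state psi -> weak_close s d phi psi -> (mk L phi psi < e%:E)%E) ->
  metrizes_weak_star (mk L).
Proof.
move=> fin coarser; split=> //.
- move=> phi psi sphi spsi; split=> [mk0|->].
    apply: funext => a; apply/eqP; rewrite -subr_eq0; apply/eqP/cabs_eq0/eqP.
    rewrite eq_le cabs_ge0 andbT; apply: (@ler_eps _ _ _ 1) => // e e0.
    have [d d0 h] := mk_finer a sphi e0; rewrite add0r mul1r ltW// h// mk0.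
    by rewrite lte_fin.
  apply/eqP; rewrite eq_le mk_ge0 andbT; apply: mk_le => a _ _.
  by rewrite subrr /cabs normr0.
- by move=> phi psi _ _; exact: mkC.
- move=> phi psi chi sphi spsi schi.
  rewrite -(fineK (fin _ _ sphi spsi)) -(fineK (fin _ _ spsi schi)) -EFinD.
  apply: mk_le => a da La.
  have -> : (phi a : R[i]) - chi a = ((phi a : R[i]) - psi a) + ((psi a : R[i]) - chi a).
    by rewrite addrA subrK.
  apply: le_trans (cabsD _ _) _.
  by rewrite lerD// -lee_fin fineK ?fin//; exact: mk_ge.
- move=> phi sphi U; apply: (iff_trans (weak_star_nbhsP phi U)); split.
    move=> [s [e [e0 sU]]].
    suff [d d0 hd] : exists2 d : R, 0 < d & forall psi, state psi ->
        (mk L phi psi < d%:E)%E -> weak_close s e phi psi.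
      by exists d => // psi spsi /(hd _ spsi); exact: sU.
    elim: s {sU} => [|a s [d d0 hd]]; first by exists 1.
    have [d' d'0 hd'] := mk_finer a sphi e0.
    exists (Num.min d d') => [|psi spsi]; first by rewrite lt_min d0.
    rewrite EFin_min lt_min => /andP[/(hd _ spsi) k1 /(hd' _ spsi) k2] b.
    by rewrite inE => /predU1P[->//|]; exact: k1.
  move=> [e e0 eU]; have [s [d [d0 h]]] := coarser phi e sphi e0.
  by exists s, d; split=> // psi spsi /(h _ spsi); exact: eU.
Qed.
End Dense.

Lemma metrizes_coarser L phi (e : R) : metrizes_weak_star (mk L) -> state phi ->
  0 < e -> exists s (d : R), 0 < d /\
     forall psi, state psi -> weak_close s d phi psi -> (mk L phi psi < e%:E)%E.
Proof.
move=> [_ _ _ _ h] sphi e0.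
by apply/(weak_star_nbhsP phi [set psi | (mk L phi psi < e%:E)%E])/h => //; exists e.
Qed.

Lemma state_convex phi psi (r : R) : state phi -> state psi -> 0 <= r <= 1 ->
  state (fun a => (1 - r)%:C * (phi a : R[i]) + r%:C * (psi a : R[i]) : R[i]^o).
Proof.
move=> sphi spsi /andP[r0 r1]; split=> [k a b|a|].
- rewrite (stateD sphi) (stateD spsi) (stateZ sphi) (stateZ spsi).
  rewrite [RHS](_ : _ = k * ((1 - r)%:C * (phi a : R[i]) + r%:C * (psi a : R[i])) +
    ((1 - r)%:C * (phi b : R[i]) + r%:C * (psi b : R[i])))//; ring.
- by rewrite addr_ge0// mulr_ge0 ?ler0c ?subr_ge0//; exact: state_pos.
- by rewrite (state1 sphi) (state1 spsi) !mulr1 -rmorphD /= subrK.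
Qed.

(* On a segment from phi to psi, [mk] is proportional to the parameter while the
   weak-* distance tends to 0 uniformly in psi. *)
Lemma mk_diameter L : metrizes_weak_star (mk L) ->
  exists2 K : R, 0 <= K & forall phi psi, state phi -> state psi ->
    forall a, ldom L a -> L a <= 1 -> cabs ((phi a : R[i]) - psi a) <= K.
Proof.
move=> mL; have [[phi0 s0]|no] := pselect (exists phi, @state R A phi); last first.
  by exists 0 => // phi psi sphi; case: no; exists phi.
have [s [d [d0 h]]] := metrizes_coarser mL s0 ltr01.
have [M M0 Ms] := seq_anorm_bounded s.
have k0 : 0 < 2 * M + d by lra.
(* Moving phi0 by the fraction r towards psi changes the test values by at most 2 M r < d, so [mk]
   stays below 1; undoing the factor r bounds the distance to psi by 1 / r. *)
pose r := Num.min 1 (d / (2 * M + d) / 2).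
have r0 : 0 < r by rewrite lt_min ltr01 !divr_gt0.
have r1 : r <= 1 by rewrite ge_min lexx.
have key psi a : state psi -> ldom L a -> L a <= 1 -> cabs ((phi0 a : R[i]) - psi a) <= r^-1.
  move=> spsi da La; have r01 : 0 <= r <= 1 by rewrite ltW.
  have sc := state_convex s0 spsi r01.
  have dist b : (phi0 b : R[i]) - ((1 - r)%:C * (phi0 b : R[i]) + r%:C * (psi b : R[i])) =
      r%:C * ((phi0 b : R[i]) - psi b) by rewrite rmorphB /=; ring.
  have wc : weak_close s d phi0
      (fun b => (1 - r)%:C * (phi0 b : R[i]) + r%:C * (psi b : R[i])).
    move=> b sb; rewrite dist cabsM cabs_real gtr0_norm//.
    have hb : cabs ((phi0 b : R[i]) - psi b) <= 2 * M.
      apply: le_trans (cabsD _ _) _; rewrite /cabs normrN -!/(cabs _).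
      have := state_contractive s0 b; have := state_contractive spsi b; have := Ms _ sb; lra.
    have rk : r * (2 * M + d) <= d / 2.
      rewrite -ler_pdivlMr// mulrAC ge_min lexx orbT//.
    have : r * cabs ((phi0 b : R[i]) - psi b) <= r * (2 * M) by rewrite ler_wpM2l// ltW.
    have : 0 < r * d by rewrite mulr_gt0.
    lra.
  have /ltW/(le_trans (mk_ge _ _ da La)) := h _ sc wc.
  rewrite lee_fin dist cabsM cabs_real.
  by rewrite gtr0_norm// -ler_pdivlMl// mulr1.
exists (r^-1 + r^-1) => [|phi psi sphi spsi a da La]; first by rewrite addr_ge0 ?invr_ge0 ?ltW.
have -> : (phi a : R[i]) - psi a = ((phi0 a : R[i]) - psi a) - ((phi0 a : R[i]) - phi a) by ring.
apply: le_trans (cabsD _ _) _; rewrite /cabs normrN -!/(cabs _).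
by rewrite lerD// key.
Qed.
End MongeKantorovich.

(** * Metric spectral triples as quantum compact metric spaces *)

Section QcmsLip.
Variables (R : realType) (S : spectralData R).
Hypothesis mst : metric_spectral_triple S.
Let st : spectral_triple S := mst.1.
Local Notation A := (salg S).
Local Notation H := (shil S).
Local Notation L := (lipD S).
Implicit Types (a b : salg S) (x y : shil S).

Lemma lip_dom0 : ldom L (0 : A) /\ L (0 : A) = 0.
Proof.
have [s l] := smooth_scalar st 0; rewrite scale0r in s l.
split; first by split=> //=; rewrite /selfadjoint /= star0.
by apply/eqP; rewrite eq_le l lip_ge0.
Qed.

Lemma lip_domZ (r : R) a : ldom L a -> ldom L (r%:C *: a).
Proof.
move=> [sa ma]; split; last by case: (smoothZ st r%:C ma).
by rewrite /selfadjoint /= starZr sa.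
Qed.

Lemma lip_hom (r : R) a : ldom L a -> L (r%:C *: a) = `|r| * L a.
Proof.
move=> [sa ma]; have [m l] := smoothZ st r%:C ma; rewrite cabs_real in l.
apply/eqP; rewrite eq_le l /=; have [->|r0] := eqVneq r 0.
  by rewrite normr0 mul0r scale0r lip_ge0.
have [m' l'] := smoothZ st r^-1%:C m.
move: l'; rewrite scalerA -rmorphM /= mulVf// scale1r cabs_real normfV.
by rewrite ler_pdivlMl ?normr_gt0.
Qed.

Lemma lip_dense : @selfadjoint R A `<=` (closure (ldom L : set (nspace A)) : set A).
Proof.
move=> a sa; apply/closure_nrmP => e e0.
have : closure (@smooth R S : set (nspace A)) a by rewrite (st_dense st).
move=> /closure_nrmP/(_ e e0)[b mb ab]; exists (re_part (b : A)).
  by split; [exact: re_part_sa|case: (smooth_re_part st mb)].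
rewrite nspace_nrm; apply: le_lt_trans ab; rewrite nspace_nrm.
have -> : (a : nspace A) - re_part (b : A) = re_part ((a : A) - (b : A)).
  by rewrite re_partB (re_part_id sa).
exact: re_part_anorm.
Qed.

(** A phase makes phi(a) - psi(a) nonnegative, and passing to the real part then preserves it
    without increasing the commutator norm; so self-adjoint elements attain the same supremum. *)
Lemma connes_dist_mk (phi psi : A -> R[i]^o) : state phi -> state psi ->
  connes_dist (S := S) phi psi = mk L phi psi.
Proof.
move=> sphi spsi; apply/eqP; rewrite eq_le; apply/andP; split.
  apply: ge_ereal_sup => _ [a [pa ca] <-].
  have ma : smooth a by split=> //; apply: le_lt_trans ca _; rewrite ltry.
  set w := (phi a : R[i]) - psi a.
  have [w0|w0] := eqVneq (cabs w) 0.
    rewrite w0; apply: mk_ge0 => //; [exact: lip_dom0.1|exact: lip_hom].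
  have c1 : cabs (conjc w / (cabs w)%:C) = 1.
    by rewrite cabsM cabs_conj cabsV cabs_real ger0_norm ?cabs_ge0// divff.
  have [mk' lk] := smoothZ st (conjc w / (cabs w)%:C) ma.
  have [mr lr] := smooth_re_part st mk'.
  pose b := re_part ((conjc w / (cabs w)%:C) *: a).
  have Lb : L b <= 1.
    apply: le_trans lr _; apply: le_trans lk _; rewrite c1 mul1r.
    by rewrite -lee_fin -commnormE.
  have db : ldom L b by split=> //; exact: re_part_sa.
  apply: le_trans (mk_ge phi psi db Lb); rewrite lee_fin.
  have E : (phi b : R[i]) - psi b = (cabs w)%:C.
    rewrite (state_sa sphi db.1) (state_sa spsi db.1) !state_re_part//.
    rewrite -rmorphB /= -raddfB (stateZ sphi) (stateZ spsi) -mulrBr -/w.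
    rewrite mulrAC [conjc w * w]mulrC cabs_sqr -fmorphV -rmorphM /=.
    by rewrite expr2 mulfK.
  by rewrite E cabs_real ger0_norm ?cabs_ge0.
apply: ge_ereal_sup => _ [a [[sa ma] La] <-]; apply: ereal_sup_ubound.
by exists a => //; split; [exact: ma.1|rewrite (commnormE st)// lee_fin].
Qed.

Lemma lip_metrizes : metrizes_weak_star (mk L).
Proof. exact: metrizes_weak_star_ext connes_dist_mk mst.2. Qed.

(** If L a = 0, all real multiples of a lie in the unit ball, so the finite diameter forces vector
    states to agree on a. The quadratic form of a - r then vanishes, and so does its norm. *)
Lemma lip_ker a : ldom L a /\ L a = 0 <-> exists r : R, a = r%:C%:A.
Proof.
split=> [[da La]|[r ->]]; last first.
  have [m l] := smooth_scalar st r%:C; split.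
    by split=> //; rewrite /selfadjoint /= starZr star1.
  by apply/eqP; rewrite eq_le l lip_ge0.
have [K K0 hK] := mk_diameter lip_metrizes.
have [e e1] := rep_unit_vector st.
pose r := complex.Re (hdot H (sact a e) e).
have const x : nrm x = 1 -> complex.Re (hdot H (sact a x) x) = r.
  move=> x1; apply/eqP; rewrite -subr_eq0; apply: contraT => d0.
  set d := _ - r in d0.
  (* This multiple would separate the two vector states by K + 1, beyond the diameter bound K. *)
  have t0 : L (((K + 1) / d)%:C *: a) <= 1 by rewrite lip_hom// La mulr0.
  have := hK _ _ (vector_state st x1) (vector_state st e1) _ (lip_domZ _ da) t0.
  rewrite !(sactZ st) !hdotZl -mulrBr => h.
  have := le_trans (le_trans (ler_norm _) (Re_le_cabs _)) h.
  by rewrite Re_mulr raddfB /= -/r -/d divfK// leNgt ltrDl ltr01.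
exists r; apply/eqP; rewrite -subr_eq0; apply/eqP/anorm_eq0/eqP.
rewrite eq_le anorm_ge0 andbT.
apply: (numerical_radius st) => // [|x].
  by rewrite starB starZr star1 da.1.
rewrite mul0r normr_le0 (sactB st) (sactZ st) (st_act1 st) hdotBl hdotZl hdotxx.
rewrite -rmorphM raddfB /=.
have [x0|x0] := eqVneq (nrm x) 0.
  by rewrite (nrm_eq0 x0) hdot0r nrm0 expr0n /= mulr0 subrr.
have u1 : nrm ((nrm x)^-1%:C *: x) = 1.
  by rewrite nrmZr ger0_norm ?invr_ge0 ?nrm_ge0// mulVf.
have := const _ u1; rewrite (sactZr st) hdotZl hdotZr conjc_real !Re_mulr => <-.
by rewrite subr_eq0 expr2; apply/eqP; field.
Qed.

(** Commutators obey the Leibniz rule with constants 1 and 0, which implies it for all larger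
    ones. *)
Lemma qcms_lipD (Om Om' : R) : 1 <= Om -> 0 <= Om' -> is_qcms Om Om' L.
Proof.
move=> Om1 Om'0; split.
- by move=> a [].
- move=> a b [sa ma] [sb mb]; split; last by case: (smoothD st ma mb).
  by rewrite /selfadjoint /= starD sa sb.
- exact: lip_domZ.
- move=> a b [sa ma] [sb mb]; split; first exact: re_part_sa.
  by have [m _] := smoothM st ma mb; case: (smooth_re_part st m).
- move=> a b [sa ma] [sb mb]; split; first exact: im_part_sa.
  by have [m _] := smoothM st ma mb; case: (smooth_im_part st m).
- exact: lip_dense.
- by move=> a _; exact: lip_ge0.
- by move=> a b [_ ma] [_ mb]; case: (smoothD st ma mb).
- exact: lip_hom.
- exact: lip_ker.
- exact: lip_metrizes.
- move=> a b [sa ma] [sb mb]; have [m l] := smoothM st ma mb.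
  have [_ lr] := smooth_re_part st m; have [_ li] := smooth_im_part st m.
  have h : anorm a * L b + L a * anorm b <=
      Om * (anorm a * L b + L a * anorm b) + Om' * L a * L b.
    rewrite -[leLHS]addr0 lerD//; last by rewrite !mulr_ge0 ?lip_ge0.
    by rewrite ler_peMl// addr_ge0// mulr_ge0 ?anorm_ge0 ?lip_ge0.
  rewrite ge_max; apply/andP; split; apply: le_trans h.
    exact: le_trans lr l.
  exact: le_trans li l.
- apply: closed_nrmP => a h.
  have sa : star (a : A) = a.
    apply: selfadjoint_closed => e e0.
    by have [b [[sb _] _] ab] := h _ e0; exists (b : A).
  have [m l] : smooth (a : A) /\ L (a : A) <= 1.
    apply: (smooth_closed st) => // e e0.
    by have [b [[_ mb] lb] ab] := h _ e0; exists b.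
  by split.
Qed.
End QcmsLip.

(** * Extension of states *)

Lemma state_comp (R : realType) (A B : cstarAlgType R) (f : {lrmorphism B -> A})
    (phi : A -> R[i]^o) :
  star_preserving f -> state phi -> @state R B (phi \o f).
Proof.
move=> fs sphi; split=> [k a b|a|] /=.
- by rewrite linearP (state_linear sphi).
- by rewrite rmorphM /= fs; exact: state_pos.
- by rewrite rmorph1; exact: state1.
Qed.

Section StateExtension.
Variables (R : realType) (S1 S2 : spectralData R).
Hypotheses (st1 : spectral_triple S1) (st2 : spectral_triple S2).
Variable iota : {lrmorphism salg S1 -> salg S2}.
Variable kappa : {linear shil S1 -> shil S2}.
Hypothesis iota_star : star_preserving iota.
Hypothesis kappa_iso : forall x y,
  hdot (shil S2) (kappa x) (kappa y) = hdot (shil S1) x y.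
Hypothesis kappa_act : forall (a : salg S1) x,
  sact (iota a) (kappa x) = kappa (sact a x).
Local Notation A := (salg S2).
Local Notation B := (salg S1).
Local Notation H := (shil S2).

(** Vector states pull back along iota to states, so the quadratic form of iota (b* b) is bounded by
    |b* b|. *)
Lemma star_morphism_contractive b : anorm (iota b) <= anorm b.
Proof.
rewrite -(@ler_pXn2r _ 2) ?nnegrE ?anorm_ge0// -!anorm_star -iota_star -rmorphM /=.
apply: (numerical_radius st2); first exact: anorm_ge0.
  by rewrite -iota_star starM starK.
move=> x; have [x0|x0] := eqVneq (nrm x) 0.
  by rewrite (nrm_eq0 x0) hdot0r nrm0 normr0 expr0n /= mulr0.
have u1 : nrm ((nrm x)^-1%:C *: x) = 1.
  by rewrite nrmZr ger0_norm ?invr_ge0 ?nrm_ge0// mulVf.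
have := state_contractive (state_comp iota_star (vector_state st2 u1)) (star b * b).
move=> /(le_trans (Re_le_cabs _)) /=.
rewrite (sactZr st2) hdotZl hdotZr conjc_real !Re_mulr !normrM.
rewrite ger0_norm ?invr_ge0 ?nrm_ge0// mulrA -expr2 exprVn.
by rewrite ler_pdivrMl ?exprn_gt0 1?mulrC// lt_def x0 nrm_ge0.
Qed.

(** A sublinear bound that encodes positivity: p (- c* c) <= 0, so a linear functional below p is
    nonnegative on every c* c. *)
Let p (a : A) := sup [set complex.Re (hdot H (sact a x) x) | x in [set x | nrm x = 1]].

Let p_ge (a : A) x : nrm x = 1 -> complex.Re (hdot H (sact a x) x) <= p a.
Proof.
move=> x1; apply: ub_le_sup; last by exists x.
exists (anorm a) => _ [y y1 <-]; apply: le_trans (rdot_le _ _) _.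
by have := sact_bound st2 a y; rewrite y1 !mulr1.
Qed.

Let p_le (a : A) (c : R) :
  (forall x, nrm x = 1 -> complex.Re (hdot H (sact a x) x) <= c) -> p a <= c.
Proof.
move=> h; apply: ge_sup; last by move=> _ [x x1 <-]; exact: h.
by have [e e1] := rep_unit_vector st2; exists (complex.Re (hdot H (sact a e) e)), e.
Qed.

Let p_sublinear : sublinear p.
Proof.
apply: sublinearI.
- have z x : complex.Re (hdot H (sact (0 : A) x) x) = 0.
    by have := sactZ st2 0 0 x; rewrite !scale0r => ->; rewrite hdot0l.
  apply/eqP; rewrite eq_le; apply/andP; split; first by apply: p_le => x _; rewrite z.
  by have [e e1] := rep_unit_vector st2; have := p_ge 0 e1; rewrite z.
- move=> a b; apply: p_le => x x1; rewrite (sactD st2) hdotDl raddfD /=.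
  by rewrite lerD// p_ge.
- move=> r a r0; apply: p_le => x x1; rewrite (sactZ st2) hdotZl Re_mulr.
  by rewrite ler_pM2l// p_ge.
Qed.

Variable phi : B -> R[i]^o.
Hypothesis sphi : state phi.

(** Adding m = |c| to the real part c of b makes its quadratic form nonnegative, so |c + m| <= m + p
    (iota b) by [numerical_radius]. A state is bounded by the norm, and m cancels. *)
Let phi_le b : complex.Re (phi b : R[i]) <= p (iota b).
Proof.
pose c := re_part b; pose m := anorm c.
have cE x : complex.Re (hdot (shil S1) (sact c x) x) =
    complex.Re (hdot H (sact (iota b) (kappa x)) (kappa x)).
  rewrite kappa_act kappa_iso /c /re_part (sactZ st1) (sactD st1) hdotZl hdotDl.
  have -> : hdot (shil S1) (sact (star b) x) x = conjc (hdot (shil S1) (sact b x) x).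
    by rewrite (st_adjoint st1) starK hdotC.
  rewrite (_ : (2 : R[i])^-1 = (2^-1)%:C); last by rewrite fmorphV rmorph_nat.
  by rewrite Re_mulr; case: (hdot _ _ x) => u v /=; field.
have kappa_nrm x : nrm (kappa x) = nrm x by exact: (isometry_nrm kappa_iso).
have bound x : 0 <= complex.Re (hdot (shil S1) (sact (c + m%:C%:A) x) x)
    <= (m + p (iota b)) * nrm x ^+ 2.
  rewrite (sactD st1 c) (sactZ st1 m%:C) (st_act1 st1) hdotDl hdotZl hdotxx -rmorphM raddfD /=.
  have h1 : `|complex.Re (hdot (shil S1) (sact c x) x)| <= m * nrm x ^+ 2.
    apply: le_trans (Re_le_cabs _) _; apply: le_trans (cauchy_schwarz _ _) _.
    by rewrite expr2 mulrA ler_wpM2r ?nrm_ge0// sact_bound.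
  move: h1; rewrite ler_norml => /andP[h1 _].
  have h2 : complex.Re (hdot (shil S1) (sact c x) x) <= p (iota b) * nrm x ^+ 2.
    have [x0|x0] := eqVneq (nrm x) 0.
      by rewrite (nrm_eq0 x0) hdot0r nrm0 expr0n /= mulr0.
    have u1 : nrm ((nrm x)^-1%:C *: x) = 1.
      by rewrite nrmZr ger0_norm ?invr_ge0 ?nrm_ge0// mulVf.
    have := @p_ge (iota b) (kappa ((nrm x)^-1%:C *: x)); rewrite kappa_nrm => /(_ u1).
    rewrite -cE (sactZr st1) hdotZl hdotZr conjc_real !Re_mulr mulrA -expr2 exprVn.
    by rewrite ler_pdivrMl ?exprn_gt0 1?mulrC// lt_def x0 nrm_ge0.
  by apply/andP; split; lra.
have s0 : 0 <= m + p (iota b).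
  have [e e1] := rep_unit_vector st1; have := bound e.
  by rewrite e1 expr1n mulr1 => /andP[]; exact: le_trans.
have cs : star (c + m%:C%:A) = c + m%:C%:A by rewrite starD starZr star1 re_part_sa.
have : anorm (c + m%:C%:A) <= m + p (iota b).
  apply: (numerical_radius st1) => // x; have /andP[b1 b2] := bound x.
  by rewrite ger0_norm.
move/(le_trans (state_re_le sphi cs)).
by rewrite (stateD sphi c) (stateZ sphi m%:C) (state1 sphi) mulr1 raddfD /= state_re_part//; lra.
Qed.

(** The infimum p' combines both constraints. A linear functional below p' is below p, and below Re
    phi on the range of iota; applied to b and -b it equals Re phi there. *)
Let E (a : A) := [set p (a - iota b) + complex.Re (phi b : R[i]) | b in setT].
Let p' (a : A) := inf (E a).

Let E_inf a : has_inf (E a).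
Proof.
split; first by exists (p (a - iota 0) + complex.Re (phi 0 : R[i])), 0.
exists (- p (- a)) => _ [b _ <-].
have h1 := phi_le (- b); rewrite rmorphN /= in h1.
have h2 := p_sublinear.1 (a - iota b) (- a).
have e : a - iota b - a = - iota b by rewrite addrAC subrr add0r.
rewrite e in h2; move: h1; rewrite -scaleN1r (stateZ sphi) mulN1r raddfN /=; lra.
Qed.

Let p'_le a b : p' a <= p (a - iota b) + complex.Re (phi b : R[i]).
Proof. by apply: ge_inf; [exact: (E_inf a).2|exists b]. Qed.

Let p'_adh a e : 0 < e -> exists b, p (a - iota b) + complex.Re (phi b : R[i]) < p' a + e.
Proof. by move=> e0; have [_ [b _ <-] h] := inf_adherent e0 (E_inf a); exists b. Qed.

Let phi0 : complex.Re (phi 0 : R[i]) = 0.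
Proof. by rewrite -(scale0r 0) (stateZ sphi) mul0r. Qed.

Let p'_p a : p' a <= p a.
Proof. by have := p'_le a 0; rewrite rmorph0 subr0 phi0 addr0. Qed.

Let p'_sublinear : sublinear p'.
Proof.
apply: sublinearI.
- apply/eqP; rewrite eq_le; apply/andP; split.
    by apply: le_trans (p'_p 0) _; rewrite sublinear0.
  apply: lb_le_inf; first exact: (E_inf 0).1.
  move=> _ [b _ <-]; have := phi_le (- b); rewrite rmorphN /= sub0r.
  by rewrite -[- b]scaleN1r (stateZ sphi) mulN1r raddfN /=; lra.
- move=> a b; apply: (@ler_eps _ _ _ 2) => // e e0.
  have [u hu] := p'_adh a e0; have [v hv] := p'_adh b e0.
  apply: le_trans (p'_le _ (u + v)) _.
  have := p_sublinear.1 (a - iota u) (b - iota v).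
  by rewrite addrACA -opprD -rmorphD /= (stateD sphi) raddfD /=; lra.
- move=> r a r0; apply: (@ler_eps _ _ _ r) => [|e e0]; first exact: ltW.
  have [u hu] := p'_adh a e0; apply: le_trans (p'_le _ (r%:C *: u)) _.
  rewrite linearZ /= -scalerBr p_sublinear.2 ?(ltW r0)// (stateZ sphi) Re_mulr.
  by rewrite -!mulrDr ler_pM2l// ltW.
Qed.

Lemma state_extension : exists2 psi : A -> R[i]^o, state psi & forall b, psi (iota b) = phi b.
Proof.
have [g [gp' gD gZ]] := linear_below_sublinear p'_sublinear.
have gN a : g (- a) = - g a.
  by have := gZ (-1) a; rewrite rmorphN1 scaleN1r mulN1r.
have g_iota b : g (iota b) = complex.Re (phi b : R[i]).
  have le c : g (iota c) <= complex.Re (phi c : R[i]).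
    by apply: le_trans (gp' _) _; have := p'_le (iota c) c; rewrite subrr sublinear0// add0r.
  apply/eqP; rewrite eq_le le /=; have := le (- b); rewrite rmorphN /= gN.
  by rewrite -[- b]scaleN1r (stateZ sphi) mulN1r raddfN /= lerN2.
(* The complex-linear functional with real part g. *)
pose psi (a : A) : R[i]^o := g a +i* - g (('i%C : R[i]) *: a).
exists psi; last first.
  move=> b; rewrite /psi -linearZ /= !g_iota (stateZ sphi).
  by case: (phi b) => u v /=; rewrite mul0r mul1r sub0r opprK.
have quad (c : A) x : hdot H (sact (star c * c) x) x = (nrm (sact c x) ^+ 2)%:C.
  by rewrite (st_actM st2) (st_adjoint st2) starK hdotxx.
have g_neg a : (forall x, complex.Re (hdot H (sact a x) x) <= 0) -> g a <= 0.
  move=> h; apply: le_trans (gp' _) _; apply: le_trans (p'_p _) _.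
  by apply: p_le => x _.
split=> [k a b|c|].
- rewrite /psi scalerDr !gD; apply/eqP; rewrite eq_complex /=.
  have gC (z : R[i]) d : g (z *: d) = complex.Re z * g d + complex.Im z * g ('i%C *: d).
    rewrite {1}(complexE z) scalerDl gD gZ [_ * (_)%:C]mulrC -scalerA gZ //.
  have iC d : g ('i%C *: (k *: d)) = complex.Re k * g ('i%C *: d) - complex.Im k * g d.
    rewrite scalerA mulrC -scalerA gC scalerA.
    by rewrite -expr2 sqr_i scaleN1r gN mulrN.
  by rewrite iC (gC k a); case: k {iC} => s t /=; apply/andP; split; apply/eqP; ring.
- rewrite /psi lecE /=; apply/andP; split.
    rewrite oppr_eq0 eq_le; apply/andP; split.
      by apply: g_neg => x; rewrite (sactZ st2) hdotZl quad /= mul0r mul1r subr0.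
    rewrite -oppr_le0 -gN; apply: g_neg => x.
    by rewrite -scaleNr (sactZ st2) hdotZl quad /= oppr0 mul0r mulr0 subr0.
  rewrite -oppr_le0 -gN; apply: g_neg => x.
  by rewrite -scaleN1r (sactZ st2) hdotZl quad mulN1r /= oppr_le0 sqr_ge0.
- rewrite /psi -(rmorph1 iota) -linearZ /= !g_iota (stateZ sphi) (state1 sphi).
  by rewrite mulr1 /= oppr0.
Qed.
End StateExtension.

(** * Direct sums *)

Section DirectSum.
Variables (R : realType) (A B : cstarAlgType R).
Implicit Types p q : (A * B)%type.

Let pstar p : (A * B)%type := (star p.1, star p.2).
Let pnorm p : R := Num.max (anorm p.1) (anorm p.2).

Let pstarD p q : pstar (p + q) = pstar p + pstar q.
Proof. by rewrite /pstar /= !starD. Qed.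

Let pstarZ (k : R[i]) p : pstar (k *: p) = (k^*)%C *: pstar p.
Proof. by rewrite /pstar /= !starZ. Qed.

Let pstarM p q : pstar (p * q) = pstar q * pstar p.
Proof. by rewrite /pstar /= !starM. Qed.

Let pstarK p : pstar (pstar p) = p.
Proof. by case: p => a b; rewrite /pstar /= !starK. Qed.

Let pnorm_eq0 p : pnorm p = 0 -> p = 0.
Proof.
case: p => a b h; have : pnorm (a, b) <= 0 by rewrite h.
rewrite /pnorm ge_max /= => /andP[a0 b0].
by congr (_, _); apply: anorm_eq0; apply/eqP; rewrite eq_le anorm_ge0 andbT.
Qed.

Let pnormD p q : pnorm (p + q) <= pnorm p + pnorm q.
Proof.
by rewrite /pnorm ge_max /=; apply/andP; split; apply: le_trans (anormD _ _) _;
  rewrite lerD// le_max lexx ?orbT.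
Qed.

Let pnormZ (k : R[i]) p : pnorm (k *: p) = cabs k * pnorm p.
Proof. by rewrite /pnorm /= !anormZ maxr_pMr// cabs_ge0. Qed.

Let pnormM p q : pnorm (p * q) <= pnorm p * pnorm q.
Proof.
by rewrite /pnorm ge_max /=; apply/andP; split; apply: le_trans (anormM _ _) _;
  rewrite ler_pM ?anorm_ge0// le_max lexx ?orbT.
Qed.

Let pnorm_star p : pnorm (pstar p * p) = pnorm p ^+ 2.
Proof.
rewrite /pnorm /= !anorm_star /Num.max.
by rewrite ltr_pXn2r ?nnegrE ?anorm_ge0//; case: ifP.
Qed.

HB.instance Definition _ := isPreCstarAlgebra.Build R (A * B)%type
  pstarD pstarZ pstarM pstarK pnorm_eq0 pnormD pnormZ pnormM pnorm_star.

Lemma sum_anormE p : anorm p = Num.max (anorm p.1) (anorm p.2).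
Proof. by []. Qed.

Lemma sum_starE p : star p = (star p.1, star p.2).
Proof. by []. Qed.

Lemma sum_complete (F : set_system (nspace (A * B)%type)) :
  ProperFilter F -> cauchy F -> cvg F.
Proof.
move=> PF /cauchyP cF.
have part (C : cstarAlgType R) (f : (A * B)%type -> C) :
    (forall p q, anorm (f p - f q) <= anorm (p - q)) ->
    exists l : C, forall e : R, 0 < e -> F [set p | anorm (l - f p) < e].
  move=> fle.
  have /cvg_ex[l Fl] : cvg ((f : nspace (A * B)%type -> nspace C) @ F).
    apply/cauchy_cvgP/cauchyP => e e0; have [x Fx] := cF _ e0; exists (f x).
    rewrite nbhs_simpl /=; apply: filterS Fx => y.
    rewrite -!ball_normE /ball_ /= !normr_nrm !nspace_nrm.
    by apply: le_lt_trans; rewrite lecR; exact: fle.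
  by exists l => e e0; have /cvg_nrmP/(_ e e0) := Fl.
have [p q|a Fa] := part A fst; first by rewrite sum_anormE le_max lexx.
have [p q|b Fb] := part B snd; first by rewrite sum_anormE le_max lexx orbT.
apply/cvg_ex; exists ((a, b) : nspace (A * B)%type).
move=> U /nbhs_nrmP[e e0 hU]; apply: filterS2 (Fa _ e0) (Fb _ e0) => p pa pb.
by apply: hU; rewrite nspace_nrm sum_anormE gt_max pa.
Qed.

HB.instance Definition _ :=
  PreCstarAlgebra_isComplete.Build R (A * B)%type sum_complete.
End DirectSum.

Section DirectSumStates.
Variables (R : realType) (A B : cstarAlgType R).

(** The weight t is phi (1, 0). A summand of weight 0 leaves its component undetermined, and [rhoA]
    or [rhoB] fills the place. *)
Lemma sum_state_decomposition (phi : (A * B)%type -> R[i]^o) rhoA rhoB :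
  state phi -> @state R A rhoA -> @state R B rhoB ->
  exists (t : R) phi1 phi2, [/\ 0 <= t <= 1, @state R A phi1, @state R B phi2 &
    forall p, (phi p : R[i]) = t%:C * (phi1 p.1 : R[i]) + (1 - t)%:C * (phi2 p.2 : R[i])].
Proof.
move=> sphi srA srB.
pose fA a : R[i]^o := phi (a, 0); pose fB b : R[i]^o := phi (0, b).
have linA : linear fA.
  move=> k a a'; rewrite /fA -(state_linear sphi); congr (phi _).
  by apply: injective_projections; rewrite /= ?scaler0 ?addr0.
have linB : linear fB.
  move=> k b b'; rewrite /fB -(state_linear sphi); congr (phi _).
  by apply: injective_projections; rewrite /= ?scaler0 ?addr0.
have posA a : 0 <= (fA (star a * a) : R[i]).
  have := state_pos sphi (a, 0).
  have -> : star (a, 0) * (a, 0) = (star a * a, 0) :> (A * B)%type.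
    by apply: injective_projections; rewrite /= ?mulr0.
  exact.
have posB b : 0 <= (fB (star b * b) : R[i]).
  have := state_pos sphi (0, b).
  have -> : star (0, b) * (0, b) = (0, star b * b) :> (A * B)%type.
    by apply: injective_projections; rewrite /= ?mulr0.
  exact.
have [phi1 s1 E1] := functional_normalize linA posA srA.
have [phi2 s2 E2] := functional_normalize linB posB srB.
have fA1 : 0 <= (fA 1 : R[i]) by have := posA 1; rewrite star1 mulr1.
have fB1 : 0 <= (fB 1 : R[i]) by have := posB 1; rewrite star1 mulr1.
have split_phi a b : (phi (a, b) : R[i]) = (fA a : R[i]) + (fB b : R[i]).
  rewrite /fA /fB -(stateD sphi); congr (phi _).
  by apply: injective_projections; rewrite /= ?addr0 ?add0r.
have one : (fA 1 : R[i]) + (fB 1 : R[i]) = 1 by rewrite -split_phi (state1 sphi).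
have tE : (fA 1 : R[i]) = (complex.Re (fA 1 : R[i]))%:C by rewrite RRe_real ?ger0_real.
have t'E : (fB 1 : R[i]) = (1 - complex.Re (fA 1 : R[i]))%:C.
  by apply/eqP; rewrite rmorphB rmorph1 /= -tE eq_sym subr_eq addrC one.
exists (complex.Re (fA 1 : R[i])), phi1, phi2; split=> //.
  apply/andP; split; first by rewrite -ler0c -tE.
  by rewrite -subr_ge0 -ler0c -t'E.
by move=> [a b] /=; rewrite split_phi E1 E2 -tE -t'E.
Qed.
End DirectSumStates.

(** Weak-* closeness on a direct sum sees only products of weights and component states; hence the
    products in the hypothesis and the factor t in the conclusion, which makes t = 0 harmless. *)
Lemma scaled_mk_coarser (R : realType) (C : cstarAlgType R) (LC : seminorm C)
    (phi : C -> R[i]^o) (t e : R) :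
  metrizes_weak_star (mk LC) -> state phi -> 0 <= t <= 1 -> 0 < e ->
  exists (s : seq C) (d : R), 0 < d /\ forall (u : R) psi, state psi -> `|t - u| < d ->
    (forall a, a \in s -> cabs (t%:C * (phi a : R[i]) - u%:C * (psi a : R[i])) < d) ->
    forall a, ldom LC a -> LC a <= 1 -> t * cabs ((phi a : R[i]) - psi a) <= e.
Proof.
move=> mC sphi /andP[t0 t1] e0; have [s [d0 [d00 h]]] := metrizes_coarser mC sphi e0.
have [->|tn0] := eqVneq t 0.
  by exists [::], 1; split=> // *; rewrite mul0r ltW.
have tp : 0 < t by rewrite lt_def tn0.
have [M M0 Ms] := seq_anorm_bounded s.
have M1 : 0 < 1 + M by rewrite ltr_pwDl.
(* With this radius r, t |phi b - psi b| is less than r + r M = t d0. *)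
exists s, (t * d0 / (1 + M)); split=> [|u psi spsi tu close a da La].
  by rewrite divr_gt0 ?mulr_gt0.
have wc : weak_close s d0 phi psi.
  move=> b sb; rewrite -(ltr_pM2l tp).
  have -> : t * cabs ((phi b : R[i]) - psi b) = cabs (t%:C * ((phi b : R[i]) - psi b)).
    by rewrite cabsM cabs_real gtr0_norm.
  have -> : t%:C * ((phi b : R[i]) - psi b) =
      (t%:C * (phi b : R[i]) - u%:C * (psi b : R[i])) - (t - u)%:C * (psi b : R[i]).
    by rewrite rmorphB /=; ring.
  apply: le_lt_trans (cabsD _ _) _; rewrite [cabs (- _)]/cabs normrN -/(cabs _).
  rewrite cabsM cabs_real.
  have h1 := close _ sb.
  have h2 : `|t - u| * cabs (psi b : R[i]) <= t * d0 / (1 + M) * M.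
    rewrite ler_pM ?cabs_ge0// ?(ltW tu)//.
    exact: le_trans (state_contractive spsi b) (Ms _ sb).
  have -> : t * d0 = t * d0 / (1 + M) + t * d0 / (1 + M) * M.
    by field; rewrite gt_eqF.
  by rewrite ltr_leD.
have /ltW/(le_trans (mk_ge phi psi da La)) := h _ spsi wc.
rewrite lee_fin; apply: le_trans; rewrite ler_piMl ?cabs_ge0//.
Qed.

(** * The direct sum as a quantum compact metric space *)

Section SumQcms.
Variables (R : realType) (A B : cstarAlgType R) (LA : seminorm A) (LB : seminorm B).
Variables (Om Om' : R).
Hypotheses (Om1 : 1 <= Om) (Om'0 : 0 <= Om').
Hypotheses (qA : is_qcms Om Om' LA) (qB : is_qcms Om Om' LB).
Variable iota : {lrmorphism B -> A}.
Hypothesis iota_star : star_preserving iota.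
Hypothesis iota_le : forall b, anorm (iota b) <= anorm b.
Hypothesis states_A : exists phi, @state R A phi.
Hypothesis states_B : exists phi, @state R B phi.
Variable eps : R.
Hypothesis eps0 : 0 < eps.
Implicit Types p q : (A * B)%type.

Definition sum_lip : seminorm (A * B)%type :=
  Seminorm [set p | ldom LA p.1 /\ ldom LB p.2]
    (fun p => Num.max (Num.max (LA p.1) (LB p.2)) (anorm (p.1 - iota p.2) / eps)).

Let L := sum_lip.

Lemma sum_lip_leP p (c : R) :
  L p <= c <-> [/\ LA p.1 <= c, LB p.2 <= c & anorm (p.1 - iota p.2) <= eps * c].
Proof.
rewrite /= !ge_max ler_pdivrMr// [c * eps]mulrC.
by split=> [/andP[/andP[]]|[-> -> ->]].
Qed.

Lemma sum_lip_bounds p :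
  [/\ LA p.1 <= L p, LB p.2 <= L p & anorm (p.1 - iota p.2) <= eps * L p].
Proof. exact/sum_lip_leP. Qed.

Let L_ge0 p : ldom L p -> 0 <= L p.
Proof.
by move=> [dA dB]; rewrite /= !le_max (qcms_ge0 qA dA).
Qed.

Let L_Z (r : R) p : ldom L p -> ldom L (r%:C *: p).
Proof. by move=> [dA dB]; split; [exact: (qcmsZ qA)|exact: (qcmsZ qB)]. Qed.

Let L_hom (r : R) p : ldom L p -> L (r%:C *: p) = `|r| * L p.
Proof.
move=> [dA dB] /=; rewrite (qcms_hom qA)// (qcms_hom qB)// linearZ /= -scalerBr anormZr.
by rewrite -mulrA -!maxr_pMr.
Qed.

Let dom0 (C : cstarAlgType R) (LC : seminorm C) : is_qcms Om Om' LC -> ldom LC 0.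
Proof.
move=> qC; suff [] : ldom LC 0 /\ LC 0 = 0 by [].
by apply/(qcms_ker qC); exists 0; rewrite rmorph0 scale0r.
Qed.

Let L_dom0 : ldom L 0.
Proof. by split; exact: dom0. Qed.

Let L_dense : @selfadjoint R (A * B)%type `<=`
  (closure (ldom L : set (nspace (A * B)%type)) : set (A * B)%type).
Proof.
move=> [a b] sp; have [sa sb] : selfadjoint a /\ selfadjoint b.
  by move: sp; rewrite /selfadjoint /= => -[].
apply/closure_nrmP => e e0.
have /closure_nrmP/(_ e e0)[a' da' aa'] := qcms_dense qA sa.
have /closure_nrmP/(_ e e0)[b' db' bb'] := qcms_dense qB sb.
exists ((a', b') : nspace (A * B)%type); first by split.
by rewrite nspace_nrm sum_anormE gt_max; apply/andP; split.
Qed.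

Let diamB := mk_diameter (qcms_mk qB).

(** Besides the two component differences, changing the weight costs |t - u| times |psi1 p.1 - psi2
    p.2|. Comparing through [psi1 \o iota] bounds the latter by eps plus the diameter K of B. *)
Let mk_estimate (K : R) (phi psi : (A * B)%type -> R[i]^o) (t u : R) phi1 phi2 psi1 psi2 p :
  (forall rho rho' : B -> R[i]^o, state rho -> state rho' ->
    forall b, ldom LB b -> LB b <= 1 -> cabs ((rho b : R[i]) - rho' b) <= K) ->
  @state R A psi1 -> @state R B psi2 -> 0 <= t <= 1 ->
  (forall p, (phi p : R[i]) = t%:C * (phi1 p.1 : R[i]) + (1 - t)%:C * (phi2 p.2 : R[i])) ->
  (forall p, (psi p : R[i]) = u%:C * (psi1 p.1 : R[i]) + (1 - u)%:C * (psi2 p.2 : R[i])) ->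
  ldom L p -> L p <= 1 ->
  cabs ((phi p : R[i]) - psi p) <= t * cabs ((phi1 p.1 : R[i]) - (psi1 p.1 : R[i])) +
    (1 - t) * cabs ((phi2 p.2 : R[i]) - (psi2 p.2 : R[i])) + `|t - u| * (eps + K).
Proof.
move=> hK s1 s2 /andP[t0 t1] phiE psiE [dA dB] /sum_lip_leP[_ lB lM].
rewrite mulr1 in lM.
have -> : (phi p : R[i]) - psi p = (t%:C * ((phi1 p.1 : R[i]) - (psi1 p.1 : R[i])) +
    (1 - t)%:C * ((phi2 p.2 : R[i]) - (psi2 p.2 : R[i]))) +
    (t - u)%:C * ((psi1 p.1 : R[i]) - (psi2 p.2 : R[i])).
  by rewrite phiE psiE !rmorphB /= rmorph1; ring.
have h1 : cabs ((psi1 p.1 : R[i]) - (psi2 p.2 : R[i])) <= eps + K.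
  have -> : (psi1 p.1 : R[i]) - (psi2 p.2 : R[i]) = (psi1 (p.1 - iota p.2) : R[i]) +
      (((psi1 \o iota) p.2 : R[i]) - (psi2 p.2 : R[i])).
    by rewrite (stateB s1) addrA subrK.
  apply: le_trans (cabsD _ _) _; rewrite lerD//.
    exact: le_trans (state_contractive s1 _) lM.
  exact: hK (state_comp iota_star s1) s2 _ dB lB.
apply: le_trans (cabsD _ _) _; rewrite lerD//.
  apply: le_trans (cabsD _ _) _; rewrite !cabsM !cabs_real.
  by rewrite !ger0_norm// subr_ge0.
by rewrite cabsM cabs_real ler_wpM2l.
Qed.

Let mk_finite (phi psi : (A * B)%type -> R[i]^o) : state phi -> state psi ->
  mk L phi psi \is a fin_num.
Proof.
move=> sphi spsi; have [rA srA] := states_A; have [rB srB] := states_B.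
have [t [phi1 [phi2 [t01 s1 s2 phiE]]]] := sum_state_decomposition sphi srA srB.
have [u [psi1 [psi2 [u01 s3 s4 psiE]]]] := sum_state_decomposition spsi srA srB.
have [K K0 hK] := diamB; have [K' K'0 hK'] := mk_diameter (qcms_mk qA).
apply: (mk_fin L_dom0 L_hom (c := K' + K + `|t - u| * (eps + K))).
apply: mk_le => p dp Lp; have [dA dB] := dp; have /sum_lip_leP[lA lB _] := Lp.
apply: le_trans (mk_estimate hK s3 s4 t01 phiE psiE dp Lp) _.
have h1 := hK' _ _ s1 s3 _ dA lA; have h2 := hK _ _ s2 s4 _ dB lB.
move: t01 => /andP[t0 t1]; rewrite lerD2r lerD//.
  by apply: le_trans h1; rewrite ler_piMl ?cabs_ge0.
by apply: le_trans h2; rewrite ler_piMl ?cabs_ge0// gerBl.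
Qed.

Let mk_coarser (phi : (A * B)%type -> R[i]^o) (e : R) : state phi -> 0 < e ->
  exists s (d : R), 0 < d /\ forall psi, state psi -> weak_close s d phi psi ->
    (mk L phi psi < e%:E)%E.
Proof.
move=> sphi e0; have [rA srA] := states_A; have [rB srB] := states_B.
have [t [phi1 [phi2 [t01 s1 s2 phiE]]]] := sum_state_decomposition sphi srA srB.
have [K K0 hK] := diamB.
have e4 : 0 < e / 4 by rewrite divr_gt0.
have t01' : 0 <= 1 - t <= 1 by move: t01 => /andP[t0 t1]; rewrite subr_ge0 t1 gerBl.
have [sA [dA [dA0 hA]]] := scaled_mk_coarser (qcms_mk qA) s1 t01 e4.
have [sB [dB [dB0 hB]]] := scaled_mk_coarser (qcms_mk qB) s2 t01' e4.
have k0 : 0 < eps + K + 1 by rewrite addr_gt0// ltr_wpDr.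
(* Testing on (1, 0) controls the weights. *)
exists ((1, 0) :: [seq (a, 0) | a <- sA] ++ [seq (0, b) | b <- sB]).
(* The last entry makes |t - u| (eps + K) at most e / 4; the three terms of [mk_estimate] then add
   up to 3e / 4. *)
exists (Num.min (Num.min dA dB) (e / 4 / (eps + K + 1))).
split=> [|psi spsi close]; first by rewrite !lt_min dA0 dB0 divr_gt0.
have [u [psi1 [psi2 [u01 s3 s4 psiE]]]] := sum_state_decomposition spsi srA srB.
have tu : `|t - u| < Num.min (Num.min dA dB) (e / 4 / (eps + K + 1)).
  have := close (1, 0); rewrite inE eqxx => /(_ isT).
  rewrite phiE psiE /= (state1 s1) (state1 s3).
  rewrite (state0 s2) (state0 s4).
  by rewrite !mulr0 !addr0 !mulr1 -rmorphB cabs_real.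
have cA a : a \in sA -> cabs (t%:C * (phi1 a : R[i]) - u%:C * (psi1 a : R[i])) < dA.
  move=> sa; have := close (a, 0); rewrite inE mem_cat map_f ?orbT// => /(_ isT).
  rewrite phiE psiE /=.
  rewrite (state0 s2) (state0 s4).
  by rewrite !mulr0 !addr0 !lt_min => /andP[/andP[]].
have cB b : b \in sB -> cabs ((1 - t)%:C * (phi2 b : R[i]) - (1 - u)%:C * (psi2 b : R[i])) < dB.
  move=> sb; have := close (0, b); rewrite inE mem_cat map_f ?orbT// => /(_ isT).
  rewrite phiE psiE /=.
  rewrite (state0 s1) (state0 s3).
  by rewrite !mulr0 !add0r !lt_min => /andP[/andP[]].
move: tu; rewrite !lt_min => /andP[/andP[tuA tuB] tuE].
have tuB' : `|(1 - t) - (1 - u)| < dB.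
  by rewrite (_ : _ - _ = u - t) 1?distrC//; ring.
apply: (@le_lt_trans _ _ (3 / 4 * e)%:E); last by rewrite lte_fin; lra.
apply: mk_le => p dp Lp; have [pA pB] := dp; have /sum_lip_leP[lA lB _] := Lp.
apply: le_trans (mk_estimate hK s3 s4 t01 phiE psiE dp Lp) _.
have h1 := hA _ _ s3 tuA cA _ pA lA; have h2 := hB _ _ s4 tuB' cB _ pB lB.
have h3 : `|t - u| * (eps + K) <= e / 4.
  move: tuE; rewrite ltr_pdivlMr// => /ltW; apply: le_trans.
  by rewrite ler_wpM2l// lerDl.
lra.
Qed.

Lemma sum_qcms : is_qcms Om Om' L.
Proof.
split.
- move=> [a b] [/= dA dB]; rewrite /selfadjoint /= sum_starE /=.
  by rewrite (qcms_sa qA dA) (qcms_sa qB dB).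
- by move=> p q [pA pB] [qA' qB']; split; [exact: (qcmsD qA)|exact: (qcmsD qB)].
- exact: L_Z.
- by move=> p q [pA pB] [qA' qB']; split; [exact: (qcms_re qA)|exact: (qcms_re qB)].
- by move=> p q [pA pB] [qA' qB']; split; [exact: (qcms_im qA)|exact: (qcms_im qB)].
- exact: L_dense.
- exact: L_ge0.
- move=> p q [pA pB] [qA' qB']; apply/sum_lip_leP.
  have [p1 p2 p3] := sum_lip_bounds p; have [q1 q2 q3] := sum_lip_bounds q.
  split.
  + by apply: le_trans (qcms_tri qA _ _) _ => //; rewrite lerD.
  + by apply: le_trans (qcms_tri qB _ _) _ => //; rewrite lerD.
  + rewrite /= (rmorphD iota) opprD addrACA; apply: le_trans (anormD _ _) _.
    by rewrite mulrDr lerD.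
- exact: L_hom.
- move=> [a b]; split=> [[[/= dA dB] L0]|[r ->]].
    have [l1 l2 l3] := sum_lip_bounds (a, b); rewrite /= L0 in l1 l2 l3.
    have [r ar] : exists r : R, a = r%:C%:A.
      by apply/(qcms_ker qA); split=> //; apply/eqP; rewrite eq_le l1 (qcms_ge0 qA).
    have [s bs] : exists r : R, b = r%:C%:A.
      by apply/(qcms_ker qB); split=> //; apply/eqP; rewrite eq_le l2 (qcms_ge0 qB).
    (* The two scalars agree because |a - iota b| <= eps * 0. *)
    exists r; apply: injective_projections => //=.
    rewrite bs; congr (_%:C%:A); apply/eqP; rewrite eq_sym -subr_eq0 -normr_le0.
    move: l3; rewrite ar bs linearZ /= rmorph1 -scalerBl -rmorphB /= anormZr anorm1.
    by rewrite mulr1 mulr0.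
  have [dA lA] : ldom LA r%:C%:A /\ LA r%:C%:A = 0 by apply/(qcms_ker qA); exists r.
  have [dB lB] : ldom LB r%:C%:A /\ LB r%:C%:A = 0 by apply/(qcms_ker qB); exists r.
  split; first by split.
  rewrite /= lA lB linearZ /= rmorph1 subrr anorm0 mul0r !maxxx//.
- exact: mk_metrizes L_dom0 L_Z L_dense L_ge0 L_hom mk_finite mk_coarser.
- move=> p q dp dq; have [pA pB] := dp; have [qA' qB'] := dq.
  set c := _ + _.
  have [p1 p2 p3] := sum_lip_bounds p; have [q1 q2 q3] := sum_lip_bounds q.
  have Om0 : 0 <= Om by exact: le_trans Om1.
  have Lp0 := L_ge0 dp; have Lq0 := L_ge0 dq.
  have npA : anorm p.1 <= anorm p by rewrite sum_anormE le_max lexx.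
  have npB : anorm p.2 <= anorm p by rewrite sum_anormE le_max lexx orbT.
  have nqA : anorm q.1 <= anorm q by rewrite sum_anormE le_max lexx.
  have nqB : anorm q.2 <= anorm q by rewrite sum_anormE le_max lexx orbT.
  have cA : Om * (anorm p.1 * LA q.1 + LA p.1 * anorm q.1) + Om' * LA p.1 * LA q.1 <= c.
    rewrite /c lerD//; last by rewrite -!mulrA ler_wpM2l// ler_pM// (qcms_ge0 qA).
    rewrite ler_wpM2l//.
    by rewrite lerD// ler_pM ?anorm_ge0// (qcms_ge0 qA).
  have cB : Om * (anorm p.2 * LB q.2 + LB p.2 * anorm q.2) + Om' * LB p.2 * LB q.2 <= c.
    rewrite /c lerD//; last by rewrite -!mulrA ler_wpM2l// ler_pM// (qcms_ge0 qB).
    rewrite ler_wpM2l//.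
    by rewrite lerD// ler_pM ?anorm_ge0// (qcms_ge0 qB).
  have := qcms_leibniz qA pA qA'; rewrite ge_max => /andP[rA iA].
  have := qcms_leibniz qB pB qB'; rewrite ge_max => /andP[rB iB].
  have M : anorm ((p * q).1 - iota (p * q).2) <= eps * c.
    rewrite /= rmorphM /=.
    (* The distance term obeys a Leibniz rule with constant 1, since iota is multiplicative and
       contractive. *)
    have -> : p.1 * q.1 - iota p.2 * iota q.2 =
        p.1 * (q.1 - iota q.2) + (p.1 - iota p.2) * iota q.2.
      by rewrite mulrBr mulrBl addrA subrK.
    apply: le_trans (anormD _ _) _.
    have h1 : anorm (p.1 * (q.1 - iota q.2)) <= anorm p * (eps * L q).
      by apply: le_trans (anormM _ _) _; rewrite ler_pM ?anorm_ge0.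
    have h2 : anorm ((p.1 - iota p.2) * iota q.2) <= eps * L p * anorm q.
      apply: le_trans (anormM _ _) _; rewrite ler_pM ?anorm_ge0//.
      exact: le_trans (iota_le _) nqB.
    have h3 : 0 <= anorm p * L q + L p * anorm q by rewrite addr_ge0 ?mulr_ge0 ?anorm_ge0.
    have h4 : anorm p * L q + L p * anorm q <= c.
      rewrite /c -[leLHS]addr0 lerD ?ler_peMl//.
      by rewrite !mulr_ge0.
    have := ler_wpM2l (ltW eps0) h4; lra.
  (* Real and imaginary parts are, up to a phase, averages of the product and plus or minus its
     adjoint, which satisfy the same bound. *)
  have half (k : R[i]) (u v : (A * B)%type) : cabs k = 2^-1 ->
      anorm (u.1 - iota u.2) <= eps * c -> anorm (v.1 - iota v.2) <= eps * c ->
      anorm ((k *: (u + v)).1 - iota (k *: (u + v)).2) <= eps * c.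
    move=> kE hu hv.
    have -> : (k *: (u + v)).1 - iota (k *: (u + v)).2 =
        k *: ((u.1 - iota u.2) + (v.1 - iota v.2)).
      by rewrite /= linearZ_LR (rmorphD iota) -scalerBr opprD addrACA.
    rewrite anormZ kE.
    have := anormD (u.1 - iota u.2) (v.1 - iota v.2); lra.
  have Ms : anorm ((star (p * q)).1 - iota (star (p * q)).2) <= eps * c.
    by rewrite sum_starE /= iota_star -starB star_anorm.
  have Mn : anorm ((- star (p * q)).1 - iota (- star (p * q)).2) <= eps * c.
    by rewrite /= rmorphN /= opprK addrC -anormN opprD opprK addrC.
  rewrite ge_max; apply/andP; split; apply/sum_lip_leP; split.
  + exact: le_trans rA cA.
  + exact: le_trans rB cB.
  + exact: half (cabs_re_coef R) M Ms.
  + exact: le_trans iA cA.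
  + exact: le_trans iB cB.
  + exact: half (cabs_im_coef R) M Mn.
- apply: closed_nrmP => p h.
  have hA : ldom LA p.1 /\ LA p.1 <= 1.
    have := qcms_closed qA; apply.
    apply/closure_nrmP => e /h[q [[qA' _] /sum_lip_leP[l _ _]] pq].
    exists (q.1 : nspace A) => //; apply: le_lt_trans pq.
    by rewrite !nspace_nrm sum_anormE le_max lexx.
  have hB : ldom LB p.2 /\ LB p.2 <= 1.
    have := qcms_closed qB; apply.
    apply/closure_nrmP => e /h[q [[_ qB'] /sum_lip_leP[_ l _]] pq].
    exists (q.2 : nspace B) => //; apply: le_lt_trans pq.
    by rewrite !nspace_nrm sum_anormE le_max lexx orbT.
  split; first by split; [exact: hA.1|exact: hB.1].
  apply/sum_lip_leP; split; [exact: hA.2|exact: hB.2|].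
  rewrite mulr1; apply: (@ler_eps _ _ _ 2) => // e e0.
  have [q [_ /sum_lip_leP[_ _ l]] pq] := h _ e0.
  rewrite mulr1 in l; move: pq; rewrite nspace_nrm sum_anormE gt_max => /andP[p1 p2].
  have -> : p.1 - iota p.2 = (p.1 - q.1) + (q.1 - iota q.2) - iota (p.2 - q.2).
    by rewrite (rmorphB iota) addrA subrK opprB addrA subrK.
  apply: le_trans (anormB _ _) _.
  have := anormD (p.1 - q.1) (q.1 - iota q.2); have := iota_le (p.2 - q.2).
  lra.
Qed.
End SumQcms.

(** * Quantum isometries and extent of the direct sum *)

Section SumTunnel.
Variables (R : realType) (A B : cstarAlgType R) (LA : seminorm A) (LB : seminorm B).
Variables (Om Om' : R).
Hypotheses (qA : is_qcms Om Om' LA) (qB : is_qcms Om Om' LB).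
Variable iota : {lrmorphism B -> A}.
Hypothesis iota_star : star_preserving iota.
Hypothesis states_A : exists phi, @state R A phi.
Hypothesis states_B : exists phi, @state R B phi.
Variable eps : R.
Hypothesis eps0 : 0 < eps.
Local Notation L := (sum_lip LA LB iota eps).

Lemma attained_inf T (F : T -> R) (X : set T) (c : R) :
  (forall x, X x -> c <= F x) -> (exists2 x, X x & F x <= c) ->
  c%:E = ereal_inf [set (F x)%:E | x in X].
Proof.
move=> lb [x Xx Fx]; apply/eqP; rewrite eq_le; apply/andP; split.
  by apply: le_ereal_inf_tmp => _ [y Xy <-]; rewrite lee_fin; exact: lb.
by apply: le_trans (ereal_inf_lbound _) _; [by exists x|rewrite lee_fin].
Qed.

Lemma sum_fst_isometry :
  (forall a, ldom LA a -> exists b, [/\ ldom LB b, LB b <= LA a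
     & anorm (a - iota b) <= eps * LA a]) ->
  quantum_isometry L LA (@fst A B).
Proof.
move=> h; split=> //.
- by move=> a; exists (a, 0).
- by move=> p [].
- move=> a da; apply: attained_inf => [p [_ <-]|].
    by have [] := sum_lip_bounds LA LB iota eps0 p.
  have [b [db lb ab]] := h a da; exists (a, b); first by split.
  exact/(sum_lip_leP _ _ _ eps0).
Qed.

Lemma sum_snd_isometry :
  (forall b, ldom LB b -> exists a, [/\ ldom LA a, LA a <= LB b
     & anorm (a - iota b) <= eps * LB b]) ->
  quantum_isometry L LB (@snd A B).
Proof.
move=> h; split=> //.
- by move=> b; exists (0, b).
- by move=> p [].
- move=> b db; apply: attained_inf => [p [_ <-]|].
    by have [] := sum_lip_bounds LA LB iota eps0 p.
  have [a [da la ab]] := h b db; exists (a, b); first by split.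
  exact/(sum_lip_leP _ _ _ eps0).
Qed.

(** States pulled back along f are states of the sum, so one of the two one-sided distances is
    immediate. *)
Let hausdorff_le (C : cstarAlgType R) (f : {lrmorphism (A * B)%type -> C}) :
  star_preserving f ->
  (forall phi, @state R (A * B)%type phi -> exists2 psi, @state R C psi &
     forall p, ldom L p -> L p <= 1 -> cabs ((psi (f p) : R[i]) - phi p) <= eps) ->
  (hausdorff (mk L) [set phi \o f | phi in @state R C] (@state R (A * B)%type) <= eps%:E)%E.
Proof.
move=> fs h; rewrite /hausdorff ge_max; apply/andP; split.
  apply: ge_ereal_sup => _ [_ [psi spsi <-] <-].
  apply: le_trans (ereal_inf_lbound _) _.
    by exists (psi \o f) => //; exact: state_comp.
  by apply: mk_le => p _ _; rewrite subrr /cabs normr0 ltW.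
apply: ge_ereal_sup => _ [phi sphi <-].
have [psi spsi close] := h phi sphi.
apply: le_trans (ereal_inf_lbound _) _.
  by exists (psi \o f) => //; exists psi.
exact: mk_le.
Qed.

(** Replacing the component phi2 on B by an extension psi2 to A changes the value at (a, b) by (1 -
    t) psi2 (a - iota b), of size at most eps. *)
Lemma sum_hausdorff_fst :
  (forall phi, @state R B phi -> exists2 psi, @state R A psi & forall b, psi (iota b) = phi b) ->
  (hausdorff (mk L) [set phi \o (@fst A B) | phi in @state R A] (@state R (A * B)%type)
    <= eps%:E)%E.
Proof.
move=> ext; apply: hausdorff_le => // phi sphi.
have [rA srA] := states_A; have [rB srB] := states_B.
have [t [phi1 [phi2 [t01 s1 s2 phiE]]]] := sum_state_decomposition sphi srA srB.
have [psi2 s3 psi2E] := ext _ s2.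
eexists; first exact: (state_convex s3 s1 t01).
move=> p dp /(sum_lip_leP _ _ _ eps0)[_ _]; rewrite mulr1 => lp.
rewrite phiE (_ : _ - _ = (1 - t)%:C * (psi2 (p.1 - iota p.2) : R[i])); last first.
  by rewrite (stateB s3) psi2E; ring.
rewrite cabsM cabs_real; move: t01 => /andP[t0 t1].
apply: le_trans (le_trans (state_contractive s3 _) lp).
by rewrite ger0_norm ?subr_ge0// ler_piMl ?cabs_ge0// gerBl.
Qed.

(** Here the component on A is simply pulled back along iota. *)
Lemma sum_hausdorff_snd :
  (hausdorff (mk L) [set phi \o (@snd A B) | phi in @state R B] (@state R (A * B)%type)
    <= eps%:E)%E.
Proof.
apply: hausdorff_le => // phi sphi.
have [rA srA] := states_A; have [rB srB] := states_B.
have [t [phi1 [phi2 [t01 s1 s2 phiE]]]] := sum_state_decomposition sphi srA srB.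
eexists; first exact: (state_convex s2 (state_comp iota_star s1) t01).
move=> p dp /(sum_lip_leP _ _ _ eps0)[_ _]; rewrite mulr1 => lp.
rewrite phiE (_ : _ - _ = - (t%:C * (phi1 (p.1 - iota p.2) : R[i]))); last first.
  by rewrite (stateB s1) /=; ring.
rewrite /cabs normrN -/(cabs _) cabsM cabs_real; move: t01 => /andP[t0 t1].
apply: le_trans (le_trans (state_contractive s1 _) lp).
by rewrite ger0_norm// ler_piMl ?cabs_ge0.
Qed.
End SumTunnel.

(** * The scalars as a quantum compact metric space *)

Section ComplexQcms.
Variable R : realType.
Local Notation C := (R[i]^o : cstarAlgType R).

Definition trivial_lip : seminorm C := Seminorm (@selfadjoint R C) (fun=> 0).

Lemma complex_state (phi : C -> R[i]^o) : state phi -> forall z, (phi z : R[i]) = z.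
Proof.
move=> sphi z; rewrite -[z in LHS]mulr1.
by rewrite [phi _](stateZ sphi z 1) (state1 sphi) mulr1.
Qed.

Lemma complex_state_ex : exists phi, @state R C phi.
Proof.
exists id; split=> // a; rewrite mulrC; exact: mulcJ_ge0.
Qed.

(** C has a single state, so [mk] vanishes on states and the topological conditions are trivial. *)
Lemma complex_qcms (Om Om' : R) : is_qcms Om Om' trivial_lip.
Proof.
have mk0 (phi psi : C -> R[i]^o) : state phi -> state psi -> (mk trivial_lip phi psi <= 0%:E)%E.
  move=> sphi spsi; apply: mk_le => z _ _.
  by rewrite (complex_state sphi) (complex_state spsi) subrr /cabs normr0.
have d0 : ldom trivial_lip 0 by rewrite /= /selfadjoint /= star0.
have dZ (r : R) (z : C) : ldom trivial_lip z -> ldom trivial_lip (r%:C *: z).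
  by rewrite /= /selfadjoint /= starZr => ->.
have hom (r : R) (z : C) : ldom trivial_lip z ->
    trivial_lip (r%:C *: z) = `|r| * trivial_lip z.
  by rewrite /= mulr0.
have dense : @selfadjoint R C `<=` (closure (ldom trivial_lip : set (nspace C)) : set C).
  by move=> z sz; exact: subset_closure.
split=> //.
- by move=> z w sz sw; rewrite /= /selfadjoint /= starD sz sw.
- by move=> z w _ _; exact: re_part_sa.
- by move=> z w _ _; exact: im_part_sa.
- by move=> z w _ _; rewrite /= addr0.
- move=> z; split=> [[sz _]|[r ->]].
    exists (complex.Re (z : R[i])); rewrite /GRing.scale /= mulr1.
    case: z sz => x y /= [h]; congr (_ +i* _); lra.
  by split=> //; rewrite /= /selfadjoint /= starZr star1.
- apply: mk_metrizes => // [phi psi sphi spsi|phi e sphi e0].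
    exact: (mk_fin d0 hom (mk0 _ _ sphi spsi)).
  exists [::], 1; split=> // psi spsi _.
  by apply: le_lt_trans (mk0 _ _ sphi spsi) _; rewrite lte_fin.
- by move=> z w _ _; rewrite /= maxxx !mulr0 mul0r !addr0 mulr0.
- apply: closed_nrmP => z h; split=> //; apply: selfadjoint_closed => e e0.
  by have [w [sw _] zw] := h _ e0; exists w.
Qed.
End ComplexQcms.

(** * The tunnel *)

Section ProductSpace.
Variables (R : realType) (U V : completeNormedModType R[i]).

Lemma nrm_pair (w : (U * V)%type) : nrm w = Num.max (nrm w.1) (nrm w.2).
Proof.
rewrite {1}/nrm prod_normE !normr_nrm /Num.max ltcR.
by case: (ltP (nrm w.1)).
Qed.

Let W : normedModType R[i] := (U * V)%type.

Lemma product_complete (F : set_system W) :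
  ProperFilter F -> cauchy F -> cvg F.
Proof.
move=> PF /cauchyP cF.
have part (X : completeNormedModType R[i]) (f : W -> X) :
    (forall p q, nrm (f p - f q) <= nrm (p - q)) ->
    exists l : X, forall e : R, 0 < e -> F [set p | nrm (l - f p) < e].
  move=> fle.
  have /cvg_ex[l Fl] : cvg (f @ F).
    apply/cauchy_cvgP/cauchyP => e e0; have [x Fx] := cF _ e0; exists (f x).
    rewrite nbhs_simpl /=; apply: filterS Fx => y.
    have -> : ball x e y = (`|x - y| < e) by rewrite -ball_normE.
    rewrite -!ball_normE /ball_ /= !normr_nrm.
    by apply: le_lt_trans; rewrite lecR; exact: fle.
  by exists l => e e0; have /cvg_nrmP/(_ e e0) := Fl.
have [p q|a Fa] := part U fst; first by rewrite nrm_pair le_max lexx.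
have [p q|b Fb] := part V snd; first by rewrite nrm_pair le_max lexx orbT.
apply/cvg_ex; exists ((a, b) : W).
move=> X /nbhs_nrmP[e e0 hX]; apply: filterS2 (Fa _ e0) (Fb _ e0) => p pa pb.
by apply: hX; rewrite nrm_pair gt_max pa.
Qed.

HB.instance Definition _ := Uniform_isComplete.Build (U * V)%type product_complete.
End ProductSpace.

Section Tunnel.
Variables (R : realType) (S T : spectralData R).
Hypotheses (mS : metric_spectral_triple S) (mT : metric_spectral_triple T).
Let sS : spectral_triple S := mS.1.
Let sT : spectral_triple T := mT.1.
Variables (Om Om' Omod Oinn : R).
Hypotheses (Om1 : 1 <= Om) (Om'0 : 0 <= Om') (Omod2 : 2 <= Omod) (Oinn1 : 1 <= Oinn).
Variable iota : {lrmorphism salg T -> salg S}.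
Variables (kappa : {linear shil T -> shil S}) (kappa' : {linear shil S -> shil T}).
Hypothesis iota_star : star_preserving iota.
Hypothesis kappa_iso : forall x y,
  hdot (shil S) (kappa x) (kappa y) = hdot (shil T) x y.
Hypothesis kappa'P : forall x y, hdot (shil S) (kappa x) y = hdot (shil T) x (kappa' y).
Hypothesis kappa_act : forall (a : salg T) x, sact (iota a) (kappa x) = kappa (sact a x).
Hypothesis kappa_dirac : intertwines (Defs.dirac T) (Defs.dirac S) kappa.
Variable eps : R.
Hypothesis eps0 : 0 < eps.
Hypothesis approx : forall x, odom (Defs.dirac S) x ->
  nrm (x - kappa (kappa' x)) <= eps * (nrm x + nrm (Defs.dirac S x)).
Hypothesis bridge_in : forall a, ldom (lipD S) a -> exists b, [/\ ldom (lipD T) b,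
  lipD T b <= lipD S a & anorm (a - iota b) <= eps * lipD S a].
Hypothesis bridge_out : forall b, ldom (lipD T) b -> exists a, [/\ ldom (lipD S) a,
  lipD S a <= lipD T b & anorm (a - iota b) <= eps * lipD T b].
Hypothesis expi_out : forall t x,
  kappa' (expi (Defs.dirac S) t x) = expi (Defs.dirac T) t (kappa' x).
Hypothesis expi_in : forall t y,
  kappa (expi (Defs.dirac T) t y) = expi (Defs.dirac S) t (kappa y).

Local Notation HS := (shil S).
Local Notation HT := (shil T).
Local Notation DS := (Defs.dirac S).
Local Notation DT := (Defs.dirac T).
Local Notation C := (R[i]^o : cstarAlgType R).

Let gnS x := nrm x + nrm (DS x).
Let gnT x := nrm x + nrm (DT x).

Definition tunnel_norm (w : (HS * HT)%type) : R :=
  Num.max (Num.max (gnS w.1) (gnT w.2)) (nrm (w.1 - kappa w.2) / eps).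

(** On the base the radius is 2 * eps: the two components of <w, e> differ by at most 2 eps TN(w)
    TN(e), one eps for each argument. *)
Definition tunnel_correspondence : correspondence R :=
  @Correspondence R (salg S * salg T)%type (C * C)%type
    (sum_lip (lipD S) (lipD T) iota eps)
    (sum_lip (trivial_lip R) (trivial_lip R) idfun (2 * eps))
    (HS * HT)%type
    (fun a w => (sact a.1 w.1, sact a.2 w.2))
    (fun w z => ((z.1 : R[i]) *: w.1, (z.2 : R[i]) *: w.2))
    (fun w e => (hdot HS e.1 w.1 : R[i]^o, hdot HT e.2 w.2 : R[i]^o))
    [set w | odom DS w.1 /\ odom DT w.2]
    tunnel_norm.

Local Notation P := tunnel_correspondence.

Lemma tunnel_norm_leP w (c : R) :
  tunnel_norm w <= c <-> [/\ gnS w.1 <= c, gnT w.2 <= c & nrm (w.1 - kappa w.2) <= eps * c].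
Proof.
rewrite /tunnel_norm !ge_max ler_pdivrMr// [c * eps]mulrC.
by split=> [/andP[/andP[]]|[-> -> ->]].
Qed.

Let dS : self_adjoint DS := st_self_adjoint sS.
Let dT : self_adjoint DT := st_self_adjoint sT.

Let tn_bounds w : [/\ gnS w.1 <= tunnel_norm w, gnT w.2 <= tunnel_norm w
  & nrm (w.1 - kappa w.2) <= eps * tunnel_norm w].
Proof. exact/tunnel_norm_leP. Qed.

Let tn_ge0 w : 0 <= tunnel_norm w.
Proof. by rewrite /tunnel_norm !le_max /gnS addr_ge0 ?nrm_ge0. Qed.

Let states_S : exists phi, @state R (salg S) phi.
Proof. by have [e e1] := rep_unit_vector sS; eexists; exact: vector_state e1. Qed.

Let states_T : exists phi, @state R (salg T) phi.
Proof. by have [e e1] := rep_unit_vector sT; eexists; exact: vector_state e1. Qed.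

Let eps2 : 0 < 2 * eps. Proof. by rewrite mulr_gt0. Qed.

Lemma tunnel_module : hilbert_module P.
Proof.
split=> /=.
- by move=> b k w e; apply: injective_projections; rewrite /= scalerDr !scalerA mulrC.
- move=> w k b c; apply: injective_projections; rewrite /= scalerDl;
    by congr (_ + _); rewrite [in LHS]/GRing.scale /= scalerA.
- by move=> w; apply: injective_projections; rewrite /= scale1r.
- by move=> w b c; apply: injective_projections; rewrite /= scalerA mulrC.
- by move=> w k e e'; apply: injective_projections; rewrite /= hdotDl hdotZl.
- by move=> w e b; apply: injective_projections; rewrite /= hdotZl mulrC.
- by move=> w e; apply: injective_projections; rewrite /= [RHS]hdotC.
- move=> w; exists ((nrm w.1)%:C : R[i]^o, (nrm w.2)%:C : R[i]^o).
  have E (r : R) : star (r%:C : R[i]^o) * r%:C = (r ^+ 2)%:C :> R[i]^o.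
    by rewrite [star _]conjc_real -rmorphM expr2.
  by apply: injective_projections; rewrite /= E hdotxx.
- move=> w; rewrite nrm_pair sum_anormE /= !hdotxx.
  have E (r : R) : anorm ((r ^+ 2)%:C : R[i]^o) = r ^+ 2.
    by rewrite [anorm _]cabs_real ger0_norm ?sqr_ge0.
  rewrite !E /Num.max ltr_pXn2r ?nnegrE ?nrm_ge0//.
  by case: ifP => _; rewrite sqrtr_sqr ger0_norm ?nrm_ge0.
Qed.

(** The ball is a closed part of the product of the two compact graph-norm balls. *)
Lemma tunnel_ball_compact : compact [set w : P | mdom w /\ DN w <= 1].
Proof.
have cS := graph_ball_compact dS (st_compact sS).
have cT := graph_ball_compact dT (st_compact sT).
apply: (subclosed_compact _ (compact_setX cS cT)); last first.
  by move=> w [[w1 w2] /tunnel_norm_leP[h1 h2 _]]; split; split.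
apply: closed_nrmP => w h.
have hS : odom DS w.1 /\ nrm w.1 + nrm (DS w.1) <= 1.
  apply: (graph_ball_closed dS) => e /h[v [[v1 v2] /tunnel_norm_leP[l _ _]] wv].
  by exists v.1 => //; apply: le_lt_trans wv; rewrite nrm_pair le_max lexx.
have hT : odom DT w.2 /\ nrm w.2 + nrm (DT w.2) <= 1.
  apply: (graph_ball_closed dT) => e /h[v [[v1 v2] /tunnel_norm_leP[_ l _]] wv].
  by exists v.2 => //; apply: le_lt_trans wv; rewrite nrm_pair le_max lexx orbT.
split; first by split; [exact: hS.1|exact: hT.1].
apply/tunnel_norm_leP; split; [exact: hS.2|exact: hT.2|].
rewrite mulr1; apply: (@ler_eps _ _ _ 2) => // e e0.
have [v [_ /tunnel_norm_leP[_ _ l]] wv] := h _ e0.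
rewrite mulr1 in l; move: wv; rewrite nrm_pair gt_max => /andP[w1 w2].
have -> : w.1 - kappa w.2 = (w.1 - v.1) + (v.1 - kappa v.2) - kappa (w.2 - v.2).
  by rewrite linearB addrA subrK opprB addrA subrK.
apply: le_trans (nrmB _ _) _; rewrite (isometry_nrm kappa_iso).
have := nrmD (w.1 - v.1) (v.1 - kappa v.2).
have : nrm (w.1 - v.1) < e by []. have : nrm (w.2 - v.2) < e by [].
lra.
Qed.

(** D a x = [D, a] x + a D x. *)
Let act_graph_norm (Q : spectralData R) (sQ : spectral_triple Q) (a : salg Q) x :
  ldom (lipD Q) a -> odom (Defs.dirac Q) x ->
  nrm (sact a x) + nrm (Defs.dirac Q (sact a x)) <=
    (anorm a + lipD Q a) * (nrm x + nrm (Defs.dirac Q x)).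
Proof.
move=> [_ ma] dx.
have h1 := lip_bound sQ ma dx; have h2 := sact_bound sQ a x.
have h3 := sact_bound sQ a (Defs.dirac Q x).
have h4 := nrmD (commutator (Defs.dirac Q) (sact a) x) (sact a (Defs.dirac Q x)).
rewrite [X in nrm X](_ : _ = Defs.dirac Q (sact a x)) in h4; last by rewrite /commutator subrK.
have h5 : 0 <= lipD Q a * nrm (Defs.dirac Q x) by rewrite mulr_ge0 ?nrm_ge0 ?lip_ge0.
lra.
Qed.

Lemma tunnel_leibniz (a : malg P) (w : P) : ldom (malgL P) a -> mdom w ->
  mdom (lact a w) /\ DN (lact a w) <= Omod * (anorm a + malgL P a) * DN w.
Proof.
move=> [da db] [w1 w2]; split; first by split; [exact: da.2.1|exact: db.2.1].
have [l1 l2 l3] := sum_lip_bounds (lipD S) (lipD T) iota eps0 a.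
have [n1 n2 n3] := tn_bounds w.
have aA : anorm a.1 <= anorm a by rewrite sum_anormE le_max lexx.
have aB : anorm a.2 <= anorm a by rewrite sum_anormE le_max lexx orbT.
pose m := anorm a + malgL P a.
have L0 : 0 <= malgL P a by apply: le_trans l1; exact: lip_ge0.
have m0 : 0 <= m by rewrite addr_ge0 ?anorm_ge0.
have t0 := tn_ge0 w.
have mle : m * tunnel_norm w <= Omod * m * tunnel_norm w.
  by rewrite ler_wpM2r// ler_peMl// (le_trans _ Omod2)// ler1n.
apply: le_trans mle; apply/tunnel_norm_leP; split=> /=.
- apply: le_trans (act_graph_norm sS da w1) _.
  by rewrite ler_pM ?addr_ge0 ?nrm_ge0 ?anorm_ge0 ?lip_ge0// lerD.
- apply: le_trans (act_graph_norm sT db w2) _.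
  by rewrite ler_pM ?addr_ge0 ?nrm_ge0 ?anorm_ge0 ?lip_ge0// lerD.
(* kappa intertwines the actions, so the difference splits into an algebra part, bounded by eps L(a)
   TN(w), and a module part, bounded by |a| eps TN(w). *)
- have -> : sact a.1 w.1 - kappa (sact a.2 w.2) =
      sact (a.1 - iota a.2) w.1 + sact (iota a.2) (w.1 - kappa w.2).
    by rewrite (sactB sS) (sactBr sS) kappa_act addrA subrK.
  apply: le_trans (nrmD _ _) _.
  have h1 : nrm (sact (a.1 - iota a.2) w.1) <= eps * malgL P a * tunnel_norm w.
    apply: le_trans (sact_bound sS _ _) _; rewrite ler_pM ?anorm_ge0 ?nrm_ge0//.
    by apply: le_trans n1; rewrite /gnS lerDl nrm_ge0.
  have h2 : nrm (sact (iota a.2) (w.1 - kappa w.2)) <= anorm a * (eps * tunnel_norm w).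
    apply: le_trans (sact_bound sS _ _) _; rewrite ler_pM ?anorm_ge0 ?nrm_ge0//.
    exact: le_trans (star_morphism_contractive sS iota_star _) aB.
  have : nrm (sact (a.1 - iota a.2) w.1) + nrm (sact (iota a.2) (w.1 - kappa w.2)) <=
     eps * malgL P a * tunnel_norm w + anorm a * (eps * tunnel_norm w) by rewrite lerD.
  move/le_trans; apply; rewrite le_eqVlt; apply/orP; left; apply/eqP.
  by rewrite /m; ring.
Qed.

Lemma tunnel_inner_leibniz (w e : P) : mdom w -> mdom e ->
  [/\ ldom (mbaseL P) (re_part (minner w e)),
      ldom (mbaseL P) (im_part (minner w e))
    & Num.max (mbaseL P (re_part (minner w e))) (mbaseL P (im_part (minner w e)))
        <= Oinn * DN w * DN e].
Proof.
move=> dw de.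
have dom (f : mbase P) : star f = f -> ldom (mbaseL P) f.
  by case: f => u v; rewrite sum_starE => -[su sv]; split.
split; [exact/dom/re_part_sa|exact/dom/im_part_sa|].
have w0 := tn_ge0 w; have e0 := tn_ge0 e.
set c := _ * _ * _.
have cge : tunnel_norm w * tunnel_norm e <= c.
  by rewrite /c -mulrA ler_peMl// mulr_ge0.
have c0 : 0 <= c by apply: le_trans cge; rewrite mulr_ge0.
have [w1 w2 w3] := tn_bounds w; have [e1 e2 e3] := tn_bounds e.
pose f := minner w e : (C * C)%type.
have fle : anorm (f.1 - f.2) <= 2 * eps * c.
  (* kappa is isometric, so both inner products can be compared in the larger space, one argument at
     a time. *)
  have -> : f.1 - f.2 = (hdot HS (e.1 - kappa e.2) w.1 : R[i]) +
      (hdot HS (kappa e.2) (w.1 - kappa w.2) : R[i]).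
    by rewrite /f /= hdotBl hdotBr kappa_iso addrA subrK.
  apply: le_trans (cabsD _ _) _.
  have h1 := cauchy_schwarz (e.1 - kappa e.2) w.1.
  have h2 := cauchy_schwarz (kappa e.2) (w.1 - kappa w.2).
  rewrite (isometry_nrm kappa_iso) in h2.
  have h3 : nrm (e.1 - kappa e.2) * nrm w.1 <= eps * tunnel_norm e * tunnel_norm w.
    rewrite ler_pM ?nrm_ge0//; apply: le_trans w1; by rewrite /gnS lerDl nrm_ge0.
  have h4 : nrm e.2 * nrm (w.1 - kappa w.2) <= tunnel_norm e * (eps * tunnel_norm w).
    rewrite ler_pM ?nrm_ge0//; apply: le_trans e2; by rewrite /gnT lerDl nrm_ge0.
  have h5 : eps * (tunnel_norm w * tunnel_norm e) <= eps * c by rewrite ler_wpM2l// ltW.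
  apply: le_trans (lerD (le_trans h1 h3) (le_trans h2 h4)) _.
  apply: le_trans (_ : 2 * (eps * (tunnel_norm w * tunnel_norm e)) <= _); last first.
    by rewrite -mulrA ler_wpM2l.
  by rewrite le_eqVlt; apply/orP; left; apply/eqP; ring.
have half (k : R[i]) (u v : mbase P) : cabs k = 2^-1 ->
    anorm (u.1 - u.2) <= 2 * eps * c -> anorm (v.1 - v.2) <= 2 * eps * c ->
    mbaseL P (k *: (u + v)) <= c.
  move=> kE hu hv; apply/(sum_lip_leP _ _ _ eps2); split=> //.
  have -> : (k *: (u + v)).1 - idfun (k *: (u + v)).2 = k *: ((u.1 - u.2) + (v.1 - v.2)).
    by rewrite /= -scalerBr opprD addrACA.
  rewrite anormZ kE; have := anormD (u.1 - u.2) (v.1 - v.2); lra.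
have sle : anorm ((star f).1 - (star f).2) <= 2 * eps * c.
  by rewrite sum_starE /= -starB star_anorm.
have nle : anorm ((- star f).1 - (- star f).2) <= 2 * eps * c.
  by rewrite /= -opprD anormN.
rewrite ge_max; apply/andP; split.
  exact: half (cabs_re_coef R) fle sle.
exact: half (cabs_im_coef R) fle nle.
Qed.

Lemma tunnel_metrical : metrical_correspondence Om Om' Omod Oinn P.
Proof.
split.
- exact (sum_qcms Om1 Om'0 (qcms_lipD mS Om1 Om'0) (qcms_lipD mT Om1 Om'0) iota_star
    (star_morphism_contractive sS iota_star) states_S states_T eps0).
- have cC := complex_state_ex R.
  have id_star : star_preserving (idfun : {lrmorphism C -> C}) by [].
  have id_le (z : C) : anorm ((idfun : {lrmorphism C -> C}) z) <= anorm z by [].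
  exact (sum_qcms Om1 Om'0 (complex_qcms Om Om') (complex_qcms Om Om')
    id_star id_le cC cC eps2).
- exact: tunnel_module.
- by move=> w k a b; apply: injective_projections;
    rewrite /= ?(sactD sS) ?(sactZ sS) ?(sactD sT) ?(sactZ sT).
- by move=> w; apply: injective_projections; rewrite /= ?(st_act1 sS) ?(st_act1 sT).
- by move=> a b w; apply: injective_projections; rewrite /= ?(st_actM sS) ?(st_actM sT).
- move=> a w e; apply: injective_projections; rewrite /=.
    by rewrite hdotC (st_adjoint sS) -hdotC.
  by rewrite hdotC (st_adjoint sT) -hdotC.
- by split; exact: sa_dom0.
- by move=> k w e [w1 w2] [e1 e2]; split; exact: sa_domP.
- rewrite eqEsubset; split=> // -[x y] _; apply/closure_nrmP => e e0.
  have : closure (odom DS) x by rewrite (sa_dense dS).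
  move=> /closure_nrmP/(_ e e0)[x' dx' xx'].
  have : closure (odom DT) y by rewrite (sa_dense dT).
  move=> /closure_nrmP/(_ e e0)[y' dy' yy'].
  by exists (x', y') => //; rewrite nrm_pair gt_max xx'.
- move=> w e [w1 w2] [e1 e2]; apply/tunnel_norm_leP.
  have [a1 a2 a3] := tn_bounds w; have [b1 b2 b3] := tn_bounds e; split.
  + rewrite /gnS /= (sa_D dS)//; have := nrmD w.1 e.1; have := nrmD (DS w.1) (DS e.1).
    move: a1 b1; rewrite /gnS /=; lra.
  + rewrite /gnT /= (sa_D dT)//; have := nrmD w.2 e.2; have := nrmD (DT w.2) (DT e.2).
    move: a2 b2; rewrite /gnT /=; lra.
  + by rewrite /= linearD opprD addrACA mulrDr (le_trans (nrmD _ _))// lerD.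
- move=> k w [w1 w2]; rewrite /= /tunnel_norm /gnS /gnT /= (sa_Z dS)// (sa_Z dT)//.
  rewrite linearZ /= -scalerBr !nrmZ -!mulrDr -mulrA.
  by rewrite -!maxr_pMr ?cabs_ge0.
- move=> w _; have [a1 a2 _] := tn_bounds w; rewrite nrm_pair ge_max.
  by apply/andP; split; [apply: le_trans a1|apply: le_trans a2];
    rewrite lerDl nrm_ge0.
- exact: tunnel_ball_compact.
- exact: tunnel_leibniz.
- exact: tunnel_inner_leibniz.
Qed.

Let fst_isometry : metrical_quantum_isometry (M1 := P) (M2 := metCor S)
  (@fst HS HT) (@fst (salg S) (salg T)) (@fst C C).
Proof.
split.
- split; last by move=> x; exists (x, 0).
  move=> w; apply/cvg_nrmP => e e0; apply: (nbhs_nrmP (w : mspace P) _).2; exists e => // v.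
  by apply: le_lt_trans; rewrite nrm_pair le_max lexx.
- split; first by apply: sum_fst_isometry.
  by apply: sum_fst_isometry => // z sz; exists z; split=> //; rewrite subrr anorm0 mulr0.
- by split.
- by move=> w [].
- move=> x dx; apply: attained_inf => [w [_ <-]|]; first by case: (tn_bounds w).
  have [dy Dy] := adjoint_intertwines dT dS kappa'P kappa_dirac dx.
  (* This lift attains the infimum: kappa' is contractive and intertwines the operators, so the
     graph norm does not increase. *)
  exists (x, kappa' x) => //; apply/tunnel_norm_leP; split=> //=; last exact: approx.
  by rewrite /gnT Dy lerD// (adjoint_nrm kappa_iso kappa'P).
Qed.

Let snd_isometry : metrical_quantum_isometry (M1 := P) (M2 := metCor T)
  (@snd HS HT) (@snd (salg S) (salg T)) (@snd C C).
Proof.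
split.
- split; last by move=> x; exists (0, x).
  move=> w; apply/cvg_nrmP => e e0; apply: (nbhs_nrmP (w : mspace P) _).2; exists e => // v.
  by apply: le_lt_trans; rewrite nrm_pair le_max lexx orbT.
- split; first by apply: sum_snd_isometry.
  by apply: sum_snd_isometry => // z sz; exists z; split=> //; rewrite subrr anorm0 mulr0.
- by split.
- by move=> w [].
- move=> y dy; apply: attained_inf => [w [_ <-]|]; first by case: (tn_bounds w).
  have [dk Dk] := kappa_dirac dy.
  exists (kappa y, y) => //; apply/tunnel_norm_leP; split=> //=.
    by rewrite /gnS Dk !(isometry_nrm kappa_iso).
  by rewrite subrr nrm0 mulr_ge0 ?addr_ge0 ?nrm_ge0// ltW.
Qed.

Lemma small_tunnel (e : R) :
  exists tau : metrical_tunnel Om Om' Omod Oinn (metCor T) (metCor S),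
    (magnitude tau e <= (2 * eps)%:E)%E.
Proof.
(* The tunnel runs from T to S, so the second projection comes first. *)
exists (MetricalTunnel tunnel_metrical snd_isometry fst_isometry).
have le2 : eps <= 2 * eps by rewrite ler_peMl ?(ltW eps0)// ler1n.
have eps_le : (eps%:E <= (2 * eps)%:E)%E by rewrite lee_fin.
have cC := complex_state_ex R.
rewrite /magnitude ge_max; apply/andP; split.
  rewrite /tunnel_extent ge_max; apply/andP; split; rewrite /extent ge_max; apply/andP; split.
  - apply: le_trans eps_le.
    exact (sum_hausdorff_snd (lipD S) (lipD T) iota_star states_S states_T eps0).
  - apply: le_trans eps_le.
    apply (sum_hausdorff_fst (lipD S) (lipD T) states_S states_T eps0) => phi sphi.
    exact (state_extension sT sS kappa_iso kappa_act sphi).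
  - have id_star : star_preserving (idfun : {lrmorphism C -> C}) by [].
    exact (sum_hausdorff_snd (trivial_lip R) (trivial_lip R) id_star cC cC eps2).
  - apply (sum_hausdorff_fst (trivial_lip R) (trivial_lip R)
      (iota := (idfun : {lrmorphism C -> C})) cC cC eps2).
    by move=> phi sphi; exists phi.
rewrite ge_max; apply/andP; split.
  apply: ge_ereal_sup => _ [y [dy yn] <-].
  have [dk Dk] := kappa_dirac dy.
  have yn' : nrm (kappa y) + nrm (DS (kappa y)) <= 1 by rewrite Dk !(isometry_nrm kappa_iso).
  apply: le_trans (ereal_inf_lbound _) _; first by exists (kappa y).
  apply: ge_ereal_sup => _ [[w t] [/= _ wn _] <-].
  have [_ _ w3] := tn_bounds w.
  (* Both pairings now involve the same evolved vector kappa (exp(itD_T) y), and the gap is its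
     pairing with kappa w.2 - w.1. *)
  rewrite lee_fin /= -expi_in -kappa_iso -hdotBr; apply: le_trans (cauchy_schwarz _ _) _.
  rewrite (isometry_nrm kappa_iso) expi_nrm nrmBC.
  have y1 : nrm y <= 1 by apply: le_trans yn; rewrite lerDl nrm_ge0.
  have w3' : nrm (w.1 - kappa w.2) <= eps by apply: le_trans w3 _; rewrite ler_piMr// ltW.
  by rewrite -[2 * eps]mul1r ler_pM ?nrm_ge0// (le_trans w3').
apply: ge_ereal_sup => _ [x [dx xn] <-].
have [dy Dy] := adjoint_intertwines dT dS kappa'P kappa_dirac dx.
apply: le_trans (ereal_inf_lbound _) _; first exists (kappa' x) => //.
  split=> //; rewrite /= Dy; apply: le_trans xn.
  by rewrite lerD// (adjoint_nrm kappa_iso kappa'P).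
apply: ge_ereal_sup => _ [[w t] [/= _ wn _] <-].
have [_ _ w3] := tn_bounds w.
have E u : hdot HT (kappa' u) w.2 = hdot HS u (kappa w.2) by rewrite hdotC -kappa'P -hdotC.
rewrite lee_fin /= -expi_out E -hdotBr; apply: le_trans (cauchy_schwarz _ _) _.
rewrite expi_nrm.
have x1 : nrm x <= 1 by apply: le_trans xn; rewrite lerDl nrm_ge0.
have w3' : nrm (w.1 - kappa w.2) <= eps by apply: le_trans w3 _; rewrite ler_piMr// ltW.
by rewrite -[2 * eps]mul1r ler_pM ?nrm_ge0// (le_trans w3').
Qed.
End Tunnel.

(** * Inductive limits *)

Section InductiveLimit.
Variables (R : realType) (S : nat -> spectralData R) (Soo : spectralData R).
Variable iota : forall n, {lrmorphism salg (S n) -> salg Soo}.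
Variable kappa : forall n, {linear shil (S n) -> shil Soo}.
Hypothesis hlim : inductive_limit iota kappa.
Hypothesis hS : forall n, metric_spectral_triple (S n).
Hypothesis hSoo : metric_spectral_triple Soo.
Local Notation Hoo := (shil Soo).
Local Notation Doo := (Defs.dirac Soo).

Lemma limit_adjoints : exists Ks : forall n, {linear Hoo -> shil (S n)},
  forall n x y, hdot Hoo (kappa n x) y = hdot (shil (S n)) x (Ks n y).
Proof.
have ex n : exists Ks : {linear Hoo -> shil (S n)},
    forall x y, hdot Hoo (kappa n x) y = hdot (shil (S n)) x (Ks y).
  apply: contraction_adjoint => x.
  by rewrite (isometry_nrm (il_isometry hlim (n := n))).
by exists (fun n => sval (cid (ex n))) => n; exact: svalP (cid (ex n)).
Qed.

Lemma limit_incr n m : (n <= m)%N -> range (kappa n) `<=` range (kappa m).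
Proof.
elim: m => [|m ih]; first by rewrite leqn0 => /eqP ->.
rewrite leq_eqVlt => /orP[/eqP->//|/ih h].
by move=> x /h; exact: (il_hincr hlim).
Qed.

Lemma limit_intertwines n : intertwines (Defs.dirac (S n)) Doo (kappa n).
Proof. exact: (il_dirac hlim). Qed.

Variable Ks : forall n, {linear Hoo -> shil (S n)}.
Hypothesis KsP : forall n x y, hdot Hoo (kappa n x) y = hdot (shil (S n)) x (Ks n y).

Lemma projections_cvg x (e : R) : 0 < e ->
  exists N, forall n, (N <= n)%N -> nrm (x - kappa n (Ks n x)) < e.
Proof.
move=> e0.
have : closure (\bigcup_n range (kappa n)) x by rewrite (il_hdense hlim).
move=> /closure_nrmP/(_ e e0)[y [N _ Ny] xy]; exists N => n Nn.
have [z _ zy] := limit_incr Nn Ny; rewrite -zy in xy.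
exact: le_lt_trans (projection_best (il_isometry hlim (n := n)) (@KsP n) x z) xy.
Qed.

(** On a finite e / 2 net of the compact graph-norm ball pointwise convergence suffices. For x near
    a net point y, [projection_best] gives |x - P x| <= |x - P y| <= |x - y| + |y - P y|. *)
Lemma projections_uniform (e : R) : 0 < e ->
  exists N, forall n, (N <= n)%N -> forall x, odom Doo x ->
    nrm (x - kappa n (Ks n x)) <= e * (nrm x + nrm (Doo x)).
Proof.
move=> e0; have sD := st_self_adjoint hSoo.1.
have cK := graph_ball_compact sD (st_compact hSoo.1).
have e2 : 0 < e / 2 by rewrite divr_gt0.
have [s sP] := compact_net e2 (compact_precompact (@norm_hausdorff _ Hoo) cK).
have [N NP] : exists N, forall n, (N <= n)%N -> forall y, y \in s ->
    nrm (y - kappa n (Ks n y)) < e / 2.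
  elim: s {sP} => [|y s [N1 ih]]; first by exists 0%N.
  have [N2 yP] := projections_cvg y e2; exists (maxn N1 N2) => n.
  rewrite geq_max => /andP[n1 n2] z; rewrite inE => /predU1P[->|]; first exact: yP.
  exact: ih.
exists N => n Nn x dx; set g := nrm x + nrm (Doo x).
have [g0|g0] := eqVneq g 0.
  have x0 : nrm x = 0.
    apply/eqP; rewrite eq_le nrm_ge0 andbT -g0 lerDl nrm_ge0 //.
  by rewrite (nrm_eq0 x0) (linear0 (Ks n)) (linear0 (kappa n)) subrr nrm0 g0 mulr0.
have gp : 0 < g by rewrite lt_def g0 addr_ge0 ?nrm_ge0.
have ball x' : odom Doo x' -> nrm x' + nrm (Doo x') <= 1 -> nrm (x' - kappa n (Ks n x')) <= e.
  move=> dx' x'1; have [y ys xy] := sP x' (conj dx' x'1).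
  apply: le_trans (projection_best (il_isometry hlim (n := n)) (@KsP n) x' (Ks n y)) _.
  have := nrm_tri y x' (kappa n (Ks n y)); have := NP _ Nn _ ys; lra.
have := ball (g^-1%:C *: x) (sa_domZ sD _ dx).
rewrite (sa_Z sD _ dx) (linearZ_LR (Ks n)) (linearZ_LR (kappa n)) -scalerBr !nrmZr -mulrDr.
rewrite ger0_norm ?invr_ge0 ?(ltW gp)//.
by rewrite mulVf// => /(_ (lexx _)); rewrite ler_pdivrMl// mulrC.
Qed.
End InductiveLimit.

(** The fibre of an injective map is a single point, so the infimum is over one value. *)
Lemma injective_isometry_lip (R : realType) (A B : cstarAlgType R)
    (LA : seminorm A) (LB : seminorm B) (f : {lrmorphism A -> B}) a :
  quantum_isometry LA LB f -> injective f -> ldom LA a -> LB (f a) = LA a.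
Proof.
move=> [_ _ fdom finf] fI da; have := finf _ (fdom _ da).
have -> : [set (LA a')%:E | a' in [set a' | ldom LA a' /\ f a' = f a]] = [set (LA a)%:E].
  rewrite eqEsubset; split=> [_ [a' [_ /fI ->] <-]//|_ ->].
  by exists a.
by rewrite ereal_inf1 => -[].
Qed.

(** The bridge is fed the preimage of a under f in one direction, and its output is moved by f in
    the other; both moves preserve the seminorm. *)
Lemma identity_bridge (R : realType) (S : nat -> spectralData R) (Soo : spectralData R)
    (iota : forall n, {lrmorphism salg (S n) -> salg Soo})
    (f : {lrmorphism salg Soo -> salg Soo}) :
  (forall n, metric_spectral_triple (S n)) -> metric_spectral_triple Soo ->
  full_quantum_isometry (lipD Soo) (lipD Soo) f ->
  bridge_builder (fun n => lipD (S n)) (lipD Soo) iota f ->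
  forall e : R, 0 < e -> exists N, forall n, (N <= n)%N ->
    (forall a, ldom (lipD Soo) a -> exists b, [/\ ldom (lipD (S n)) b,
       lipD (S n) b <= lipD Soo a & anorm (a - iota n b) <= e * lipD Soo a]) /\
    (forall b, ldom (lipD (S n)) b -> exists a, [/\ ldom (lipD Soo) a,
       lipD Soo a <= lipD (S n) b & anorm (a - iota n b) <= e * lipD (S n) b]).
Proof.
move=> hS hSoo [fq [g [fK gK gq]]] [_ _ fb] e e0; have [N NP] := fb e e0.
have scaled (x s : R) : lt_scaled x e s -> x <= e * s.
  by rewrite /lt_scaled; case: eqP => [-> |_ /ltW//]; rewrite mulr0.
exists N => n /NP[bin bout]; split=> [a da|b db].
  have dga : ldom (lipD Soo) (g a) by case: gq => _ _ h _; exact: h.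
  have [b [db lb ab]] := bin _ dga.
  rewrite (injective_isometry_lip gq (can_inj gK) da) gK in lb ab.
  by exists b; split=> //; exact: scaled.
have [a [da la ab]] := bout _ db; exists (f a); split.
- by case: fq => _ _ h _; exact: h.
- by rewrite (injective_isometry_lip fq (can_inj fK) da).
- exact: scaled.
Qed.

Theorem theorem3p17 (R : realType) (Om Om' Omod Oinn : R)
    (hOm : 1 <= Om) (hOm' : 0 <= Om') (hOmod : 2 <= Omod) (hOinn : 1 <= Oinn)
    (S : nat -> spectralData R) (Soo : spectralData R)
    (iota : forall n, {lrmorphism salg (S n) -> salg Soo})
    (kappa : forall n, {linear shil (S n) -> shil Soo})
    (hS : forall n, metric_spectral_triple (S n))
    (hSoo : metric_spectral_triple Soo)
    (hlim : inductive_limit iota kappa)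
    (hbridge : exists f : {lrmorphism salg Soo -> salg Soo},
       full_quantum_isometry (lipD Soo) (lipD Soo) f /\
       bridge_builder (fun n => lipD (S n)) (lipD Soo) iota f) :
  (fun n => spectral_propinquity Om Om' Omod Oinn (S n) Soo) @ \oo --> (0 : R).
Proof.
have [f [fq fb]] := hbridge.
have [Ks KsP] := limit_adjoints hlim.
have sS n : self_adjoint (Defs.dirac (S n)) := st_self_adjoint (hS n).1.
have [N1 compat] := expi_compat sS (st_self_adjoint hSoo.1) (il_isometry hlim) KsP
  (limit_intertwines hlim) (limit_incr hlim) (projections_cvg hlim KsP).
apply/cvgrPdist_le => e e0.
(* A tunnel with eps = e / 3 has magnitude at most 2e / 3 < e, which puts e in the set whose infimum
   is the propinquity. *)
have e3 : 0 < e / 3 by rewrite divr_gt0.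
have [N2 approx] := projections_uniform hlim hSoo KsP e3.
have [N3 bridge] := identity_bridge hS hSoo fq fb e3.
exists (maxn (maxn N1 N2) N3) => // n /=.
rewrite !geq_max => /andP[/andP[n1 n2] n3].
have [c1 c2] := compat _ n1; have [b1 b2] := bridge _ n3.
have [tau taue] := small_tunnel hSoo (hS n) hOm hOm' hOmod hOinn (il_star hlim (n := n))
  (il_isometry hlim (n := n)) (@KsP n) (il_act hlim (n := n)) (limit_intertwines hlim (n := n))
  e3 (approx _ n2) b1 b2 c1 c2 e.
rewrite sub0r normrN /spectral_propinquity; set X := [set _] `|` _.
have X0 : lbound X 0.
  by move=> x [->|[/ltW//]]; rewrite divr_ge0 ?sqrtr_ge0.
rewrite ger0_norm; last by apply: lb_le_inf => //; exists (Num.sqrt 2 / 2); left.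
apply: ge_inf; first by exists 0.
right; split=> //; exists tau; apply: le_lt_trans taue _; rewrite lte_fin.
lra.
Qed.
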